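(* Let $\mathbb{F}_q$ be a finite field of characteristic $p$ and let $n$ be a positive integer with $p>n$. Let $P(n)$ be the set of partitions of $n$, let $\Gamma=\{\{\lambda,\lambda'\}:\lambda\in P(n),\ \lambda\neq\lambda'\}$, and let $\Delta=\{\lambda=\lambda'\in P(n):\sqrt{p_\lambda}\in\mathbb{F}_q\}$, i.e. the set of self-conjugate $\lambda\in P(n)$ such that the integer $p_\lambda$, viewed in $\mathbb{F}_q$, is a square in $\mathbb{F}_q$. Then the Wedderburn–Artin decomposition of $\mathbb{F}_qA_n$ is given by $$\mathbb{F}_qA_n=\left(\bigoplus_{\gamma=\{\lambda,\lambda'\}\in\Gamma}I_\gamma\right)\oplus\left(\bigoplus_{\lambda=\lambda'\notin\Delta}I_\lambda\right)\oplus\left(\bigoplus_{\lambda\in\Delta}(I_{\lambda+}\oplus I_{\lambda-})\right),$$ where $I_\gamma\cong M_{d_\lambda}(\mathbb{F}_q)$ if $\gamma=\{\lambda,\lambda'\}\in\Gamma$; $I_\lambda\cong M_{d_\lambda/2}(\mathbb{F}_{q^2})$ if $\lambda=\lambda'\notin\Delta$; and $I_{\lambda\pm}\cong M_{d_\lambda/2}(\mathbb{F}_q)$ if $\lambda=\lambda'\in\Delta$.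
   Context: $A_n$ is the alternating group of degree $n$. The summands are minimal two-sided ideals of the semisimple algebra $\mathbb{F}_qA_n$. For $\lambda=(\lambda_1,\ldots,\lambda_k)\in P(n)$, $\lambda'=(\lambda_1',\ldots,\lambda_l')$ denotes the conjugate partition (transposed Young diagram), and $d_\lambda$ is the number of standard Young tableaux of shape $\lambda$. The hook number at position $(i,j)$ of the Young diagram is $h_{ij}(\lambda)=\lambda_i+\lambda_j'-(i+j)+1$. For $\lambda=\lambda'$, let $r$ be the number of boxes on the main diagonal of the diagram of $\lambda$, with diagonal hook numbers $h_{11}(\lambda),\ldots,h_{rr}(\lambda)$, and put $$p_\lambda=(-1)^{(n-r)/2}\prod_{i=1}^r h_{ii}(\lambda).$$
   Formalization: The formal theorem takes n ≥ 2 instead of n ≥ 1: for n = 1 the only partition is self-conjugate with p_λ = 1 a square and d_λ = 1, so the claimed summands M_{1/2}(F_q) are undefined. *)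

(* Defs.v *)
From HB Require Import structures.
From mathcomp Require Import all_boot all_order all_algebra.
From mathcomp Require Import all_fingroup all_solvable all_character.

Set Implicit Arguments.
Unset Strict Implicit.
Unset Printing Implicit Defensive.

Import GRing.Theory.
Local Open Scope ring_scope.

(* A partition of n is its sequence of parts in nonincreasing order, padded   *)
(* with zeros to length n.  Rows and columns are numbered from 0.             *)
Definition is_part n (f : {ffun 'I_n -> 'I_n.+1}) : bool :=
  [forall i : 'I_n, forall j : 'I_n, (i <= j)%N ==> (f j <= f i)%N]
  && (\sum_(i < n) f i == n)%N.

Record part n :=
  Part { part_val : {ffun 'I_n -> 'I_n.+1}; part_valP : is_part part_val }.

HB.instance Definition _ n := [isSub for @part_val n].
HB.instance Definition _ n := [Finite of part n by <:].

Definition row_len n (lam : part n) (i : 'I_n) : nat := part_val lam i.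
Definition col_len n (lam : part n) (j : 'I_n) : nat :=
  #|[set i : 'I_n | (j < row_len lam i)%N]|.

Lemma conj_subproof n (lam : part n) :
  is_part [ffun j : 'I_n => inord (col_len lam j)].
Proof.
have col_le j : (col_len lam j < n.+1)%N.
  by rewrite ltnS -[leqRHS]card_ord max_card.
have E (j : 'I_n) :
    [ffun k : 'I_n => inord (col_len lam k) : 'I_n.+1] j = col_len lam j :> nat.
  by rewrite ffunE inordK.
apply/andP; split.
  apply/forallP=> i; apply/forallP=> j; apply/implyP=> le_ij; rewrite !E.
  by apply/subset_leq_card/subsetP=> k; rewrite !inE; apply: leq_ltn_trans.
have /andP[_ /eqP sum_lam] := part_valP lam.
apply/eqP; rewrite -[RHS]sum_lam (eq_bigr _ (fun j _ => E j)).
rewrite (eq_bigr (fun j : 'I_n => \sum_(i < n) (j < row_len lam i))%N); last first.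
  move=> j _; rewrite /col_len -sum1_card big_mkcond.
  by apply: eq_bigr => i _; rewrite inE; case: ltnP.
rewrite exchange_big; apply: eq_bigr => i _.
have le_n : (row_len lam i <= n)%N by rewrite -ltnS ltn_ord.
transitivity (\sum_(j < n | (j < row_len lam i)%N) 1)%N.
  by rewrite [RHS]big_mkcond; apply: eq_bigr => j _; case: ltnP.
by rewrite -(big_ord_widen n (fun=> 1%N) le_n) sum1_card card_ord.
Qed.

Definition conj_part n (lam : part n) : part n := Part (conj_subproof lam).

Definition box n (lam : part n) : finType :=
  {b : 'I_n * 'I_n | (b.2 < row_len lam b.1)%N}.

(* The entries of a tableau are 0, ..., n.-1; an injective filling of the n   *)
(* boxes uses each of them exactly once.                                      *)
Definition is_SYT n (lam : part n) (T : {ffun box lam -> 'I_n}) : bool :=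
  [&& injectiveb T,
      [forall b : box lam, forall c : box lam,
         ((val b).1 == (val c).1) && ((val b).2 < (val c).2)%N
         ==> (T b < T c)%N]
    & [forall b : box lam, forall c : box lam,
         ((val b).2 == (val c).2) && ((val b).1 < (val c).1)%N
         ==> (T b < T c)%N]].

Definition nSYT n (lam : part n) : nat :=
  #|[set T : {ffun box lam -> 'I_n} | is_SYT T]|.

(* With 0-based indices, lambda_i + lambda'_j - (i + j) + 1 becomes           *)
(* lambda_i + lambda'_j - (i + j + 1); the natural subtraction is exact when  *)
(* (i, j) is a box of the diagram.                                            *)
Definition hook n (lam : part n) (i j : 'I_n) : nat :=
  (row_len lam i + row_len (conj_part lam) j - (i + j + 1))%N.

Definition on_diag n (lam : part n) (i : 'I_n) : bool := (i < row_len lam i)%N.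

Definition diag_len n (lam : part n) : nat := #|[set i | on_diag lam i]|.

(* For lam = conj_part lam, n - diag_len lam is even.                         *)
Definition p_part n (lam : part n) : int :=
  (-1) ^+ (n - diag_len lam)./2 * (\prod_(i < n | on_diag lam i) hook lam i i)%N%:Z.

Definition Gamma n : {set {set part n}} :=
  [set [set lam; conj_part lam] | lam : part n & lam != conj_part lam].

Definition selfconj n : {set part n} := [set lam | lam == conj_part lam].

Definition Delta (F : finFieldType) n : {set part n} :=
  [set lam in selfconj n | [exists x : F, x ^+ 2 == (p_part lam)%:~R]].

(* Algebras of matrices are given by the row space of their mxvec encodings,  *)
(* as in mxalgebra.                                                           *)
Definition minimal_mx_ideal (F : fieldType) m N (R : 'A[F]_(m, N))
    (I : 'A[F]_N) : Prop :=
  [/\ (I <= R)%MS, mx_ideal R I, I != 0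
    & forall J : 'A[F]_N, mx_ideal R J -> (J <= I)%MS -> J != 0 -> (I <= J)%MS].

(* I is isomorphic, as an F-algebra, to the d x d matrices over K, where K is *)
(* an extension of F via iota.  The isomorphism g goes from 'M[K]_d onto I.   *)
Definition iso_full_matrix (F K : fieldType) (iota : F -> K) N
    (I : 'A[F]_N) (d : nat) : Prop :=
  exists g : 'M[K]_d -> 'M[F]_N,
    [/\ {morph g : X Y / X + Y},
        {morph g : X Y / X *m Y},
        forall (a : F) (X : 'M[K]_d), g (iota a *: X) = a *: g X,
        injective g
      & forall A : 'M[F]_N, (A \in I)%MS <-> exists X, g X = A].

(* Main.v *)
(** Since p > n, Young's seminormal form makes sense over F and defines an
    action of S_n on the span V of all standard tableaux of size n, once the
    Coxeter relations are checked.  The image of F[S_n] contains the diagonal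
    matrices of contents (these are the Jucys-Murphy elements); content vectors
    separate standard tableaux modulo p, so the image contains all diagonal
    idempotents, and since adjacent swaps connect the tableaux of a given shape,
    it is the algebra of all matrices that are block diagonal with respect to
    shapes.  As the squares of the numbers d_lambda add up to n!, this gives
    F[S_n] = prod_lambda M_(d_lambda)(F).

    Let J send a tableau T to kappa_T T', where the scalars kappa_T are chosen
    such that J s_i = - s_i J for all i.  Then F[A_n] is the centraliser of J in
    the block diagonal matrices.  J exchanges the blocks of lambda and lambda',
    which gives one copy of M_(d_lambda)(F) for each pair; if lambda = lambda',
    J squares on the block of lambda to a scalar c, and the centraliser of J
    there is M_(d_lambda/2)(F[X]/(X^2 - c)).  An explicit product formula for c
    over pairs of boxes, which cancel two by two under transposition except for
    the pairs {b, b'}, shows that c is p_lambda up to a nonzero square. *)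
From HB Require Import structures.
From mathcomp Require Import all_boot all_order all_algebra.
From mathcomp Require Import all_fingroup all_solvable all_field all_character.
From mathcomp Require Import zify ring.
Require Import Defs.

Set Implicit Arguments.
Unset Strict Implicit.
Unset Printing Implicit Defensive.

Import Order.TTheory GRing.Theory Num.Theory.
Local Open Scope ring_scope.

(** * Extending the Coxeter relations to the symmetric group *)

(** The seminormal form is used because its coefficients only need inverses of differences of
    contents; the orthogonal form would need square roots that F may lack. The bound p > n enters
    through hooks: two boxes of a diagram with k boxes have contents differing by less than k, so no
    denominator vanishes modulo p, and a similar count keeps the content vectors of different
    tableaux apart. All shapes act on one space, since J mixes the blocks of lambda and lambda'. On
    T the square of J is kappa_T kappa_T', and this is constant on a block because it is a product
    over the pairs of boxes of the shape, regardless of the entries. The condition n > 1 is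
    essential: for n = 1 the only partition is self-conjugate with d_lambda = 1, which cannot be
    halved. For n > 1 no tableau is its own transpose, so a self-conjugate block consists of two
    halves exchanged by J. Minimality of the ideals is not proved separately for each type: it
    follows from the isomorphisms, as full matrix rings over a field are simple. *)

Section CoxeterNormalForm.

Variables (T : Type) (mul : T -> T -> T) (e : T) (m : nat) (G : nat -> T).
Local Notation "x ** y" := (mul x y) (at level 40, left associativity).
Hypothesis mulA : associative mul.
Hypothesis mul1 : left_id e mul.
Hypothesis mulr1 : right_id e mul.
Hypothesis GG : forall i, (i < m)%N -> G i ** G i = e.
Hypothesis Gbraid : forall i, (i.+1 < m)%N ->
  G i ** G i.+1 ** G i = G i.+1 ** G i ** G i.+1.
Hypothesis Gcomm : forall i j, (i.+1 < j)%N -> (j < m)%N -> G i ** G j = G j ** G i.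

(* Normal forms are products over k of descending blocks G_(k-1) ... G_(k-j).  *)
Fixpoint cox_block k j : T :=
  if j is j'.+1 then cox_block k j' ** G (k - j) else e.

Fixpoint cox_nf k (x : T) : Prop :=
  if k is k'.+1 then
    exists y j, [/\ cox_nf k' y, (j <= k)%N & x = y ** cox_block k j]
  else x = e.

Lemma cox_block_comm k j i : (j <= k)%N -> (k <= m)%N -> (i.+1 < k - j)%N ->
  cox_block k j ** G i = G i ** cox_block k j.
Proof.
elim: j => [|j IHj] lejk lekm lti /=; first by rewrite mul1 mulr1.
rewrite -mulA -Gcomm; [|lia|lia].
by rewrite mulA IHj -?mulA //; lia.
Qed.

(** The new factor commutes leftwards until it meets the factors [G i] and [G i.-1] of the block;
    the braid relation lets it leave them as [G i.-1], which commutes with all that remains. *)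
Lemma cox_block_shift k j i : (j <= k)%N -> (k <= m)%N -> (k - j < i < k)%N ->
  cox_block k j ** G i = G i.-1 ** cox_block k j.
Proof.
elim: j => [|j IHj] lejk lekm lti /=; first lia.
have [eq_i | neq_i] := eqVneq i (k - j)%N; last first.
  rewrite -mulA (Gcomm (i := (k - j.+1)%N)); [|lia|lia].
  by rewrite mulA IHj ?mulA //; lia.
case: j => [|j] in lejk lti IHj eq_i *; first lia.
rewrite /= eq_i; set l := (k - j.+2)%N.
have -> : (k - j.+1 = l.+1)%N by rewrite /l; lia.
rewrite -!mulA (mulA (G l.+1)) -Gbraid; last by rewrite /l; lia.
by rewrite !mulA /= cox_block_comm //; rewrite /l; lia.
Qed.

(** Depending on i, the new factor commutes past the last block, lengthens it, cancels its last
    factor, or crosses it with its index lowered by one. What crosses the block is absorbed by the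
    induction hypothesis. *)
Lemma cox_nf_mulG k x i : (k <= m)%N -> (i < k)%N -> cox_nf k x -> cox_nf k (x ** G i).
Proof.
elim: k x i => [|k IHk] x i lekm ltik //= [y [j [nfy lej ->]]].
have [lt_i | ge_i] := ltnP i.+1 (k.+1 - j).
  exists (y ** G i), j; split=> //; first by apply: IHk => //; lia.
  by rewrite -!mulA cox_block_comm.
have [eq_i | neq_i] := eqVneq i.+1 (k.+1 - j)%N.
  exists y, j.+1; split=> //=; first lia.
  by rewrite -mulA; congr (_ ** (_ ** G _)); lia.
have [eq_i' | neq_i'] := eqVneq i (k.+1 - j)%N.
  case: j => [|j] in lej ge_i neq_i eq_i' *; first lia.
  exists y, j; split=> //; first lia.
  by rewrite /= -!mulA eq_i' GG ?mulr1 //; lia.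
exists (y ** G i.-1), j; split=> //; first by apply: IHk => //; lia.
by rewrite -!mulA cox_block_shift //; lia.
Qed.

Lemma cox_nf1 k : cox_nf k e.
Proof. by elim: k => //= k IHk; exists e, 0%N; split=> //=; rewrite mul1. Qed.

Definition cox_eval w := foldl (fun x i => x ** G i) e w.

Lemma cox_nf_eval w : all (fun i => i < m)%N w -> cox_nf m (cox_eval w).
Proof.
elim/last_ind: w => [|w i IHw]; first by rewrite /= => _; apply: cox_nf1.
rewrite all_rcons /cox_eval foldl_rcons => /andP[lti /IHw nfw].
exact: cox_nf_mulG.
Qed.

Lemma cox_eval_cat u v : cox_eval (u ++ v) = cox_eval u ** cox_eval v.
Proof.
elim/last_ind: v => [|v i IHv]; first by rewrite cats0 mulr1.
by rewrite -rcons_cat /cox_eval !foldl_rcons mulA -/(cox_eval _) IHv.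
Qed.

Lemma cox_eval_rev w : all (fun i => i < m)%N w -> cox_eval w ** cox_eval (rev w) = e.
Proof.
elim: w => [|i w IHw] /=; first by rewrite mul1.
case/andP=> lti ltw; rewrite rev_cons -cats1 cox_eval_cat.
rewrite -[i :: w]cat1s cox_eval_cat -mulA (mulA (cox_eval w)) IHw //.
by rewrite mul1 /cox_eval /= mul1 GG.
Qed.

End CoxeterNormalForm.

(** * Adjacent transpositions and the extension theorem *)

Definition adj_tperm m i : {perm 'I_m.+1} := tperm (inord i) (inord i.+1).

Section AdjacentTranspositions.

Variable m : nat.
Local Notation s := (@adj_tperm m).

Lemma adj_tpermK i : (s i * s i = 1)%g. Proof. exact: tperm2. Qed.

Lemma adj_tpermE i (x : 'I_m.+1) : (i < m)%N ->
  s i x = (if x == i :> nat then i.+1 else if x == i.+1 :> nat then i else x) :> nat.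
Proof.
move=> lti; rewrite /adj_tperm; case: tpermP => [->|->|].
- by rewrite !inordK ?eqxx //; lia.
- by rewrite !inordK; try lia; do ![case: eqP => //]; lia.
move=> /eqP; rewrite -val_eqE /= inordK; last lia.
move=> /negbTE-> /eqP; rewrite -val_eqE /= inordK; last lia.
by move=> /negbTE->.
Qed.

Lemma adj_tperm_braid i : (i.+1 < m)%N ->
  (s i * s i.+1 * s i = s i.+1 * s i * s i.+1)%g.
Proof.
move=> lti; apply/permP=> x; apply: val_inj; rewrite !permM /=.
rewrite !adj_tpermE; try lia.
by do ![case: eqP => //=]; lia.
Qed.

Lemma adj_tperm_comm i j : (i.+1 < j)%N -> (j < m)%N -> (s i * s j = s j * s i)%g.
Proof.
move=> lti ltj; apply/permP=> x; apply: val_inj; rewrite !permM /=.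
rewrite !adj_tpermE; try lia.
by do ![case: eqP => //=]; lia.
Qed.

Lemma adj_tperm_odd i : (i < m)%N -> odd_perm (s i).
Proof. by move=> lti; rewrite odd_tperm -val_eqE /= !inordK; lia. Qed.

Lemma perm_descent (w : {perm 'I_m.+1}) : w != 1%g ->
  exists2 i, (i < m)%N & (w (inord i.+1) < w (inord i))%N.
Proof.
move=> w_neq1.
have [/existsP[i] ltw | ] := boolP [exists i : 'I_m, w (inord i.+1) < w (inord i)]%N.
  by exists i.
rewrite negb_exists => /forallP noDesc; case/eqP: w_neq1.
have incr i : (i < m)%N -> (w (inord i) < w (inord i.+1))%N.
  move=> lti; have := noDesc (Ordinal lti); rewrite -leqNgt /= leq_eqVlt.
  case/orP=> // /eqP /val_inj /perm_inj /(congr1 val) /=.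
  by rewrite !inordK; lia.
(* A permutation without descents is increasing, so w i is at least i, counting from the left, and
   at most i, counting from the right. *)
have ge i : (i <= m)%N -> (i <= w (inord i))%N.
  by elim: i => // i IHi lti; apply: leq_ltn_trans (incr i lti); apply: IHi; lia.
have le i : (i <= m)%N -> (w (inord (m - i)) <= m - i)%N.
  elim: i => [|i IHi] lei; first by rewrite subn0 -ltnS.
  have := incr (m - i.+1)%N; have := IHi (ltnW lei).
  by rewrite subnSK // => h1 h2; have := h2 ltac:(lia); lia.
apply/permP=> x; apply: val_inj; rewrite perm1 /=.
have lexm : (x <= m)%N by rewrite -ltnS.
have := le (m - x)%N (leq_subr _ _); have := ge x lexm.
by rewrite subKn // inord_val; lia.
Qed.

(** The bounded quantity [M] replaces the length: by the rearrangement inequality it strictly grows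
    when a descent is swapped. *)
Lemma perm_adj_ind (P : {perm 'I_m.+1} -> Prop) : P 1%g ->
    (forall i (w : {perm 'I_m.+1}), (i < m)%N ->
       (w (inord i.+1) < w (inord i))%N ->
       P (s i * w)%g -> P w) ->
  forall w, P w.
Proof.
move=> P1 PS w; pose M (w : {perm 'I_m.+1}) := (\sum_(x < m.+1) x * w x)%N.
have M_le v : (M v <= m.+1 * (m * m))%N.
  rewrite -[X in (_ <= X * _)%N]card_ord -sum_nat_const; apply: leq_sum => x _.
  by apply: leq_mul; rewrite -ltnS.
have [k] := ubnP (m.+1 * (m * m) - M w)%N.
elim: k => // k IHk in w *; rewrite ltnS => leMk.
have [-> // | /perm_descent[i lti ltw]] := eqVneq w 1%g.
apply: (PS i) => //; apply: IHk; apply: leq_trans leMk.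
suff ltM : (M w < M (s i * w)%g)%N by have := M_le (s i * w)%g; lia.
have -> : M (s i * w)%g = (\sum_(x < m.+1) s i x * w x)%N.
  rewrite /M (reindex_inj (@perm_inj _ (s i))) /=.
  by apply: eq_bigr => x _; rewrite permM tpermK.
have neq : inord i.+1 != inord i :> 'I_m.+1 by rewrite -val_eqE /= !inordK; lia.
rewrite /M !(bigD1 (inord i : 'I_m.+1) (P := predT)) //=.
rewrite !(bigD1 (inord i.+1 : 'I_m.+1) (P := predC1 _)) //=.
rewrite [X in (_ < _ + (_ + X))%N](eq_bigr (fun x : 'I_m.+1 => (x * w x)%N)); last first.
  by move=> x /andP[nx nx1]; rewrite /adj_tperm tpermD // eq_sym.
by rewrite /adj_tperm tpermL tpermR !inordK; lia.
Qed.

End AdjacentTranspositions.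

(** The image of the point k reveals the length j of the block. *)
Lemma adj_block_perm m k j (x : 'I_m.+1) : (j <= k)%N -> (k <= m)%N ->
  let b := cox_block mulg 1%g (@adj_tperm m) k j in
  ((x = k :> nat) -> b x = k - j :> nat)%N /\ ((k < x)%N -> b x = x).
Proof.
elim: j => [|j IHj] lejk lekm /=; first by rewrite perm1 subn0.
have [IH1 IH2] := IHj (ltnW lejk) lekm; split=> [xk | ltkx]; rewrite permM.
  by rewrite adj_tpermE ?IH1 //; try lia; do ![case: eqP => //=]; lia.
by apply: val_inj; rewrite IH2 //= adj_tpermE; try lia; do ![case: eqP => //=]; lia.
Qed.

Section CoxeterExtension.

Variables (m : nat) (T : Type) (mul : T -> T -> T) (e : T) (G : nat -> T).
Local Notation "x ** y" := (mul x y) (at level 40, left associativity).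
Hypothesis mulA : associative mul.
Hypothesis mul1 : left_id e mul.
Hypothesis mulr1 : right_id e mul.
Hypothesis GG : forall i, (i < m)%N -> G i ** G i = e.
Hypothesis Gbraid : forall i, (i.+1 < m)%N ->
  G i ** G i.+1 ** G i = G i.+1 ** G i ** G i.+1.
Hypothesis Gcomm : forall i j, (i.+1 < j)%N -> (j < m)%N -> G i ** G j = G j ** G i.

(** Words are evaluated in the symmetric group and in [T] at once. Normal forms in this product show
    that the permutation forces the value in [T], without any count of normal forms. *)
Let mul2 (x y : {perm 'I_m.+1} * T) := ((x.1 * y.1)%g, x.2 ** y.2).
Let e2 : {perm 'I_m.+1} * T := (1%g, e).
Let G2 i := (@adj_tperm m i, G i).
Let seval := cox_eval mulg 1%g (@adj_tperm m).
Let geval := cox_eval mul e G.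

Let mul2A : associative mul2.
Proof. by move=> x y z; rewrite /mul2 /= mulgA mulA. Qed.

Let eval2 w : cox_eval mul2 e2 G2 w = (seval w, geval w).
Proof.
elim/last_ind: w => // w i IHw.
by rewrite /seval /geval /cox_eval !foldl_rcons -!/(cox_eval _ _ _ _) IHw.
Qed.

Let block2 k j : cox_block mul2 e2 G2 k j =
  (cox_block mulg 1%g (@adj_tperm m) k j, cox_block mul e G k j).
Proof. by elim: j => //= j ->. Qed.

Let cox_nf_fix k x (i : 'I_m.+1) : (k <= m)%N -> (k < i)%N ->
  cox_nf mul2 e2 G2 k x -> x.1 i = i.
Proof.
elim: k x => [|k IHk] x lekm lti /= => [-> |]; first by rewrite perm1.
case=> y [j [nfy lej ->]]; rewrite block2 /= permM IHk //; [|lia|lia].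
exact: (adj_block_perm _ lej lekm).2.
Qed.

(** The factors before the last block fix the top point, so that block alone moves it, to k.+1 - j.
    If the permutation is trivial, then j = 0 and the block disappears. *)
Let cox_nf_perm1 k x : (k <= m)%N -> cox_nf mul2 e2 G2 k x -> x.1 = 1%g -> x.2 = e.
Proof.
elim: k x => [|k IHk] x lekm /= => [-> //|]; case=> y [j [nfy lej ->]].
rewrite block2 /= => eq1; have ltk : (k.+1 < m.+1)%N by [].
have := congr1 (fun w : {perm 'I_m.+1} => val (w (Ordinal ltk))) eq1.
rewrite /= permM perm1 (cox_nf_fix _ _ nfy) //; last exact: ltnW.
rewrite (adj_block_perm (Ordinal ltk) lej lekm).1 //= => eqk.
have j0 : j = 0%N by lia.
move: eq1; rewrite j0 /= mulg1 mulr1; apply: IHk => //; exact: ltnW.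
Qed.

Lemma cox_eval_perm1 w : all (fun i => i < m)%N w -> seval w = 1%g -> geval w = e.
Proof.
move=> ltw w1; have : cox_nf mul2 e2 G2 m (cox_eval mul2 e2 G2 w).
  apply: cox_nf_eval => // [x|x|i lti|i lti|i j lti ltj].
  - by case: x => x y; rewrite /mul2 mul1g mul1.
  - by case: x => x y; rewrite /mul2 mulg1 mulr1.
  - by rewrite /mul2 /= adj_tpermK GG.
  - by rewrite /mul2 /= adj_tperm_braid // Gbraid.
  by rewrite /mul2 /= adj_tperm_comm // Gcomm.
by rewrite eval2 => /cox_nf_perm1; apply.
Qed.

Lemma perm_word (x : {perm 'I_m.+1}) :
  exists2 w, all (fun i => i < m)%N w & seval w = x.
Proof.
elim/perm_adj_ind: x => [|i x lti _ [w ltw wE]]; first by exists [::].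
exists (i :: w); first by rewrite /= lti.
rewrite -cat1s /seval cox_eval_cat ?wE //; [|exact: mulgA|exact: mulg1].
by rewrite -/(seval w) wE /cox_eval /= mul1g mulgA adj_tpermK mul1g.
Qed.

Theorem coxeter_extension :
  exists rho : {perm 'I_m.+1} -> T,
    [/\ rho 1%g = e, forall x y, rho (x * y)%g = rho x ** rho y
      & forall i, (i < m)%N -> rho (adj_tperm m i) = G i].
Proof.
have [wd wdP] : exists wd : {perm 'I_m.+1} -> seq nat,
    forall x, all (fun i => i < m)%N (wd x) /\ seval (wd x) = x.
  apply: (fin_all_exists (P := fun x w => all (fun i => i < m)%N w /\ seval w = x)).
  by move=> x; have [w] := perm_word x; exists w.
(* Generators are involutions, so for two words of one permutation, u followed by the reversal of v
   spells the identity and has value [e] in [T]. *)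
have inj u v : all (fun i => i < m)%N u -> all (fun i => i < m)%N v ->
    seval u = seval v -> geval u = geval v.
  move=> ltu ltv uv.
  have ltr : all (fun i => i < m)%N (rev v) by rewrite all_rev.
  have vv := cox_eval_rev mulA mul1 mulr1 GG ltv.
  have := cox_eval_rev mulA mul1 mulr1 GG ltr; rewrite revK => vv'.
  have : geval (u ++ rev v) = e.
    apply: cox_eval_perm1; first by rewrite all_cat ltu.
    rewrite /seval cox_eval_cat; [|exact: mulgA|exact: mulg1].
    rewrite -/(seval u) uv; apply: (cox_eval_rev (m := m)) => //.
    - exact: mulgA.
    - exact: mul1g.
    - exact: mulg1.
    by move=> i _; apply: adj_tpermK.
  rewrite /geval cox_eval_cat // => /(congr1 (mul^~ (cox_eval mul e G v))).
  by rewrite -mulA vv' mulr1 mul1.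
exists (fun x => geval (wd x)); split=> [|x y|i lti].
- have [lt1 e1] := wdP 1%g; exact: cox_eval_perm1.
- have [ltx ex] := wdP x; have [lty ey] := wdP y; have [ltxy exy] := wdP (x * y)%g.
  rewrite -[RHS]cox_eval_cat //; apply: inj => //; first by rewrite all_cat ltx.
  by rewrite exy /seval cox_eval_cat -?/(seval _) ?ex ?ey //; [exact: mulgA|exact: mulg1].
have [lti' ei] := wdP (adj_tperm m i).
rewrite (inj _ [:: i]) //=; first by rewrite /geval /cox_eval /= mul1.
  by rewrite lti.
by rewrite ei /seval /cox_eval /= mul1g.
Qed.

End CoxeterExtension.

(** * Standard fillings and contents *)

Lemma nat_of_insubd n (o : 'I_n) x : (x < n)%N -> insubd o x = x :> nat.
Proof. by move=> ltx; rewrite -[LHS]/(val _) insubdK. Qed.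

Section StandardFillings.

Variable n : nat.
Local Notation bx := ('I_n * 'I_n)%type.

Definition box_le (b c : bx) := (b.1 <= c.1)%N && (b.2 <= c.2)%N.

Definition content (b : bx) : int := b.2%:Z - b.1%:Z.

Definition is_ideal (mu : {set bx}) :=
  [forall b, forall c, (box_le b c && (c \in mu)) ==> (b \in mu)].

Lemma is_idealP (mu : {set bx}) :
  reflect (forall b c, box_le b c -> c \in mu -> b \in mu) (is_ideal mu).
Proof.
apply: (iffP forallP) => [H b c lebc cmu | H b].
  by have /forallP/(_ c) := H b; rewrite lebc cmu.
by apply/forallP => c; apply/implyP => /andP[]; apply: H.
Qed.

Lemma box_le_anti b c : box_le b c -> box_le c b -> b = c.
Proof.
case: b c => [b1 b2] [c1 c2] /andP[/= le1 le2] /andP[/= ge1 ge2].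
by congr (_, _); apply: val_inj => /=; lia.
Qed.

(** One of two incomparable boxes lies strictly above and strictly to the right of the other; each
    coordinate adds at least 1 to the difference of contents. *)
Lemma box_le_total (b c : bx) : ~~ box_le b c -> ~~ box_le c b ->
  (2 <= `|content b - content c|)%N.
Proof. by rewrite /box_le /content; lia. Qed.

(** The ideal contains the hook at the origin whose arm reaches the column of b and whose leg
    reaches the row of c. This hook, enumerated by [g], has b.2 + c.1 + 1 boxes. *)
Lemma ideal_hook_bound (mu : {set bx}) (b c : bx) : is_ideal mu -> b \in mu -> c \in mu ->
  (b.2 + c.1 < #|mu|)%N.
Proof.
move=> /is_idealP idl bmu cmu.
have n_gt0 : (0 < n)%N by apply: leq_ltn_trans (ltn_ord b.1).
have [o o0] : exists o : 'I_n, o = 0%N :> nat by exists (Ordinal n_gt0).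
pose g (x : 'I_(b.2 + c.1).+1) : bx :=
  if (x <= b.2)%N then (o, insubd o (x : nat)) else (insubd o (x - b.2)%N, o).
have ltc := ltn_ord c.1; have ltb := ltn_ord b.2.
have g1 x : (g x).1 = (x - b.2)%N :> nat.
  have ltx := ltn_ord x; rewrite /g; case: ifP => hx; rewrite /= ?o0; first lia.
  by rewrite nat_of_insubd; lia.
have g2 x : (g x).2 = (if (x <= b.2)%N then x : nat else 0%N) :> nat.
  have ltx := ltn_ord x; rewrite /g; case: ifP => hx //=.
  by rewrite nat_of_insubd; lia.
have g_inj : injective g.
  move=> x y eqg; apply: val_inj => /=.
  have := congr1 (fun d : bx => (d.1 : nat)) eqg.
  have := congr1 (fun d : bx => (d.2 : nat)) eqg.
  by rewrite /= !g1 !g2; case: (leqP x b.2); case: (leqP y b.2); lia.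
rewrite -[X in (X <= _)%N]card_ord -(card_codom g_inj).
apply/subset_leq_card/subsetP => _ /codomP[x ->]; have ltx := ltn_ord x.
have [hx | hx] := leqP x b.2.
  by apply: idl bmu; rewrite /box_le g1 g2 hx; lia.
by apply: idl cmu; rewrite /box_le g1 g2 ifN -?ltnNge //; lia.
Qed.

Section Fillings.

Variable k : nat.
Implicit Types t u : {ffun 'I_k -> bx}.

(* A filling sends each entry to its box, so tableaux of all shapes live in   *)
(* one type; standardness says that every set {t 0, ..., t i} is an ideal.    *)
Definition std t := injectiveb t &&
  [forall i, forall b, box_le b (t i) ==> [exists j : 'I_k, (j <= i)%N && (t j == b)]].

Definition shape t : {set bx} := [set t i | i : 'I_k].

Lemma stdP t : reflect (injective t /\
    forall i b, box_le b (t i) -> exists2 j : 'I_k, (j <= i)%N & t j = b)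
  (std t).
Proof.
apply: (iffP andP) => [[/injectiveP injt /forallP H] | [injt H]]; split=> //.
- move=> i b leb; have /forallP/(_ b) := H i; rewrite leb.
  by case/existsP=> j /andP[lej /eqP]; exists j.
- exact/injectiveP.
apply/forallP=> i; apply/forallP=> b; apply/implyP=> /H[j lej tj].
by apply/existsP; exists j; rewrite lej tj /=.
Qed.

Lemma std_inj t : std t -> injective t. Proof. by case/stdP. Qed.

Lemma std_le t i j : std t -> box_le (t i) (t j) -> (i <= j)%N.
Proof. by case/stdP=> injt H /H[l lel /injt <-]. Qed.

Lemma std_shape t : std t -> is_ideal (shape t).
Proof.
case/stdP=> _ H; apply/is_idealP=> b c lebc /imsetP[i _ cE].
by move: lebc; rewrite cE => /H[j _ <-]; apply: imset_f.
Qed.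

Lemma card_shape t : std t -> #|shape t| = k.
Proof. by move=> /std_inj injt; rewrite card_imset // card_ord. Qed.

Lemma std_content_bound t i j : std t -> (`|content (t i) - content (t j)| < k)%N.
Proof.
move=> st; have idl := std_shape st.
have mem l : t l \in shape t by apply: imset_f.
have := ideal_hook_bound idl (mem i) (mem j); have := ideal_hook_bound idl (mem j) (mem i).
by rewrite card_shape // /content; lia.
Qed.

Lemma std_sep t u p : (k < p)%N -> std t -> std u ->
    (forall i : 'I_k, (p %| `|content (t i) - content (u i)|)%N) -> t = u.
Proof.
move=> ltkp st su eqc; apply/ffunP=> i.
have [l] := ubnP (val i); elim: l i => // l IHl i; rewrite ltnS /= => lei.
have IH (j : 'I_k) : (j < i)%N -> t j = u j by move=> ltj; apply: IHl; apply: leq_trans ltj _.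
have cmp v w : std v -> std w -> (forall j : 'I_k, (j < i)%N -> v j = w j) ->
    box_le (v i) (w i) -> v i = w i.
  move=> sv sw eqvw; case/stdP: sw => _ H /H[j]; rewrite leq_eqVlt.
  case/orP=> [/eqP/val_inj -> // | ltj wj].
  by have := std_inj sv (etrans (eqvw _ ltj) wj) => eqji; rewrite eqji ltnn in ltj.
have [|nle1] := boolP (box_le (t i) (u i)); first exact: cmp.
have [le2|nle2] := boolP (box_le (u i) (t i)).
  by symmetry; apply: cmp => // j ltj; rewrite IH.
have gt2 := box_le_total nle1 nle2.
pose mu := [set t j | j : 'I_k & (j < i)%N] :|: [set t i; u i].
have idl : is_ideal mu.
  apply/is_idealP=> b c lebc; rewrite !inE; case/or3P.
  - case/imsetP=> j; rewrite inE => ltj cE; move: lebc; rewrite cE.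
    case/stdP: st => _ H /H[j' lej' <-].
    by rewrite imset_f // inE (leq_ltn_trans lej').
  - move/eqP=> cE; move: lebc; rewrite cE; case/stdP: (st) => _ H /H[j' lej' <-].
    move: lej'; rewrite leq_eqVlt => /orP[/eqP/val_inj-> | ltj].
      by rewrite eqxx /= orbT.
    by rewrite imset_f // inE.
  move/eqP=> cE; move: lebc; rewrite cE; case/stdP: (su) => _ H /H[j' lej' <-].
  move: lej'; rewrite leq_eqVlt => /orP[/eqP/val_inj-> | ltj].
    by rewrite eqxx !orbT.
  by rewrite -IH // imset_f // inE.
have card_mu : (#|mu| <= i + 2)%N.
  apply: leq_trans (leq_card_setU _ _) _; apply: leq_add.
    apply: leq_trans (leq_imset_card _ _) _.
    rewrite -sum1_card (eq_bigl (fun j : 'I_k => (j < i)%N)).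
      by rewrite -(big_ord_widen k (fun=> 1%N)) ?sum1_card ?card_ord // ltnW.
    by move=> j; rewrite inE.
  by rewrite cards2; case: (_ == _).
have tmu : t i \in mu by rewrite !inE eqxx orbT.
have umu : u i \in mu by rewrite !inE eqxx !orbT.
have b1 := ideal_hook_bound idl tmu umu; have b2 := ideal_hook_bound idl umu tmu.
have := dvdn_leq (ltnW gt2) (eqc i).
have arith (a1 a2 c1 c2 N r : nat) : (a2 + c1 < N)%N -> (c2 + a1 < N)%N ->
    (N <= r + 2)%N -> (r < k)%N -> (p <= `|(a2%:Z - a1%:Z - (c2%:Z - c1%:Z))%R|)%N -> t i = u i.
  by move: ltkp; lia.
exact: (arith _ _ _ _ _ i b1 b2).
Qed.

Lemma std_between t i j b : std t -> box_le (t i) b -> box_le b (t j) ->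
  exists l : 'I_k, (i <= l <= j)%N /\ t l = b.
Proof.
move=> st le1 le2; case/stdP: (st) => _ H; have [l lel tl] := H _ _ le2.
by exists l; split; rewrite ?lel ?andbT //; apply: (std_le st); rewrite tl.
Qed.

End Fillings.

Section AdjacentSwaps.

Variable m : nat.
Implicit Types (t : {ffun 'I_m.+1 -> bx}) (w : {perm 'I_m.+1}).
Local Notation s := (@adj_tperm m).

Definition tperm_act t w : {ffun 'I_m.+1 -> bx} := [ffun i => t (w i)].

Lemma tperm_actM t u v : tperm_act (tperm_act t u) v = tperm_act t (v * u)%g.
Proof. by apply/ffunP=> i; rewrite !ffunE permM. Qed.

Lemma tperm_act1 t : tperm_act t 1%g = t.
Proof. by apply/ffunP=> i; rewrite ffunE perm1. Qed.

Lemma shape_act t w : shape (tperm_act t w) = shape t.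
Proof.
apply/setP=> b; apply/imsetP/imsetP => [[i _ ->] | [i _ ->]].
  by exists (w i); rewrite ?ffunE.
by exists ((w^-1)%g i); rewrite ?ffunE ?permKV.
Qed.

Lemma adj_tpermL i : s i (inord i) = inord i.+1. Proof. exact: tpermL. Qed.
Lemma adj_tpermR i : s i (inord i.+1) = inord i. Proof. exact: tpermR. Qed.
Lemma adj_tpermD i j : (i < m)%N -> (j <= m)%N -> j != i -> j != i.+1 ->
  s i (inord j) = inord j.
Proof.
move=> lti ltj ne1 ne2; rewrite /adj_tperm tpermD // -val_eqE /= !inordK //; try lia.
Qed.

Lemma std_adj t i : (i < m)%N -> std t ->
  std (tperm_act t (s i)) = ~~ box_le (t (inord i)) (t (inord i.+1)).
Proof.
move=> lti st; apply/idP/idP => [st' | nle].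
  apply/negP=> le; have : box_le (tperm_act t (s i) (inord i.+1)) (tperm_act t (s i) (inord i)).
    by rewrite !ffunE adj_tpermL adj_tpermR.
  by move/(std_le st'); rewrite !inordK; lia.
have [injt H] := stdP _ st; apply/stdP; split=> [x y | x b].
  by rewrite !ffunE => /injt/perm_inj.
rewrite ffunE => leb; have [j lej tj] := H _ _ leb.
exists (s i j); last by rewrite ffunE tpermK.
move: lej; rewrite !adj_tpermE //.
have [jE|] := eqVneq (j : nat) i; last by do ![case: eqP => //=]; lia.
have [xE|] := eqVneq (x : nat) i; last by do ![case: eqP => //=]; lia.
case/negP: nle; have -> : inord i = j by apply: val_inj; rewrite /= inordK; lia.
suff -> : inord i.+1 = s i x by rewrite tj.
by apply: val_inj; rewrite /= adj_tpermE // xE eqxx inordK.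
Qed.

Lemma std_adj_nle t i : (i < m)%N -> std t ->
  ~~ box_le (t (inord i.+1)) (t (inord i)).
Proof. by move=> lti st; apply/negP=> /(std_le st); rewrite !inordK; lia. Qed.

Lemma content_adj_std t i : (i < m)%N -> std t -> std (tperm_act t (s i)) ->
  (2 <= `|content (t (inord i.+1)) - content (t (inord i))|)%N.
Proof.
move=> lti st; rewrite std_adj // => nle.
by rewrite distnC; apply: box_le_total; rewrite ?std_adj_nle.
Qed.

(** If the swap is not standard, the boxes of i and i.+1 are comparable with no box between them,
    hence neighbours in a row or a column. *)
Lemma content_adj_nstd t i : (i < m)%N -> std t -> ~~ std (tperm_act t (s i)) ->
  `|content (t (inord i.+1)) - content (t (inord i))|%N = 1%N.
Proof.
move=> lti st; rewrite std_adj // negbK => le.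
set b := t (inord i) in le *; set c := t (inord i.+1) in le *.
have neq : b != c.
  by rewrite (inj_eq (std_inj st)) -val_eqE /= !inordK; lia.
have key d : box_le b d -> box_le d c -> d = b \/ d = c.
  move=> le1 le2; have [l [lel <-]] := std_between st le1 le2.
  move: lel; rewrite !inordK; try lia.
  move=> lel; have [li | li] : l = i :> nat \/ l = i.+1 :> nat by lia.
    by left; congr (t _); apply: val_inj; rewrite /= inordK; lia.
  by right; congr (t _); apply: val_inj; rewrite /= inordK; lia.
have neq' : ((b.1 != c.1 :> nat) || (b.2 != c.2 :> nat))%N.
  apply: contraNT neq; rewrite negb_or !negbK.
  by move: b c {le key} => [b1 b2] [c1 c2] /= /andP[/eqP/val_inj-> /eqP/val_inj->].
have [/= le1 le2] := andP le.
have lc1 := ltn_ord c.1; have lc2 := ltn_ord c.2.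
have fst_eq (d d' : bx) : d = d' -> d.1 = d'.1 :> nat by move->.
have snd_eq (d d' : bx) : d = d' -> d.2 = d'.2 :> nat by move->.
(* d is the first box on a monotone path from b to c *)
have [h | h] := ltnP b.1 c.1.
  have ltd : (b.1.+1 < n)%N by lia.
  have [||/[dup] /fst_eq + /snd_eq|/[dup] /fst_eq + /snd_eq] :=
    key (Ordinal ltd, b.2); by rewrite /box_le /content /=; lia.
have ltd : (b.2.+1 < n)%N by lia.
have [||/[dup] /fst_eq + /snd_eq|/[dup] /fst_eq + /snd_eq] :=
  key (b.1, Ordinal ltd); by rewrite /box_le /content /=; lia.
Qed.

Lemma content_adj_neq0 t i : (i < m)%N -> std t ->
  content (t (inord i.+1)) - content (t (inord i)) != 0.
Proof.
move=> lti st; have [st'|nst'] := boolP (std (tperm_act t (s i))).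
  by have := content_adj_std lti st st'; lia.
by have := content_adj_nstd lti st nst'; lia.
Qed.

(** Two boxes on one diagonal span a square with two further corners, both of which would have to
    carry the entry i.+1. The braid relation needs this, since the difference occurs there as a
    denominator. *)
Lemma content_adj2_neq0 t i : (i.+1 < m)%N -> std t ->
  content (t (inord i.+2)) - content (t (inord i)) != 0.
Proof.
move=> lti st; apply/negP; rewrite subr_eq0 => /eqP eqc.
set b := t (inord i) in eqc *; set c := t (inord i.+2) in eqc *.
have nle : ~~ box_le c b by apply/negP=> /(std_le st); rewrite !inordK; lia.
have key d : box_le b d -> box_le d c -> d != b -> d != c -> d = t (inord i.+1).
  move=> le1 le2; have [l [lel <-]] := std_between st le1 le2.
  rewrite !(inj_eq (std_inj st)) -!val_eqE /= !inordK; try lia.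
  move: lel; rewrite !inordK; try lia.
  by move=> *; congr (t _); apply: val_inj; rewrite /= inordK; lia.
move: eqc nle; rewrite /content /box_le => eqc nle.
have e1 : (b.1, c.2) = t (inord i.+1).
  apply: key; rewrite /box_le /=; try lia.
    by apply/eqP=> /(congr1 (fun d : bx => (d.2 : nat))) /=; lia.
  by apply/eqP=> /(congr1 (fun d : bx => (d.1 : nat))) /=; lia.
have e2 : (c.1, b.2) = t (inord i.+1).
  apply: key; rewrite /box_le /=; try lia.
    by apply/eqP=> /(congr1 (fun d : bx => (d.1 : nat))) /=; lia.
  by apply/eqP=> /(congr1 (fun d : bx => (d.2 : nat))) /=; lia.
by have := congr1 (fun d : bx => (d.1 : nat)) (etrans e1 (esym e2)) => /=; lia.
Qed.

Lemma std_shape_perm t u : std t -> std u -> shape t = shape u ->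
  exists w, u = tperm_act t w.
Proof.
move=> st su eqs.
have /fin_all_exists[f fP] : forall i, exists j, t j = u i.
  move=> i; have : u i \in shape t by rewrite eqs imset_f.
  by case/imsetP=> j _ ->; exists j.
have injf : injective f by move=> i j eqf; apply: (std_inj su); rewrite -!fP eqf.
by exists (perm injf); apply/ffunP=> i; rewrite ffunE permE.
Qed.

(* A descent of the permutation carrying t to u can be swapped inside the set *)
(* of standard fillings, so the swaps connect all fillings of a shape.        *)
Lemma std_connect (P : {ffun 'I_m.+1 -> bx} -> Prop) u : std u -> P u ->
    (forall t i, (i < m)%N -> std t -> std (tperm_act t (s i)) ->
       P (tperm_act t (s i)) -> P t) ->
  forall t, std t -> shape t = shape u -> P t.
Proof.
move=> su Pu PS t st eqs.
have [w uE] := std_shape_perm su st (esym eqs).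
elim/perm_adj_ind: w t st eqs uE => [|i w lti ltw IHw] t st eqs uE.
  by rewrite uE tperm_act1.
have tE : tperm_act t (s i) = tperm_act u (s i * w)%g by rewrite uE tperm_actM.
have st' : std (tperm_act t (s i)).
  rewrite std_adj //; apply/negP; rewrite uE !ffunE => /(std_le su).
  by rewrite leqNgt ltw.
by apply: (PS t i) => //; apply: IHw => //; rewrite shape_act.
Qed.

End AdjacentSwaps.

End StandardFillings.

(** * Young's seminormal form *)

Lemma intr_small_eq0 (F : fieldType) (p : nat) (z : int) : p \in [pchar F] ->
  (`|z| < p)%N -> (z%:~R == 0 :> F) = (z == 0).
Proof.
move=> charF ltz; apply/eqP/eqP => [z0 | -> //].
have : (`|z|%N%:R == 0 :> F).
  case: (intP z) z0 => [|k|k] /=; rewrite ?absz_nat ?abszN //.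
    by move/eqP.
  by rewrite mulrNz /= => /eqP; rewrite oppr_eq0.
rewrite -(dvdn_pcharf charF) => /dvdn_leq; case: (eqVneq z 0) => // nz.
by move/(_ ltac:(lia)); lia.
Qed.

Section Seminormal.

Variables (F : fieldType) (p m : nat).
Hypotheses (charF : p \in [pchar F]) (ltmp : (m.+1 < p)%N).
Local Notation bx := ('I_m.+1 * 'I_m.+1)%type.
Local Notation filling := {ffun 'I_m.+1 -> bx}.
Local Notation s := (@adj_tperm m).
Implicit Types t : filling.

(* The enumeration of the standard fillings stays abstract, so that N is a    *)
(* variable rather than a cardinal that unification would try to unfold.      *)
Variables (N : nat) (tab : 'I_N -> filling).
Hypotheses (tab_std : forall r, std (tab r)) (tab_inj : injective tab).
Hypothesis tab_surj : forall t, std t -> exists r, tab r = t.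

(** The value 0 on nonstandard fillings lets the formula for a swap be written without a case
    distinction. *)
Definition tvec t : 'rV[F]_N :=
  if [pick r | tab r == t] is Some r then delta_mx 0 r else 0.

Lemma tvec_tab r : tvec (tab r) = delta_mx 0 r.
Proof.
rewrite /tvec; case: pickP => [r' /eqP/tab_inj -> // | /(_ r)].
by rewrite eqxx.
Qed.

Lemma tvec_nstd t : ~~ std t -> tvec t = 0.
Proof.
rewrite /tvec; case: pickP => // r /eqP <-; by rewrite tab_std.
Qed.

Lemma tvecP k (A B : 'M[F]_(N, k)) :
  (forall t, std t -> tvec t *m A = tvec t *m B) -> A = B.
Proof.
move=> eqAB; apply/row_matrixP=> r.
by rewrite !rowE -tvec_tab; apply: eqAB.
Qed.

Definition ct t (j : nat) : F := (content (t (inord j)))%:~R.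

Lemma ct_adjL t i : ct (tperm_act t (s i)) i = ct t i.+1.
Proof. by rewrite /ct ffunE adj_tpermL. Qed.

Lemma ct_adjR t i : ct (tperm_act t (s i)) i.+1 = ct t i.
Proof. by rewrite /ct ffunE adj_tpermR. Qed.

Lemma ct_adjD t i j : (i < m)%N -> (j <= m)%N -> j != i -> j != i.+1 ->
  ct (tperm_act t (s i)) j = ct t j.
Proof. by move=> *; rewrite /ct ffunE adj_tpermD. Qed.

Definition axial t i := ct t i.+1 - ct t i.

(* The value 0 at a = 1 and a = -1 discards the swaps that are not standard;  *)
(* the Coxeter relations only use swap_coef a * swap_coef (- a) = 1 - a^-2.   *)
Definition swap_coef (a : F) : F := if (a == 1) || (a == -1) then 0 else 1 + a^-1.

Lemma swap_coefM a : a != 0 -> swap_coef a * swap_coef (- a) = 1 - a^-1 ^+ 2.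
Proof.
move=> a0; rewrite /swap_coef [- a == 1]eqr_oppLR eqr_opp.
case: eqP => [->|_] /=; first by rewrite mul0r invr1 expr1n subrr.
case: eqP => [->|_] /=; first by rewrite mul0r invrN invr1 sqrrN expr1n subrr.
by rewrite invrN; ring.
Qed.

Lemma axial_int t i : axial t i = (content (t (inord i.+1)) - content (t (inord i)))%:~R.
Proof. by rewrite /axial /ct intrB. Qed.

Lemma axial_neq0 t i : (i < m)%N -> std t -> axial t i != 0.
Proof.
move=> lti st; rewrite axial_int (intr_small_eq0 charF) ?content_adj_neq0 //.
by apply: ltn_trans ltmp; apply: std_content_bound.
Qed.

Lemma axial2_neq0 t i : (i.+1 < m)%N -> std t -> ct t i.+2 - ct t i != 0.
Proof.
move=> lti st; rewrite /ct -intrB (intr_small_eq0 charF) ?content_adj2_neq0 //.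
by apply: ltn_trans ltmp; apply: std_content_bound.
Qed.

Lemma swap_coef_nstd t i : (i < m)%N -> std t -> ~~ std (tperm_act t (s i)) ->
  swap_coef (axial t i) = 0.
Proof.
move=> lti st nst; have := content_adj_nstd lti st nst.
rewrite axial_int /swap_coef; set z := _ - _ => z1.
by have [-> | ->] : z = 1 \/ z = -1 by [lia]; rewrite ?rmorphN eqxx ?orbT.
Qed.

Lemma axial_neq_pm1 t i : (i < m)%N -> std t -> std (tperm_act t (s i)) ->
  (axial t i - 1 != 0) && (axial t i + 1 != 0).
Proof.
move=> lti st st'; have := content_adj_std lti st st'.
have := std_content_bound (inord i.+1) (inord i) st.
rewrite axial_int; set z := _ - _ => ltz gtz.
by rewrite -[1]/(1%:~R) -intrB -intrD !(intr_small_eq0 charF); lia.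
Qed.

Lemma swap_coef_neq0 t i : (i < m)%N -> std t -> std (tperm_act t (s i)) ->
  swap_coef (axial t i) != 0.
Proof.
move=> lti st st'; have /andP[n1 n2] := axial_neq_pm1 lti st st'.
rewrite /swap_coef -[_ == 1]subr_eq0 (negbTE n1) -addr_eq0 (negbTE n2) /=.
apply: contraNneq n2 => /(congr1 ( *%R (axial t i))).
by rewrite mulrDr mulr1 mulfV ?axial_neq0 // mulr0 => ->.
Qed.

Definition semi_mx i : 'M[F]_N :=
  \matrix_r let t := tab r in
    ((axial t i)^-1 *: tvec t + swap_coef (axial t i) *: tvec (tperm_act t (s i))).

(** The formula for [semi_mx] fails for a nonstandard filling, but such a filling only ever occurs
    with coefficient 0. This invariant survives both terms of the formula, so that products of
    several matrices can be expanded mechanically. *)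
Definition tame (c : F) t := (c == 0) || std t.

Lemma tame_stay c t d : tame c t -> tame (c * d) t.
Proof. by case/orP=> [/eqP-> | st]; rewrite /tame ?mul0r ?eqxx // st orbT. Qed.

Lemma tame_swap c t i : (i < m)%N -> tame c t ->
  tame (c * swap_coef (axial t i)) (tperm_act t (s i)).
Proof.
move=> lti /orP[/eqP-> | st]; rewrite /tame ?mul0r ?eqxx //.
have [_|nst] := boolP (std _); first by rewrite orbT.
by rewrite swap_coef_nstd // mulr0 eqxx.
Qed.

Lemma tvec_semi_mx t i : std t -> tvec t *m semi_mx i =
  (axial t i)^-1 *: tvec t + swap_coef (axial t i) *: tvec (tperm_act t (s i)).
Proof.
by move=> /tab_surj[r <-]; rewrite {1}tvec_tab -rowE rowK.
Qed.

Lemma tame_semi_mx c t i : tame c t -> (c *: tvec t) *m semi_mx i =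
  (c * (axial t i)^-1) *: tvec t +
  (c * swap_coef (axial t i)) *: tvec (tperm_act t (s i)).
Proof.
case/orP=> [/eqP-> | st]; first by rewrite !mul0r !scale0r mul0mx add0r.
by rewrite -scalemxAl tvec_semi_mx // scalerDr !scalerA.
Qed.

Local Ltac tameness :=
  try by repeat first [assumption | apply: tame_swap; first by [lia] | apply: tame_stay].

Lemma semi_mxK i : (i < m)%N -> semi_mx i *m semi_mx i = 1%:M.
Proof.
move=> lti; apply: tvecP => t st; have tm : tame 1 t by rewrite /tame st orbT.
rewrite mulmx1 -[tvec t in LHS]scale1r mulmxA tame_semi_mx // mulmxDl.
rewrite !tame_semi_mx //; tameness.
rewrite tperm_actM adj_tpermK tperm_act1 /axial ct_adjL ct_adjR !mul1r.
have := axial_neq0 lti st; rewrite /axial.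
move: (ct t i.+1 - ct t i) (opprB (ct t i.+1) (ct t i)) => a <- a0.
rewrite [X in _ + X]addrC addrACA -!scalerDl invrN swap_coefM // -expr2.
by rewrite addrCA subrr addr0 mulrN mulrC subrr scale0r addr0 scale1r.
Qed.

(* Stated for right-nested products, so that rewriting never has to compare a *)
(* product of matrices with a scaled vector.                                  *)
Lemma tame_semi_mxA c t i (B : 'M_N) : tame c t ->
  (c *: tvec t) *m (semi_mx i *m B) = ((c * (axial t i)^-1) *: tvec t) *m B +
  ((c * swap_coef (axial t i)) *: tvec (tperm_act t (s i))) *m B.
Proof. by move=> tm; rewrite mulmxA tame_semi_mx // mulmxDl. Qed.

Lemma semi_mx_comm i j : (i.+1 < j)%N -> (j < m)%N ->
  semi_mx i *m semi_mx j = semi_mx j *m semi_mx i.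
Proof.
move=> lti ltj; apply: tvecP => t st; have tm : tame 1 t by rewrite /tame st orbT.
have ltim : (i < m)%N by lia.
rewrite -[tvec t]scale1r -?mulmxA.
have H := tame_semi_mx; have HA := tame_semi_mxA.
move: tvec semi_mx H HA => T S H HA; rewrite !HA //; tameness.
rewrite !H //; tameness.
rewrite /axial !ct_adjD; try lia.
rewrite !tperm_actM (adj_tperm_comm lti ltj) !mul1r [RHS]addrACA.
by congr (_ *: _ + _ *: _ + (_ *: _ + _ *: _)); rewrite mulrC.
Qed.

Lemma semi_mx_braid i : (i.+1 < m)%N ->
  semi_mx i *m semi_mx i.+1 *m semi_mx i = semi_mx i.+1 *m semi_mx i *m semi_mx i.+1.
Proof.
move=> lti; apply: tvecP => t st; have tm : tame 1 t by rewrite /tame st orbT.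
have ltim : (i < m)%N by lia.
have nz1 := axial_neq0 ltim st; have nz2 := axial_neq0 lti st.
have nz3 := axial2_neq0 lti st.
rewrite -[tvec t]scale1r -!mulmxA.
have H := tame_semi_mx; have HA := tame_semi_mxA.
move: tvec semi_mx H HA => T S H HA; rewrite !HA //; tameness.
rewrite !H //; tameness.
move: nz1 nz2 nz3; rewrite /axial.
rewrite !(ct_adjL, ct_adjR, ct_adjD) ?mul1r; try lia.
rewrite !tperm_actM !mulgA adj_tpermK adj_tperm_braid // ?adj_tpermK ?tperm_act1.
move: (ct t i) (ct t i.+1) (ct t i.+2) => x y z nz1 nz2 nz3.
have inv1 : (x - y)^-1 = - (y - x)^-1 by rewrite -invrN opprB.
have inv2 : (y - z)^-1 = - (z - y)^-1 by rewrite -invrN opprB.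
have K1 : swap_coef (y - x) * swap_coef (x - y) - (1 - (y - x)^-1 ^+ 2) = 0.
  by rewrite -(opprB y x) swap_coefM // subrr.
have K2 : swap_coef (z - y) * swap_coef (y - z) - (1 - (z - y)^-1 ^+ 2) = 0.
  by rewrite -(opprB z y) swap_coefM // subrr.
(* This is (y - x) + (z - y) = z - x divided by the product of the three differences, the only
   relation between their inverses that is used. *)
have R : (y - x)^-1 / (z - y) - (z - x)^-1 * ((y - x)^-1 + (z - y)^-1) = 0.
  by field; rewrite nz1 nz2 nz3.
rewrite inv1 inv2 {inv1 inv2}; apply/rowP=> c; rewrite !mxE; apply/eqP; rewrite -subr_eq0.
move: K1 K2 R {nz1 nz2 nz3}.
move: (swap_coef (y - x)) (swap_coef (x - y)) => g1 g1'.
move: (swap_coef (z - y)) (swap_coef (y - z)) (swap_coef (z - x)) => g2 g2' g3.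
move: (y - x)^-1 (z - y)^-1 (z - x)^-1 => a b d K1 K2 R.
move: (T t 0 c) (T (tperm_act t (s i)) 0 c) (T (tperm_act t (s i.+1)) 0 c) => v0 v1 v2.
set v3 := T _ 0 c; set v4 := T _ 0 c; set v5 := T _ 0 c.
(* The difference of the two sides is written as an explicit combination of [R], [K1] and [K2]; the
   terms in [v3], [v4] and [v5] cancel. *)
rewrite (_ : _ - _ = (a * b - d * (a + b)) * ((a - b) * v0 + g1 * v1 - g2 * v2) +
  d * v0 * ((g1 * g1' - (1 - a ^+ 2)) - (g2 * g2' - (1 - b ^+ 2)))); last by ring.
by rewrite K1 K2 R !mul0r subrr mulr0 addr0.
Qed.

Theorem seminormal_repr : exists rho : {perm 'I_m.+1} -> 'M[F]_N,
  [/\ rho 1%g = 1%:M, forall x y, rho (x * y)%g = rho x *m rho y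
    & forall i, (i < m)%N -> rho (s i) = semi_mx i].
Proof.
apply: coxeter_extension => //.
- exact: mulmxA.
- exact: mul1mx.
- exact: mulmx1.
- exact: semi_mxK.
- exact: semi_mx_braid.
exact: semi_mx_comm.
Qed.

End Seminormal.

(** * The algebra spanned by the seminormal matrices *)

Section MatrixAlgebraMembership.

Variables (F : fieldType) (m N : nat) (E : 'A[F]_(m, N)).

Lemma memmxD A B : (A \in E)%MS -> (B \in E)%MS -> (A + B \in E)%MS.
Proof. by move=> EA EB; rewrite linearD addmx_sub. Qed.

Lemma memmxZ a A : (A \in E)%MS -> (a *: A \in E)%MS.
Proof. by move=> EA; rewrite linearZ scalemx_sub. Qed.

Lemma memmxB A B : (A \in E)%MS -> (B \in E)%MS -> (A - B \in E)%MS.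
Proof. by move=> EA EB; rewrite -scaleN1r memmxD ?memmxZ. Qed.

Lemma memmx_sum (I : finType) (P : pred I) (A : I -> 'M_N) :
  (forall i, P i -> (A i \in E)%MS) -> (\sum_(i | P i) A i \in E)%MS.
Proof. by move=> EA; rewrite linear_sum summx_sub. Qed.

End MatrixAlgebraMembership.

Lemma intr_eq0_dvd (F : fieldType) (p : nat) (z : int) : p \in [pchar F] ->
  (z%:~R == 0 :> F) = (p %| `|z|)%N.
Proof.
move=> charF; rewrite (dvdn_pcharf charF).
by case: (intP z) => [|k|k] //=; rewrite ?abszN ?mulrNz ?oppr_eq0 ?absz_nat.
Qed.

Lemma mul_delta_mx_delta (F : fieldType) n (A : 'M[F]_n) i j :
  delta_mx i i *m A *m delta_mx j j = A i j *: delta_mx i j.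
Proof.
rewrite -(mul_delta_mx (0 : 'I_1) i i) -(mul_delta_mx (0 : 'I_1) j j).
rewrite mulmxA -[_ *m A]mulmxA -rowE -(mulmxA (delta_mx i 0)) -colE.
rewrite [col j _]mx11_scalar !mxE mul_mx_scalar -scalemxAl.
by rewrite mul_delta_mx.
Qed.

Section SeminormalAlgebra.

Variables (F : fieldType) (p m : nat).
Hypotheses (charF : p \in [pchar F]) (ltmp : (m.+1 < p)%N).
Local Notation bx := ('I_m.+1 * 'I_m.+1)%type.
Local Notation filling := {ffun 'I_m.+1 -> bx}.
Local Notation s := (@adj_tperm m).
Implicit Types t : filling.
Variables (N : nat) (tab : 'I_N -> filling).
Hypotheses (tab_std : forall r, std (tab r)) (tab_inj : injective tab).
Hypothesis tab_surj : forall t, std t -> exists r, tab r = t.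
Local Notation T := (tvec F tab).
Local Notation S := (semi_mx F tab).

Definition block_diag (A : 'M[F]_N) :=
  forall r q, shape (tab r) != shape (tab q) -> A r q = 0.

Lemma block_diagM A B : block_diag A -> block_diag B -> block_diag (A *m B).
Proof.
move=> bA bB r q neq; rewrite mxE big1 // => l _.
have [eql | neql] := eqVneq (shape (tab r)) (shape (tab l)).
  by rewrite bB ?mulr0 // -eql.
by rewrite bA ?mul0r.
Qed.

Lemma block_diag1 : block_diag 1%:M.
Proof. by move=> r q; rewrite mxE; have [->|//] := eqVneq r q; rewrite eqxx. Qed.

Lemma block_diagD A B : block_diag A -> block_diag B -> block_diag (A + B).
Proof. by move=> bA bB r q neq; rewrite mxE bA ?bB ?addr0. Qed.

Lemma block_diagZ a A : block_diag A -> block_diag (a *: A).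
Proof. by move=> bA r q neq; rewrite mxE bA ?mulr0. Qed.

Lemma block_diag_sum (I : finType) (P : pred I) (A : I -> 'M[F]_N) :
  (forall i, P i -> block_diag (A i)) -> block_diag (\sum_(i | P i) A i).
Proof.
by move=> bA r q neq; rewrite summxE big1 // => i Pi; rewrite bA.
Qed.

Lemma tvecE t q : T t 0 q = (t == tab q)%:R.
Proof.
have [/tab_surj[r <-] | nst] := boolP (std t).
  by rewrite tvec_tab // mxE eqxx (inj_eq tab_inj) eq_sym.
rewrite tvec_nstd // mxE; case: eqP => // tE.
by rewrite tE tab_std in nst.
Qed.

Lemma semi_mxE i r q : S i r q = (axial F (tab r) i)^-1 * (r == q)%:R +
  swap_coef (axial F (tab r) i) * (tperm_act (tab r) (s i) == tab q)%:R.
Proof.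
have -> : S i r q = (row r (S i)) 0 q by rewrite [RHS]mxE.
by rewrite rowK !mxE !tvecE (inj_eq tab_inj).
Qed.

Lemma block_diag_semi_mx i : block_diag (S i).
Proof.
move=> r q neq; rewrite semi_mxE.
have [eqrq | _] := eqVneq r q; first by rewrite eqrq eqxx in neq.
have [eqt | _] := eqVneq; last by rewrite !mulr0 addr0.
by rewrite -eqt shape_act eqxx in neq.
Qed.

Lemma ct0 (t : filling) : std t -> ct F t 0 = 0.
Proof.
case/stdP=> injt H; have [|j] := H (inord 0) (ord0, ord0).
  by rewrite /box_le /=.
rewrite inordK // leqn0 => /eqP j0; rewrite /ct.
have -> : inord 0 = j by apply: val_inj; rewrite /= inordK.
by move=> ->; rewrite /content subrr.
Qed.

Definition content_mx k : 'M[F]_N := diag_mx (\row_r ct F (tab r) k).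

Lemma tvec_content_mx (t : filling) k : T t *m content_mx k = ct F t k *: T t.
Proof.
have [/tab_surj[r <-] | nst] := boolP (std t); last first.
  by rewrite tvec_nstd // mul0mx scaler0.
by rewrite tvec_tab // -rowE row_diag_mx mxE.
Qed.

(* The Jucys-Murphy recursion X_{k+1} = s_k X_k s_k + s_k.                     *)
Lemma content_mx_rec k : (k < m)%N ->
  content_mx k.+1 = S k *m content_mx k *m S k + S k.
Proof.
move=> ltk; have SK := semi_mxK charF ltmp tab_std tab_inj tab_surj ltk.
suff E : S k *m content_mx k.+1 = content_mx k *m S k + 1%:M.
  by rewrite -[LHS]mul1mx -SK -mulmxA E mulmxDr mulmx1 mulmxA.
apply: (tvecP tab_std tab_inj) => t st; rewrite mulmxDr mulmx1 !mulmxA tvec_content_mx.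
rewrite (tvec_semi_mx _ tab_inj tab_surj _ st) // mulmxDl -!scalemxAl.
rewrite (tvec_semi_mx _ tab_inj tab_surj _ st) // !tvec_content_mx ct_adjR.
have nz := axial_neq0 charF ltmp ltk st.
rewrite scalerDr addrAC !scalerA [swap_coef _ * _]mulrC; congr (_ + _).
rewrite -[X in _ + X]scale1r -scalerDl -(mulVf nz) [ct F t k * _]mulrC -mulrDr.
by rewrite /axial [ct F t k + _]addrC subrK.
Qed.

Lemma content_mx_sep r q : r != q -> exists2 k, (k <= m)%N &
  ct F (tab r) k != ct F (tab q) k.
Proof.
move=> neq; have [/existsP[k neqk] | ] := boolP [exists k : 'I_m.+1,
    ct F (tab r) k != ct F (tab q) k].
  by exists k; rewrite // -ltnS.
rewrite negb_exists => /forallP eqc; case/negP: neq; apply/eqP/tab_inj.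
apply: (std_sep ltmp) => // k; have := eqc k; rewrite negbK /ct inord_val.
by rewrite -subr_eq0 -intrB (intr_eq0_dvd _ charF).
Qed.

Variable rG : mx_representation F 'Sym_('I_m.+1)%G N.
Hypothesis rG_adj : forall i, (i < m)%N -> rG (s i) = S i.
Local Notation E := (enveloping_algebra_mx rG).

Lemma repr_Sym_ind (P : {perm 'I_m.+1} -> 'M[F]_N -> Prop) : P 1%g 1%:M ->
  (forall i w A, (i < m)%N -> P w A -> P (s i * w)%g (S i *m A)) ->
  forall w, P w (rG w).
Proof.
move=> P1 PS w; elim/perm_adj_ind: w => [|i w lti _ Psw].
  by rewrite repr_mx1.
have -> : w = (s i * (s i * w))%g by rewrite mulgA adj_tpermK mul1g.
by rewrite repr_mxM ?inE // rG_adj //; apply: PS.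
Qed.

Lemma block_diag_repr w : block_diag (rG w).
Proof.
apply: (repr_Sym_ind (P := fun _ => block_diag)); first exact: block_diag1.
by move=> i _ A _ bA; apply: block_diagM => //; apply: block_diag_semi_mx.
Qed.

Lemma mem_semi_mx i : (i < m)%N -> (S i \in E)%MS.
Proof. by move=> lti; rewrite -rG_adj // envelop_mx_id ?inE. Qed.

Lemma mem_content_mx k : (k <= m)%N -> (content_mx k \in E)%MS.
Proof.
elim: k => [_|k IHk ltk].
  have -> : content_mx 0 = 0; last by rewrite linear0 sub0mx.
  by apply/matrixP=> r q; rewrite !mxE ct0 ?mul0rn.
rewrite content_mx_rec // memmxD ?envelop_mxM ?mem_semi_mx ?IHk //; exact: ltnW.
Qed.

(** Lagrange interpolation: for each q other than r, some content matrix separates r from q and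
    yields a diagonal matrix that is 1 at r and 0 at q. The product of these over all q is the
    idempotent. *)
Lemma mem_delta_diag r : (delta_mx r r \in E)%MS.
Proof.
have sep q : r != q -> exists f : 'I_N -> F,
    [/\ (diag_mx (\row_l f l) \in E)%MS, f r = 1 & f q = 0].
  case/content_mx_sep=> k lek neqk; set d := ct F (tab r) k - ct F (tab q) k.
  have d0 : d != 0 by rewrite subr_eq0.
  exists (fun l => d^-1 * (ct F (tab l) k - ct F (tab q) k)).
  split; [|by rewrite mulVf | by rewrite subrr mulr0].
  have -> : diag_mx (\row_l (d^-1 * (ct F (tab l) k - ct F (tab q) k))) =
      d^-1 *: (content_mx k - ct F (tab q) k *: 1%:M).
    apply/matrixP=> i j; rewrite !mxE; case: eqP => _.
      by rewrite !mulr1n mulr1.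
    by rewrite !mulr0n mulr0 subr0 mulr0.
  by rewrite memmxZ // memmxB ?mem_content_mx ?memmxZ ?envelop_mx1.
suff [f [Ef fr fq]] : exists f : 'I_N -> F, [/\ (diag_mx (\row_l f l) \in E)%MS,
    f r = 1 & forall q, q \in rem r (enum 'I_N) -> f q = 0].
  have <- : diag_mx (\row_l f l) = delta_mx r r; last by [].
  apply/matrixP=> i j; rewrite !mxE.
  have [-> | neq] := eqVneq i j; last by case: eqP => //= <-; rewrite eq_sym (negbTE neq).
  have [-> | neq'] := eqVneq j r; first by rewrite fr.
  by rewrite fq // mem_rem_uniq ?enum_uniq // inE neq' mem_enum.
have : r \notin rem r (enum 'I_N) by rewrite mem_rem_uniq ?enum_uniq // inE eqxx.
elim: (rem r _) => [_|q l IHl].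
  exists (fun=> 1); split=> //.
  suff -> : diag_mx (\row_(_ < N) 1) = 1%:M :> 'M[F]_N by apply: envelop_mx1.
  by apply/matrixP=> i j; rewrite !mxE.
rewrite inE negb_or => /andP[neq /IHl[f [Ef fr fl]]].
have [g [Eg gr gq]] := sep _ neq.
exists (fun x => g x * f x); split; last 1 first.
- by move=> x; rewrite inE => /predU1P[-> | /fl->]; rewrite ?gq ?mul0r ?mulr0.
- suff -> : diag_mx (\row_x (g x * f x)) = diag_mx (\row_x g x) *m diag_mx (\row_x f x).
    exact: envelop_mxM.
  by rewrite mulmx_diag; congr diag_mx; apply/rowP=> x; rewrite !mxE.
by rewrite gr fr mulr1.
Qed.

Lemma mem_delta_mx r q : shape (tab r) = shape (tab q) -> (delta_mx r q \in E)%MS.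
Proof.
move=> eqs; pose P t := forall r, tab r = t -> (delta_mx r q \in E)%MS.
apply: (@std_connect _ _ P (tab q) _ _ _ (tab r)) => //.
  by move=> r' /tab_inj->; apply: mem_delta_diag.
move=> t i lti st st' Pt' r' tE; have [r2 r2E] := tab_surj st'.
have -> : delta_mx r' q = delta_mx r' r2 *m delta_mx r2 q :> 'M[F]_N.
  by rewrite mul_delta_mx.
apply: envelop_mxM; last exact: Pt'.
have [<- | neq] := eqVneq r' r2; first exact: mem_delta_diag.
have g0 := swap_coef_neq0 charF ltmp lti st st'.
(* Cutting [S i] between two diagonal idempotents leaves a single entry, which is nonzero because
   the swap is standard. *)
have -> : delta_mx r' r2 =
    (swap_coef (axial F t i))^-1 *: (delta_mx r' r' *m S i *m delta_mx r2 r2) :> 'M[F]_N.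
  rewrite mul_delta_mx_delta semi_mxE (negbTE neq) mulr0 add0r tE r2E eqxx mulr1.
  by rewrite scalerA mulVf ?scale1r.
rewrite memmxZ // !envelop_mxM ?mem_delta_diag ?mem_semi_mx //.
Qed.

Lemma mem_block_diag A : block_diag A -> (A \in E)%MS.
Proof.
move=> bA; rewrite [A]matrix_sum_delta; apply: memmx_sum => r _; apply: memmx_sum => q _.
have [eqs | neq] := eqVneq (shape (tab r)) (shape (tab q)).
  by rewrite memmxZ ?mem_delta_mx.
by rewrite bA // scale0r linear0 sub0mx.
Qed.

Definition same_shape : {set 'I_N * 'I_N} :=
  [set rq | shape (tab rq.1) == shape (tab rq.2)].

(** A dimension count: the span of the group contains the independent matrix units of all pairs of
    tableaux of equal shape, and these are as many as the group elements that span it. *)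
Lemma enveloping_row_free : #|same_shape| = (m.+1)`! -> row_free E.
Proof.
move=> card_ss.
have card_G : #|('Sym_('I_m.+1))%g| = (m.+1)`! by rewrite card_Sym card_ord.
pose B := \matrix_(i < #|same_shape|)
  mxvec (delta_mx (enum_val i).1 (enum_val i).2 : 'M[F]_N).
have BE : (B <= E)%MS.
  apply/row_subP=> i; rewrite rowK; apply: mem_delta_mx; apply/eqP.
  by have := enum_valP i; rewrite inE.
have freeB : row_free B.
  apply: inj_row_free => u uB; apply/rowP=> j; rewrite mxE.
  have := congr1 (fun v => vec_mx v (enum_val j).1 (enum_val j).2) uB.
  rewrite /= linear0 [RHS]mxE mulmx_sum_row linear_sum summxE (bigD1 j) //= big1 => [|i neq].
    by rewrite addr0 linearZ /= rowK mxvecK !mxE !eqxx mulr1.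
  rewrite linearZ /= rowK mxvecK !mxE -[_ && _]/((_, _) == (_, _)) -!surjective_pairing.
  by rewrite (inj_eq enum_val_inj) eq_sym (negbTE neq) mulr0.
rewrite /row_free eqn_leq rank_leq_row /= [X in (X <= _)%N]card_G -card_ss.
by rewrite -(eqP freeB) mxrankS.
Qed.

End SeminormalAlgebra.

(** * The squares of the numbers of standard tableaux *)

Lemma down_set_mem n (A : {set 'I_n}) : (forall i j : 'I_n, (i <= j)%N -> j \in A -> i \in A) ->
  forall j, (j \in A) = (j < #|A|)%N.
Proof.
move=> down j.
have card_lt (l : nat) : (l <= n)%N -> #|[set x : 'I_n | (x < l)%N]| = l.
  move=> len; rewrite -sum1_card (eq_bigl (fun x : 'I_n => (x < l)%N)).
    by rewrite -(big_ord_widen n (fun=> 1%N)) // sum1_card card_ord.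
  by move=> x; rewrite inE.
have ltj := ltn_ord j; apply/idP/idP => [Aj | ].
  rewrite -[X in (X <= _)%N](card_lt j.+1) //; apply/subset_leq_card/subsetP=> x.
  by rewrite inE ltnS => lexj; apply: down Aj.
apply: contraTT => nAj; rewrite -leqNgt -[X in (_ <= X)%N](card_lt j); last exact: ltnW.
apply/subset_leq_card/subsetP=> x Ax; rewrite inE ltnNge.
by apply: contra nAj => lejx; apply: down Ax.
Qed.

(** An index shift: the term i = 0 on the left is the extra one, and the last term on the right
    vanishes because f n.-1 = 0. *)
Lemma sum_descents (f : nat -> nat) n : (0 < n)%N -> f n.-1 = 0%N ->
  (\sum_(i < n) ((i == 0 :> nat) || (f i < f i.-1)) = (\sum_(i < n) (f i.+1 < f i)).+1)%N.
Proof.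
case: n => // n _ /= fn; rewrite big_ord_recl big_ord_recr /= fn addn0.
by rewrite add1n.
Qed.

Section Counting.

Variable n : nat.
Local Notation bx := ('I_n * 'I_n)%type.
Implicit Types (mu : {set bx}) (b c : bx).

Definition nstd k mu := #|[set t : {ffun 'I_k -> bx} | std t && (shape t == mu)]|.

(** The new box must lie in the n by n square; no corner is lost as long as [mu] has fewer than n
    boxes. *)
Definition addable mu b := (b \notin mu) && is_ideal (b |: mu).
Definition removable mu b := (b \in mu) && is_ideal (mu :\ b).

Lemma is_idealU mu nu : is_ideal mu -> is_ideal nu -> is_ideal (mu :|: nu).
Proof.
move=> /is_idealP imu /is_idealP inu; apply/is_idealP=> b c lebc.
by rewrite !inE => /orP[/(imu _ _ lebc)->|/(inu _ _ lebc)->]; rewrite ?orbT.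
Qed.

Lemma is_idealI mu nu : is_ideal mu -> is_ideal nu -> is_ideal (mu :&: nu).
Proof.
move=> /is_idealP imu /is_idealP inu; apply/is_idealP=> b c lebc.
by rewrite !inE => /andP[/(imu _ _ lebc)-> /(inu _ _ lebc)->].
Qed.

Definition frestr k (t : {ffun 'I_k.+1 -> bx}) : {ffun 'I_k -> bx} :=
  [ffun i => t (lift ord_max i)].

Definition fext k b (t : {ffun 'I_k -> bx}) : {ffun 'I_k.+1 -> bx} :=
  [ffun i => if unlift ord_max i is Some j then t j else b].

Lemma fext_max k b (t : {ffun 'I_k -> bx}) : fext b t ord_max = b.
Proof. by rewrite ffunE unlift_none. Qed.

Lemma fextK k b (t : {ffun 'I_k -> bx}) : frestr (fext b t) = t.
Proof. by apply/ffunP=> i; rewrite !ffunE liftK. Qed.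

Lemma frestrK k (t : {ffun 'I_k.+1 -> bx}) : fext (t ord_max) (frestr t) = t.
Proof.
apply/ffunP=> i; rewrite ffunE; case: unliftP => [j ->|->] //.
by rewrite ffunE.
Qed.

Lemma shape_fext k b (t : {ffun 'I_k -> bx}) : shape (fext b t) = b |: shape t.
Proof.
apply/setP=> c; rewrite !inE; apply/imsetP/idP => [[i _ ->] | /orP[/eqP-> | /imsetP[i _ ->]]].
- rewrite ffunE; case: unliftP => [j _|_]; last by rewrite eqxx.
  by rewrite imset_f ?orbT.
- by exists ord_max; rewrite ?fext_max.
by exists (lift ord_max i); rewrite // ffunE liftK.
Qed.

Lemma std_fext k b (t : {ffun 'I_k -> bx}) :
  std (fext b t) = [&& std t, b \notin shape t & is_ideal (b |: shape t)].
Proof.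
have lo i : fext b t (lift ord_max i) = t i by rewrite ffunE liftK.
apply/idP/and3P => [st | [st nb idl]].
  have [injt H] := stdP _ st; split; last by rewrite -shape_fext std_shape.
    apply/stdP; split=> [i j eqt | i c].
      by apply: (@lift_inj _ ord_max); apply: injt; rewrite !lo.
    rewrite -lo => /H[j]; case: (unliftP ord_max j) => [l -> | ->].
      by rewrite !lift_max lo => lel tl; exists l.
    by rewrite lift_max leqNgt ltn_ord.
  apply/imsetP=> -[i _ bE]; have := injt ord_max (lift ord_max i).
  by rewrite fext_max lo => /(_ bE)/eqP; rewrite (negbTE (neq_lift _ _)).
have [injt H] := stdP _ st; apply/stdP; split=> [i j | i c].
  case: (unliftP ord_max i) => [i' -> | ->]; case: (unliftP ord_max j) => [j' -> | ->];
    rewrite ?lo ?fext_max //.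
  - by move/injt->.
  - by move=> tb; rewrite -tb imset_f in nb.
  by move=> tb; rewrite tb imset_f in nb.
case: (unliftP ord_max i) => [i' -> | ->].
  rewrite lo => /H[j lej tj]; exists (lift ord_max j); rewrite ?lo //.
  by rewrite !lift_max.
rewrite fext_max => lec; have /is_idealP/(_ _ _ lec) := idl; rewrite !inE eqxx => /(_ isT).
case/predU1P=> [-> | /imsetP[j _ ->]]; first by exists ord_max; rewrite ?fext_max.
by exists (lift ord_max j); rewrite ?lo // lift_max ltnW.
Qed.

Lemma nstd0 mu : nstd 0 mu = (mu == set0).
Proof.
have shape0 (t : {ffun 'I_0 -> bx}) : shape t = set0.
  by apply/setP=> b; rewrite inE; apply/imsetP=> -[[]].
have std0 (t : {ffun 'I_0 -> bx}) : std t.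
  by apply/stdP; split=> [[]|[]].
case: (eqVneq mu set0) => [-> | neq].
  transitivity #|{: {ffun 'I_0 -> bx}}|; last by rewrite card_ffun card_ord expn0.
  by rewrite /nstd -cardsT; apply: eq_card => t; rewrite !inE std0 shape0 eqxx.
apply/eqP; rewrite cards_eq0; apply/eqP/setP=> t.
by rewrite !inE shape0 eq_sym (negbTE neq) andbF.
Qed.

(** The branching rule: the largest entry occupies a removable box, and deleting it is inverse to
    putting it back. *)
Lemma nstdS k mu : is_ideal mu ->
  nstd k.+1 mu = (\sum_(b | removable mu b) nstd k (mu :\ b))%N.
Proof.
move=> idl; rewrite /nstd -sum1_card.
rewrite (partition_big (fun t : {ffun 'I_k.+1 -> bx} => t ord_max) (removable mu)) /=.
  apply: eq_bigr => b /andP[bmu idb]; rewrite -sum1_card.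
  rewrite (reindex_onto (@fext k b) (@frestr k)) /=; last first.
    by move=> t /andP[_ /eqP <-]; rewrite frestrK.
  apply: eq_bigl => t; rewrite !inE fextK fext_max !eqxx !andbT std_fext shape_fext.
  have [eqmu | neq] := eqVneq (shape t) (mu :\ b).
    by rewrite eqmu setD1K // eqxx !inE eqxx /= idl !andbT.
  rewrite andbF; apply/negP=> /andP[/and3P[_ nb _] /eqP eqmu].
  by case/eqP: neq; rewrite -eqmu setU1K.
move=> t; rewrite inE => /andP[st /eqP <-]; rewrite /removable.
rewrite -(frestrK t) fext_max in st *; move: st; rewrite std_fext shape_fext.
by case/and3P=> st nb _; rewrite setU11 setU1K // std_shape.
Qed.


Lemma nstd_gt0 k mu : is_ideal mu -> #|mu| = k -> (0 < nstd k mu)%N.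
Proof.
elim: k mu => [|k IHk] mu idl cardmu.
  by rewrite nstd0 -cards_eq0 cardmu.
have [b0 b0mu] : exists b, b \in mu by apply/card_gt0P; rewrite cardmu.
(* A box with the largest sum of coordinates is a maximal element of the ideal, hence removable. *)
have [b bmu bmax] : exists2 b : bx, b \in mu &
    forall c : bx, c \in mu -> (c.1 + c.2 <= b.1 + b.2)%N.
  have [b bmu bmax] := arg_maxnP (fun c : bx => c.1 + c.2)%N b0mu.
  by exists b.
have rem_b : removable mu b.
  rewrite /removable bmu; apply/is_idealP=> c d lecd; rewrite !inE => /andP[neq dmu].
  rewrite (is_idealP _ idl _ _ lecd dmu) andbT; apply: contraNneq neq => cb.
  rewrite cb in lecd; apply/eqP/box_le_anti => //.
  by have := bmax _ dmu; case/andP: lecd; rewrite /box_le; lia.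
rewrite nstdS // (bigD1 b) //= ltn_addr // IHk //; first by case/andP: rem_b.
by move: cardmu; rewrite (cardsD1 b) bmu => -[].
Qed.

(* Row lengths of an ideal, indexed by nat so that row n is empty. *)
Definition row_card mu (i : nat) : nat :=
  #|[set j : 'I_n | [exists i' : 'I_n, (i' == i :> nat) && ((i', j) \in mu)]]|.

Lemma mem_row_card mu b : is_ideal mu -> (b \in mu) = (b.2 < row_card mu b.1)%N.
Proof.
move=> /is_idealP idl; rewrite -down_set_mem => [|j j' lej]; last first.
  rewrite !inE => /existsP[i /andP[eqi ij]]; apply/existsP; exists i.
  by rewrite eqi; apply: idl ij; rewrite /box_le /= leqnn.
rewrite inE; apply/idP/existsP => [bmu | [i /andP[/eqP/val_inj->]]].
  by exists b.1; rewrite eqxx -surjective_pairing.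
by rewrite -surjective_pairing.
Qed.

Lemma row_card_out mu i : (n <= i)%N -> row_card mu i = 0%N.
Proof.
move=> lei; apply/eqP; rewrite cards_eq0; apply/eqP/setP=> j; rewrite !inE.
by apply/existsP=> -[i' /andP[/eqP i'E _]]; have := ltn_ord i'; rewrite i'E ltnNge lei.
Qed.

Lemma row_card_le mu i : (row_card mu i <= n)%N.
Proof. by rewrite -[X in (_ <= X)%N]card_ord max_card. Qed.

Lemma row_card_anti mu i i' : is_ideal mu -> (i <= i')%N ->
  (row_card mu i' <= row_card mu i)%N.
Proof.
move=> idl lei; have [ltn' | ] := ltnP i' n; last by move/row_card_out->.
apply/subset_leq_card/subsetP=> j; rewrite !inE => /existsP[x /andP[/eqP xE xj]].
have ltin : (i < n)%N by apply: leq_ltn_trans ltn'.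
apply/existsP; exists (Ordinal ltin); rewrite eqxx /=.
by apply: (is_idealP _ idl) xj; rewrite /box_le /= leqnn xE lei.
Qed.

Lemma row_card_lt mu i : is_ideal mu -> (#|mu| < n)%N -> (row_card mu i < n)%N.
Proof.
move=> idl ltn'; rewrite ltnNge; apply/negP=> le.
have n_gt0 : (0 < n)%N by apply: leq_ltn_trans ltn'.
have [lti | ] := ltnP i n; last by move/row_card_out=> /(_ mu); lia.
have lt1 : (n.-1 < n)%N by rewrite prednK.
have b : (Ordinal lti, Ordinal lt1) \in mu by rewrite mem_row_card //=; lia.
by have := leq_ltn_trans (ideal_hook_bound idl b b) ltn'; rewrite /=; lia.
Qed.

Lemma row_card_last mu : is_ideal mu -> (#|mu| < n)%N -> row_card mu n.-1 = 0%N.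
Proof.
move=> idl ltn'; apply/eqP; rewrite -leqn0 leqNgt; apply/negP=> gt0.
have n_gt0 : (0 < n)%N by apply: leq_ltn_trans ltn'.
have lt1 : (n.-1 < n)%N by rewrite prednK.
have b : (Ordinal lt1, Ordinal n_gt0) \in mu by rewrite mem_row_card.
by have := leq_ltn_trans (ideal_hook_bound idl b b) ltn'; rewrite /=; lia.
Qed.

Lemma addableE mu b : is_ideal mu -> addable mu b =
  (b.2 == row_card mu b.1 :> nat) &&
  ((b.1 == 0 :> nat) || (row_card mu b.1 < row_card mu b.1.-1)%N).
Proof.
move=> idl; rewrite /addable mem_row_card // -leqNgt.
have lt1 := ltn_ord b.1; have lt2 := ltn_ord b.2.
apply/andP/andP => [[le /is_idealP H] | [/eqP b2 b1]].
  have inU c : box_le c b -> c != b -> (c.2 < row_card mu c.1)%N.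
    move=> lec neq; have := H _ _ lec (setU11 _ _).
    by rewrite !inE (negbTE neq) mem_row_card.
  split.
    rewrite eqn_leq le andbT leqNgt; apply/negP=> gt.
    have ltr : (row_card mu b.1 < n)%N by lia.
    have := inU (b.1, Ordinal ltr); rewrite /box_le /= leqnn ltnn => H'.
    suff: false by []; apply: H'; first by lia.
    by apply/eqP=> /(congr1 (fun c : bx => (c.2 : nat))) /=; lia.
  have [//|b1 /=] := eqVneq (b.1 : nat) 0%N.
  have ltp : (b.1.-1 < n)%N by lia.
  have := inU (Ordinal ltp, b.2); rewrite /box_le /= leqnn andbT => H'.
  apply: leq_ltn_trans le _; apply: H'; first by lia.
  by apply/eqP=> /(congr1 (fun c : bx => (c.1 : nat))) /=; lia.
split; first by rewrite b2.
apply/is_idealP=> c d lecd; rewrite !inE !mem_row_card // => /orP[/eqP dE | ltd].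
  have [//|neq /=] := eqVneq c b; move: lecd; rewrite dE /box_le => /andP[le1 le2].
  have [eq1 | neq1] := eqVneq (c.1 : nat) b.1.
    rewrite eq1 -b2 ltn_neqAle le2 andbT; apply: contraNneq neq => eq2.
    by apply/eqP/box_le_anti; rewrite /box_le eq1 eq2 !leqnn.
  have lec : (c.1 <= b.1.-1)%N by lia.
  by have := row_card_anti idl lec; lia.
apply/orP; right; case/andP: lecd => le1 le2.
by have := row_card_anti idl le1; lia.
Qed.

Lemma removableE mu b : is_ideal mu -> removable mu b =
  (b.2.+1 == row_card mu b.1) && (row_card mu b.1.+1 < row_card mu b.1)%N.
Proof.
move=> idl; rewrite /removable mem_row_card //.
have lt1 := ltn_ord b.1; have lt2 := ltn_ord b.2.
apply/andP/andP => [[lt /is_idealP H] | [/eqP b2 b1]].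
  have notU c : box_le b c -> c != b -> (row_card mu c.1 <= c.2)%N.
    move=> lec neq; rewrite leqNgt -mem_row_card //; apply/negP=> cmu.
    by have := H _ _ lec; rewrite !inE neq cmu eqxx => /(_ isT).
  split.
    rewrite eqn_leq lt /= leqNgt; apply/negP=> gt.
    have ltr : (b.2.+1 < n)%N by have := row_card_le mu b.1; lia.
    have : (row_card mu b.1 <= b.2.+1)%N; last by lia.
    apply: (notU (b.1, Ordinal ltr)); first by rewrite /box_le /= leqnn /=.
    by apply/eqP=> /(congr1 (fun c : bx => (c.2 : nat))) /=; lia.
  have [ltp | ] := ltnP b.1.+1 n; last by move/row_card_out->; lia.
  have := notU (Ordinal ltp, b.2); rewrite /box_le /= leqnn andbT => H'.
  apply: leq_ltn_trans lt; apply: H'; first by lia.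
  by apply/eqP=> /(congr1 (fun c : bx => (c.1 : nat))) /=; lia.
split; first by rewrite -b2.
apply/is_idealP=> c d lecd; rewrite !inE !mem_row_card // => /andP[neq ltd].
have /andP[le1 le2] := lecd; have anti := row_card_anti idl le1.
apply/andP; split; last by lia.
apply: contraNneq neq => cb; move: lecd le1 le2 anti; rewrite cb => lecd le1 le2 _.
apply/eqP/box_le_anti => //; rewrite /box_le.
have [le1' | lt1'] := leqP d.1 b.1; last by have := row_card_anti idl lt1'; lia.
have eq1 : d.1 = b.1 :> nat by lia.
by rewrite eq1 in ltd; lia.
Qed.

(** Each row has at most one corner of either kind, so both numbers are sums over rows, to which
    [sum_descents] applies. *)
Lemma card_addable mu : is_ideal mu -> (#|mu| < n)%N ->
  #|[set b | addable mu b]| = #|[set b | removable mu b]|.+1.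
Proof.
move=> idl ltn'; have n_gt0 : (0 < n)%N by apply: leq_ltn_trans ltn'.
have cardA : #|[set b | addable mu b]| =
    (\sum_(i < n) ((i == 0 :> nat) || (row_card mu i < row_card mu i.-1))%N)%N.
  rewrite -(card_in_imset (f := fst)) => [|b c]; last first.
    rewrite !inE !addableE // => /andP[/eqP b2 _] /andP[/eqP c2 _] eq1.
    by apply: box_le_anti; rewrite /box_le b2 c2 eq1 !leqnn.
  rewrite -sum1_card big_mkcond /=; apply: eq_bigr => i _.
  set cond := (_ || _); suff -> : (i \in fst @: [set b | addable mu b]) = cond.
    by case: cond.
  apply/imsetP/idP => [[b bE iE] | ci].
    by move: bE; rewrite /cond iE inE addableE // => /andP[].
  exists (i, Ordinal (row_card_lt i idl ltn')) => //.
  by rewrite inE addableE //= eqxx.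
have cardR : #|[set b | removable mu b]| =
    (\sum_(i < n) (row_card mu i.+1 < row_card mu i)%N)%N.
  rewrite -(card_in_imset (f := fst)) => [|b c]; last first.
    rewrite !inE !removableE // => /andP[/eqP b2 _] /andP[/eqP c2 _] eq1.
    have eq2 : b.2 = c.2 :> nat by apply: succn_inj; rewrite b2 c2 eq1.
    by apply: box_le_anti; rewrite /box_le eq1 eq2 !leqnn.
  rewrite -sum1_card big_mkcond /=; apply: eq_bigr => i _.
  set cond := (_ < _)%N; suff -> : (i \in fst @: [set b | removable mu b]) = cond.
    by case: cond.
  apply/imsetP/idP => [[b bE iE] | ci].
    by move: bE; rewrite /cond iE inE removableE // => /andP[].
  have ltr : ((row_card mu i).-1 < n)%N.
    by have := row_card_lt i idl ltn'; lia.
  exists (i, Ordinal ltr) => //.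
  rewrite inE removableE //=; apply/andP; split=> //.
  by rewrite prednK //; apply: leq_ltn_trans ci.
have last0 := row_card_last idl ltn'.
rewrite cardA cardR.
exact: sum_descents n_gt0 last0.
Qed.

(** Ideals are closed under union and intersection: removing c from [mu] is intersecting [mu] with
    the set in which both changes have been made, and adding b is uniting [mu] with that set. *)
Lemma exchange_corner mu b c : is_ideal mu ->
  [&& addable mu b, removable (b |: mu) c & c != b] =
  [&& removable mu c, addable (mu :\ c) b & b != c].
Proof.
move=> idl; have [->|neq] := eqVneq b c; first by rewrite !andbF.
have neq' : c != b by rewrite eq_sym.
have setE : (b |: mu) :\ c = b |: mu :\ c.
  by apply/setP=> x; rewrite !inE; case: (eqVneq x c) => //= ->; rewrite (negbTE neq').
rewrite /addable /removable setE !inE ?neq ?neq' ?(negbTE neq) ?(negbTE neq') ?andbT /=.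
apply/andP/andP => [[/andP[bmu id1] /andP[cmu id2]] | [/andP[cmu id1] /andP[bmu id2]]].
  rewrite cmu bmu id2 /=; split=> //.
  have -> : mu :\ c = mu :&: (b |: mu :\ c).
    apply/setP=> x; rewrite !inE; case: (eqVneq x b) => [->|] /=.
      by rewrite (negbTE bmu) andbF.
    by case: (x \in mu); rewrite ?andbF.
  exact: is_idealI.
rewrite cmu bmu id2 /= ?andbT; split=> //.
have -> : b |: mu = mu :|: (b |: mu :\ c).
  by apply/setP=> x; rewrite !inE; case: (x \in mu); rewrite ?orbT //= andbF orbF.
exact: is_idealU.
Qed.

(* The relation D U = U D + 1 in the lattice of ideals: two distinct corners,  *)
(* one added and one removed, can be exchanged.                               *)
Lemma nstd_up k mu : is_ideal mu -> #|mu| = k -> (k < n)%N ->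
  (\sum_(b | addable mu b) nstd k.+1 (b |: mu) = k.+1 * nstd k mu)%N.
Proof.
have sumA nu (x : nat) : (\sum_(b | addable nu b) x = #|[set b | addable nu b]| * x)%N.
  by rewrite -sum_nat_const; apply: eq_bigl => b; rewrite inE.
have sumR nu (x : nat) : (\sum_(b | removable nu b) x = #|[set b | removable nu b]| * x)%N.
  by rewrite -sum_nat_const; apply: eq_bigl => b; rewrite inE.
elim: k mu => [|k IHk] mu idl cardmu ltk; last first.
  pose X := (\sum_(b | addable mu b) \sum_(c | removable (b |: mu) c && (c != b))
    nstd k.+1 ((b |: mu) :\ c))%N.
  have -> : (\sum_(b | addable mu b) nstd k.+2 (b |: mu) =
      #|[set b | addable mu b]| * nstd k.+1 mu + X)%N.
    rewrite -sumA -big_split /=; apply: eq_bigr => b /andP[bmu idb].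
    rewrite nstdS // (bigD1 b) /= ?setU1K //.
    by rewrite /removable setU11 setU1K.
  have : (k.+1 * nstd k.+1 mu = #|[set b | removable mu b]| * nstd k.+1 mu + X)%N.
    have -> : X = (\sum_(c | removable mu c) \sum_(b | addable (mu :\ c) b && (b != c))
        nstd k.+1 (b |: mu :\ c))%N.
      rewrite /X (exchange_big_dep (removable mu)) /= => [|b c add_b rem_c].
        apply: eq_bigr => c rem_c; apply: eq_big => [b | b].
          have := exchange_corner b c idl; rewrite rem_c /= => <-.
          by rewrite andbC.
        case/andP=> _ /andP[_ neq]; congr nstd; apply/setP=> x; rewrite !inE.
        by case: (eqVneq x c) => //= ->; rewrite (negbTE neq).
      by have := exchange_corner b c idl; rewrite add_b rem_c => /esym/and3P[].
    rewrite {1}nstdS // big_distrr /= -sumR -big_split /=; apply: eq_bigr => c rem_c.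
    have /andP[cmu idc] := rem_c.
    have cardc : #|mu :\ c| = k by move: cardmu; rewrite (cardsD1 c) cmu => -[].
    rewrite -(IHk (mu :\ c)) //; last exact: ltnW.
    by rewrite (bigD1 c) /= ?setD1K // /addable !inE eqxx setD1K.
  by rewrite card_addable ?cardmu //; lia.
have mu0 : mu = set0 by apply/eqP; rewrite -cards_eq0 cardmu.
have rem0 b : removable mu b = false by rewrite /removable mu0 inE.
rewrite (eq_bigr (fun=> 1%N)) => [|b /andP[_ idb]].
  rewrite sumA card_addable ?cardmu // nstd0 mu0 eqxx !muln1.
  by rewrite (_ : [set b | _] = set0) ?cards0 //; apply/setP=> b; rewrite !inE -mu0 rem0.
rewrite nstdS // (bigD1 b) /=; last by rewrite /removable setU11 mu0 setU0 setDv -mu0.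
rewrite nstd0 mu0 setU0 setDv eqxx big1 // => c /andP[/andP[+ _]].
by rewrite inE => ->.
Qed.

(** Count the pairs of ideals of sizes k and k.+1 that differ by one box, weighted by the product of
    their numbers of fillings. From above, the branching rule gives the sum of squares for k.+1;
    from below, [nstd_up] gives k.+1 times the sum for k. *)
Lemma sum_sqr_nstd k : (k <= n)%N ->
  (\sum_(mu : {set bx} | is_ideal mu && (#|mu| == k)) nstd k mu * nstd k mu = k`!)%N.
Proof.
elim: k => [_ | k IHk ltk].
  rewrite (bigD1 set0) /= ?cards0 ?eqxx ?andbT; last first.
    by apply/is_idealP=> b c _; rewrite inE.
  rewrite nstd0 eqxx big1 // => mu /andP[/andP[_ /eqP]].
  by move/eqP; rewrite cards_eq0 => /eqP->; rewrite eqxx.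
rewrite factS -(IHk (ltnW ltk)) big_distrr /=.
have -> : (\sum_(mu : {set bx} | is_ideal mu && (#|mu| == k)) k.+1 * (nstd k mu * nstd k mu) =
    \sum_(mu : {set bx} | is_ideal mu && (#|mu| == k)) \sum_(b | addable mu b)
      nstd k.+1 (b |: mu) * nstd k mu)%N.
  apply: eq_bigr => mu /andP[idl /eqP cardmu].
  by rewrite mulnA -nstd_up // big_distrl.
have -> : (\sum_(mu : {set bx} | is_ideal mu && (#|mu| == k.+1))
      nstd k.+1 mu * nstd k.+1 mu =
    \sum_(mu : {set bx} | is_ideal mu && (#|mu| == k.+1)) \sum_(c | removable mu c)
      nstd k.+1 mu * nstd k (mu :\ c))%N.
  by apply: eq_bigr => mu /andP[idl _]; rewrite [X in (_ * X)%N]nstdS // big_distrr.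
rewrite !pair_big_dep /=.
rewrite (reindex_onto (fun x : {set bx} * bx => (x.2 |: x.1, x.2))
  (fun x : {set bx} * bx => (x.1 :\ x.2, x.2))) /=; last first.
  by case=> mu c /= /andP[_ /andP[cmu _]]; rewrite setD1K.
apply: eq_big => [[mu b] | [mu b]] /=.
  rewrite xpair_eqE eqxx andbT /removable /addable setU11 /=.
  have [bmu | nbmu] /= := boolP (b \in mu).
    rewrite !andbF; apply/negbTE/negP=> /andP[_ /eqP/setP/(_ b)].
    by rewrite !inE eqxx bmu.
  rewrite setU1K // eqxx andbT cardsU1 nbmu add1n eqSS.
  by do 2!case: (is_ideal _); rewrite /= ?andbT ?andbF.
by case/andP=> _; rewrite xpair_eqE => /andP[/eqP-> _].
Qed.

End Counting.

Lemma card_same_shape n N (tab : 'I_N -> {ffun 'I_n -> 'I_n * 'I_n}) :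
  (forall r, std (tab r)) -> injective tab ->
  (forall t, std t -> exists r, tab r = t) ->
  #|[set rq | shape (tab rq.1) == shape (tab rq.2)]| = n`!.
Proof.
move=> tab_std tab_inj tab_surj; rewrite -(sum_sqr_nstd (leqnn n)) -sum1_card.
have nstdE mu : nstd n mu = #|[set r | shape (tab r) == mu]|.
  rewrite -(card_imset _ tab_inj); apply: eq_card => t; rewrite inE.
  apply/andP/imsetP => [[st smu] | [r]]; last by rewrite inE => smu ->.
  by have [r rE] := tab_surj _ st; exists r; rewrite // inE rE.
rewrite (partition_big (fun rq : 'I_N * 'I_N => shape (tab rq.1))
  (fun mu : {set 'I_n * 'I_n} => is_ideal mu && (#|mu| == n))) /=.
  apply: eq_bigr => mu _; rewrite nstdE -cardsX -sum1_card.
  apply: eq_bigl => -[r q]; rewrite !inE /=.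
  by case: (eqVneq (shape (tab r)) mu) => [->|]; rewrite ?andbT ?andbF // eq_sym.
by move=> [r q] _; rewrite /= std_shape ?card_shape /=.
Qed.

(** * The associator and its square *)

Section Associator.

Variables (F : fieldType) (p m : nat).
Hypotheses (charF : p \in [pchar F]) (ltmp : (m.+1 < p)%N).
Local Notation bx := ('I_m.+1 * 'I_m.+1)%type.
Local Notation filling := {ffun 'I_m.+1 -> bx}.
Local Notation s := (@adj_tperm m).
Implicit Types t : filling.

Definition box_tr n (b : 'I_n * 'I_n) := (b.2, b.1).

Lemma box_trK n : involutive (@box_tr n). Proof. by case. Qed.

Lemma content_tr n (b : 'I_n * 'I_n) : content (box_tr b) = - content b.
Proof. by rewrite /content opprB. Qed.

Definition tconj t : filling := [ffun i => box_tr (t i)].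

Lemma tconjK : involutive tconj.
Proof. by move=> t; apply/ffunP=> i; rewrite !ffunE box_trK. Qed.

Lemma std_tconj t : std (tconj t) = std t.
Proof.
suff std_tr u : std u -> std (tconj u).
  by apply/idP/idP => [/std_tr | /std_tr //]; rewrite tconjK.
case/stdP=> injt H; apply/stdP; split=> [i j | i b].
  by rewrite !ffunE => /(can_inj (@box_trK _))/injt.
rewrite ffunE => leb; have [|j lej tj] := H i (box_tr b).
  by move: leb; rewrite /box_le /= andbC.
by exists j; rewrite // ffunE tj box_trK.
Qed.

Lemma shape_tconj t : shape (tconj t) = @box_tr _ @: shape t.
Proof.
apply/setP=> b; apply/imsetP/imsetP => [[i _ ->] | [c /imsetP[i _ ->] ->]].
  by exists (t i); rewrite ?imset_f // ffunE.
by exists i; rewrite ?ffunE.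
Qed.

Lemma tconj_act t w : tconj (tperm_act t w) = tperm_act (tconj t) w.
Proof. by apply/ffunP=> i; rewrite !ffunE. Qed.

Lemma ct_tconj t i : ct F (tconj t) i = - ct F t i.
Proof. by rewrite /ct ffunE content_tr rmorphN. Qed.

Lemma axial_tconj t i : axial F (tconj t) i = - axial F t i.
Proof. by rewrite /axial !ct_tconj opprB addrC opprK. Qed.

(** The swap permutes the ordered pairs of positions except for (i, i.+1), whose factor is reversed.
    The equation is multiplied out so that no factor has to be invertible. *)
Lemma prod_pairs_adj (h : bx -> bx -> F) t i : (i < m)%N ->
  let P u := \prod_(x : 'I_m.+1 * 'I_m.+1 | (x.1 < x.2)%N) h (u x.1) (u x.2) in
  let b := t (inord i) in let c := t (inord i.+1) in
  P (tperm_act t (s i)) * h b c = P t * h c b.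
Proof.
move=> lti P b c; rewrite /P.
set x1 : 'I_m.+1 * 'I_m.+1 := (inord i, inord i.+1).
set x2 : 'I_m.+1 * 'I_m.+1 := (inord i.+1, inord i).
have ltx1 : (x1.1 < x1.2)%N by rewrite /= !inordK; lia.
rewrite [X in _ = X * _](bigD1 x1) //= -/b -/c.
rewrite (reindex_inj (h := fun x => (s i x.1, s i x.2))); last first.
  by move=> [x y] [x' y'] [/perm_inj-> /perm_inj->].
rewrite (bigD1 x2) /= ?adj_tpermR ?adj_tpermL //.
rewrite !ffunE adj_tpermL adj_tpermR -/b -/c mulrAC [RHS]mulrAC [h b c * h c b]mulrC.
congr (_ * _).
apply: eq_big => [[x y] | [x y] _] /=; last by rewrite !ffunE !tpermK.
rewrite !xpair_eqE !adj_tpermE // -!val_eqE /= !inordK; try lia.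
by do ![case: eqP => //=]; lia.
Qed.

(* Chosen so that swapping i and i+1, at axial distance a with |a| >= 2,      *)
(* multiplies assoc_coef by - (a - 1) / (a + 1), as anticommutation requires.  *)
Definition assoc_fac (b c : bx) : int :=
  let d := content c - content b in
  if d == 0 then (if (b.1 < c.1)%N then 1 else -1)
  else if `|d|%N == 1%N then d else d + 1.

Definition assoc_coef t : F :=
  \prod_(x : 'I_m.+1 * 'I_m.+1 | (x.1 < x.2)%N) (assoc_fac (t x.1) (t x.2))%:~R.

(** The generic value d + 1 would vanish at d = -1, which falls under the separate case of absolute
    value 1. Otherwise it is nonzero and at most n in absolute value, hence nonzero modulo p. *)
Lemma assoc_fac_neq0 t i j : std t -> (assoc_fac (t i) (t j))%:~R != 0 :> F.
Proof.
move=> st; have := std_content_bound j i st; rewrite /assoc_fac.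
set d := _ - _ => ltd; have [_|d0] := eqVneq d 0.
  by case: ifP => _; rewrite ?rmorphN ?oppr_eq0 oner_eq0.
by have [d1 | d1] := eqVneq `|d|%N 1%N; rewrite (intr_small_eq0 charF); lia.
Qed.

Lemma assoc_coef_neq0 t : std t -> assoc_coef t != 0.
Proof. by move=> st; apply/prodf_neq0=> x _; apply: assoc_fac_neq0. Qed.

Lemma assoc_coef_adj t i : (i < m)%N -> std t ->
  swap_coef (axial F t i) * assoc_coef (tperm_act t (s i)) =
  - (assoc_coef t * swap_coef (- axial F t i)) \/ ~~ std (tperm_act t (s i)).
Proof.
move=> lti st; have [st' | nst] := boolP (std (tperm_act t (s i))); [left | by right].
have /andP[n1 n2] := axial_neq_pm1 charF ltmp lti st st'.
have a0 := axial_neq0 charF ltmp lti st.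
have := @prod_pairs_adj (fun b c => (assoc_fac b c)%:~R) t i lti.
rewrite /= -!/(assoc_coef _).
have ge2 := content_adj_std lti st st'.
have fac (b c : bx) : (2 <= `|content c - content b|)%N ->
    (assoc_fac b c)%:~R = (content c - content b)%:~R + 1 :> F.
  rewrite /assoc_fac; set d := _ - _ => ge.
  have [|_] := eqVneq d 0; first lia.
  by have [|_] := eqVneq `|d|%N 1%N; [lia | rewrite intrD].
have -> : (assoc_fac (t (inord i)) (t (inord i.+1)))%:~R = axial F t i + 1.
  by rewrite fac // -axial_int.
have -> : (assoc_fac (t (inord i.+1)) (t (inord i)))%:~R = - axial F t i + 1.
  rewrite fac; last by rewrite distnC.
  by rewrite axial_int -mulrNz; congr (_%:~R + 1); lia.
rewrite /swap_coef eqr_opp [- _ == 1]eqr_oppLR -[_ == 1]subr_eq0 -[_ == -1]addr_eq0.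
rewrite (negbTE n1) (negbTE n2) /=.
move: (axial F t i) (assoc_coef t) (assoc_coef _) a0 => a k k' a0 E.
apply: (mulfI a0); rewrite invrN mulrN !mulrA.
have -> : a * (1 + a^-1) * k' = k' * (a + 1) by rewrite mulrDr mulr1 mulfV // mulrC.
by rewrite E [a * k]mulrC -mulrA -mulrN mulrBr mulr1 mulfV // opprB addrC.
Qed.

Variables (N : nat) (tab : 'I_N -> filling).
Hypotheses (tab_std : forall r, std (tab r)) (tab_inj : injective tab).
Hypothesis tab_surj : forall t, std t -> exists r, tab r = t.
Local Notation T := (tvec F tab).
Local Notation S := (semi_mx F tab).

Definition assoc_mx : 'M[F]_N :=
  \matrix_r (assoc_coef (tab r) *: T (tconj (tab r))).

Lemma tvec_assoc_mx t : std t -> T t *m assoc_mx = assoc_coef t *: T (tconj t).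
Proof. by move=> /tab_surj[r <-]; rewrite tvec_tab // -rowE rowK. Qed.

Lemma assoc_mx_anti i : (i < m)%N -> S i *m assoc_mx = - (assoc_mx *m S i).
Proof.
move=> lti; apply: (tvecP tab_std tab_inj) => t st.
rewrite mulmxN !mulmxA tvec_assoc_mx // (tvec_semi_mx _ tab_inj tab_surj) //.
rewrite -scalemxAl (tvec_semi_mx _ tab_inj tab_surj) ?std_tconj // mulmxDl -!scalemxAl.
rewrite tvec_assoc_mx // axial_tconj scalerDr opprD !scalerA -!scaleNr.
congr (_ *: _ + _); first by rewrite invrN mulrN opprK mulrC.
rewrite -tconj_act; case: (assoc_coef_adj lti st) => [E | nst].
  have [st' | nst] := boolP (std (tperm_act t (s i))).
    by rewrite tvec_assoc_mx // scalerA E.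
  by rewrite !(tvec_nstd _ tab_std) ?std_tconj // mul0mx !scaler0.
by rewrite !(tvec_nstd _ tab_std) ?std_tconj // mul0mx !scaler0.
Qed.

Lemma assoc_mx_sqr t : std t ->
  T t *m (assoc_mx *m assoc_mx) = (assoc_coef t * assoc_coef (tconj t)) *: T t.
Proof.
move=> st; rewrite mulmxA tvec_assoc_mx // -scalemxAl tvec_assoc_mx ?std_tconj //.
by rewrite scalerA tconjK.
Qed.

Definition assoc_phi (d : int) : int :=
  if d == 0 then 1 else if `|d|%N == 1%N then -1 else 1 - d ^+ 2.

(** The pairs are ordered by content instead of by entry, which makes the product depend on the
    shape alone. Pairs on one diagonal are left out, as [assoc_phi] is 1 there. *)
Definition assoc_scalar (lam : {set bx}) : F :=
  \prod_(x : bx * bx | [&& x.1 \in lam, x.2 \in lam & content x.1 < content x.2])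
    (assoc_phi (content x.2 - content x.1))%:~R.

Lemma assoc_phiN d : assoc_phi (- d) = assoc_phi d.
Proof. by rewrite /assoc_phi oppr_eq0 abszN sqrrN. Qed.

Lemma assoc_fac_tr (b c : bx) :
  assoc_fac b c * assoc_fac (box_tr b) (box_tr c) = assoc_phi (content c - content b).
Proof.
rewrite /assoc_fac /assoc_phi !content_tr -opprD oppr_eq0 abszN /=.
have [d0 | _] := eqVneq (content c - content b) 0; last first.
  have [d1 | _] := eqVneq `|content c - content b|%N 1%N; last by ring.
  by have [-> | ->] : content c - content b = 1 \/ content c - content b = -1 by lia.
have -> : (b.2 < c.2)%N = (b.1 < c.1)%N by move: d0; rewrite /content; lia.
by case: ifP.
Qed.

Lemma assoc_coef_scalar t : std t ->
  assoc_coef t * assoc_coef (tconj t) = assoc_scalar (shape t).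
Proof.
move=> st; have injt := std_inj st; rewrite /assoc_coef -big_split /=.
pose phi (x : 'I_m.+1 * 'I_m.+1) : F :=
  (assoc_phi (content (t x.2) - content (t x.1)))%:~R.
pose c i := content (t i).
rewrite (eq_bigr phi) => [|x _]; last by rewrite !ffunE -intrM assoc_fac_tr.
have -> : assoc_scalar (shape t) = \prod_(x : 'I_m.+1 * 'I_m.+1 | c x.1 < c x.2) phi x.
  have inj2 : injective (fun x : 'I_m.+1 * 'I_m.+1 => (t x.1, t x.2)).
    by move=> [x y] [x' y'] [/injt-> /injt->].
  rewrite /assoc_scalar (eq_bigl (mem ((fun x => (t x.1, t x.2)) @:
      [set x : 'I_m.+1 * 'I_m.+1 | c x.1 < c x.2]))).
    rewrite big_imset => [|x y _ _ /inj2 //]; apply: eq_bigl => x; by rewrite inE.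
  move=> [a b]; apply/and3P/imsetP => [[/imsetP[i _ /= aE] /imsetP[j _ /= bE] ltc] | [x]].
    by exists (i, j); rewrite ?inE /c -aE -bE.
  by rewrite inE => ltx [-> ->]; split => //; apply: imset_f.
rewrite (bigID (fun x => c x.1 < c x.2)) /=.
rewrite [RHS](bigID (fun x : 'I_m.+1 * 'I_m.+1 => x.1 < x.2)%N) /=.
congr (_ * _); first by apply: eq_bigl => x; rewrite andbC.
rewrite (bigID (fun x => c x.2 < c x.1)) /= [X in _ * X]big1 => [|x /andP[/andP[_ ge1] ge2]].
  rewrite mulr1 (reindex_inj (h := fun x => (x.2, x.1))) /=; last first.
    by move=> [x y] [x' y'] [-> ->].
  apply: eq_big => [x | x _].
    have [<- | neq] := eqVneq x.1 x.2; first by rewrite !ltnn !Order.POrderTheory.ltxx /= ?andbF.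
    have -> : (x.2 < x.1)%N = ~~ (x.1 < x.2)%N.
      by move: neq; rewrite -val_eqE /=; lia.
    by case: (x.1 < x.2)%N; rewrite /= ?andbF ?andbT //; lia.
  by rewrite /phi /= -opprB assoc_phiN.
have eqc : c x.1 = c x.2 by lia.
by rewrite /phi -!/(c _) eqc subrr.
Qed.

End Associator.

(** * Partitions and their tableaux *)

Section Diagrams.

Variable n : nat.
Implicit Types lam : part n.

Definition diagram lam : {set 'I_n * 'I_n} := [set b : 'I_n * 'I_n | (b.2 < row_len lam b.1)%N].

Lemma row_len_anti lam (i j : 'I_n) : (i <= j)%N -> (row_len lam j <= row_len lam i)%N.
Proof.
move=> lej; have /andP[/forallP/(_ i)/forallP/(_ j)] := part_valP lam.
by rewrite lej.
Qed.

Lemma diagram_ideal lam : is_ideal (diagram lam).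
Proof.
apply/is_idealP=> b c /andP[le1 le2]; rewrite !inE => ltc.
exact: leq_ltn_trans le2 (leq_trans ltc (row_len_anti _ le1)).
Qed.

Lemma card_ord_lt l : (l <= n)%N -> (\sum_(j < n | j < l) 1 = l)%N.
Proof.
by move=> len; rewrite -(big_ord_widen n (fun=> 1%N)) // sum1_card card_ord.
Qed.

Lemma row_len_le lam i : (row_len lam i <= n)%N.
Proof. by rewrite -ltnS ltn_ord. Qed.

Lemma card_diagram lam : #|diagram lam| = n.
Proof.
have /andP[_ /eqP sum_lam] := part_valP lam.
rewrite -[RHS]sum_lam -sum1_card (eq_bigl (fun b : 'I_n * 'I_n =>
  xpredT b.1 && (b.2 < row_len lam b.1)%N)) => [|b]; last by rewrite inE.
rewrite -(pair_big_dep xpredT (fun i j : 'I_n => (j < row_len lam i)%N) (fun _ _ => 1%N)) /=.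
by apply: eq_bigr => i _; rewrite card_ord_lt ?row_len_le.
Qed.

Lemma row_lenE lam i : row_len lam i = (\sum_(j < n | (i, j) \in diagram lam) 1)%N.
Proof.
by rewrite -[LHS]card_ord_lt ?row_len_le //; apply: eq_bigl => j; rewrite inE.
Qed.

Lemma diagram_inj : injective diagram.
Proof.
move=> lam mu eqd; apply: val_inj; apply/ffunP=> i; apply: val_inj.
by have := row_lenE lam i; rewrite eqd -row_lenE.
Qed.

Lemma ideal_diagram (mu : {set 'I_n * 'I_n}) : is_ideal mu -> #|mu| = n ->
  exists lam, diagram lam = mu.
Proof.
move=> idl cardmu.
pose f : {ffun 'I_n -> 'I_n.+1} := [ffun i : 'I_n => inord (row_card mu i)].
have fE (i : 'I_n) : f i = row_card mu i :> nat.
  by rewrite ffunE inordK // ltnS row_card_le.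
have fP : is_part f.
  apply/andP; split.
    apply/forallP=> i; apply/forallP=> j; apply/implyP=> lej.
    by rewrite !fE; apply: row_card_anti.
  rewrite -[X in _ == X]cardmu (eq_bigr _ (fun i _ => fE i)) -sum1_card.
  rewrite (eq_bigl (fun b : 'I_n * 'I_n => xpredT b.1 && (b.2 < row_card mu b.1)%N)).
    rewrite -(pair_big_dep xpredT (fun i j : 'I_n => (j < row_card mu i)%N) (fun _ _ => 1%N)).
    by apply/eqP/eq_bigr => i _; rewrite card_ord_lt ?row_card_le.
  by move=> b; rewrite mem_row_card.
exists (Part fP); apply/setP=> b; rewrite inE /row_len /=.
by rewrite fE mem_row_card.
Qed.

Lemma row_len_conj lam j : row_len (conj_part lam) j = col_len lam j.
Proof.
by rewrite /row_len /= ffunE inordK // ltnS -[X in (_ <= X)%N]card_ord max_card.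
Qed.

Lemma mem_diagram_conj lam b : (b \in diagram (conj_part lam)) = (box_tr b \in diagram lam).
Proof.
rewrite !inE row_len_conj /col_len -down_set_mem ?inE // => i j lej.
by rewrite !inE => /leq_trans; apply; apply: row_len_anti.
Qed.

Lemma diagram_conj lam : diagram (conj_part lam) = @box_tr n @: diagram lam.
Proof.
apply/setP=> b; rewrite mem_diagram_conj.
by rewrite -{2}[b]box_trK (mem_imset _ _ (can_inj (@box_trK n))).
Qed.

Lemma conj_partK : involutive (@conj_part n).
Proof.
by move=> lam; apply: diagram_inj; apply/setP=> b; rewrite !mem_diagram_conj box_trK.
Qed.

Lemma card_box lam : #|{: box lam}| = n.
Proof.
rewrite card_sig -[RHS](card_diagram lam); apply: eq_card => b.
by rewrite !inE.
Qed.

End Diagrams.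

Section Tableaux.

Variables (m : nat) (lam : part m.+1).
Local Notation bx := ('I_m.+1 * 'I_m.+1)%type.
Local Notation filling := {ffun 'I_m.+1 -> bx}.
Implicit Types (t : filling) (T : {ffun box lam -> 'I_m.+1}).

Definition tab_of_fill t : {ffun box lam -> 'I_m.+1} :=
  [ffun b => odflt ord0 [pick k | t k == val b]].

Definition fill_of_tab T : filling :=
  [ffun k => if [pick b | T b == k] is Some b then val b else (ord0, ord0)].

Lemma mem_box_diagram (b : box lam) : val b \in diagram lam.
Proof. by rewrite inE (valP b). Qed.

Lemma tab_of_fillP t b : std t -> shape t = diagram lam -> t (tab_of_fill t b) = val b.
Proof.
move=> st sh; rewrite ffunE; case: pickP => [k /eqP // | none].
have : val b \in shape t by rewrite sh mem_box_diagram.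
by case/imsetP=> k _ bE; have := none k; rewrite bE eqxx.
Qed.

Lemma fill_of_tabP T b : injective T -> fill_of_tab T (T b) = val b.
Proof.
move=> injT; rewrite ffunE; case: pickP => [c /eqP/injT-> // | /(_ b)].
by rewrite eqxx.
Qed.

Lemma SYT_onto T k : injective T -> exists b, T b = k.
Proof.
move=> injT; have /codomP[b ->] : k \in codom T; last by exists b.
by rewrite (inj_card_onto injT) // card_ord card_box.
Qed.

(** Walk from b along its row to the column of c, then down that column; the turning point [d] is a
    box of the diagram. *)
Lemma is_SYT_le T (b c : box lam) : is_SYT T -> box_le (val b) (val c) -> (T b <= T c)%N.
Proof.
case/and3P=> _ /forallP Hrow /forallP Hcol /andP[le1 le2].
have cP := valP c; have bP := valP b.
have dP : (((val b).1, (val c).2).2 < row_len lam ((val b).1, (val c).2).1)%N.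
  exact: leq_trans cP (row_len_anti _ le1).
pose d : box lam := Sub ((val b).1, (val c).2) dP.
apply: (@leq_trans (T d)).
  have [eq2 | neq2] := eqVneq (val b).2 (val c).2.
    suff -> : b = d by [].
    by apply: val_inj; rewrite /= -eq2 -surjective_pairing.
  have := Hrow b => /forallP/(_ d)/implyP; rewrite /= eqxx /= ltn_neqAle le2 andbT.
  by rewrite -(inj_eq val_inj) in neq2; move=> /(_ neq2)/ltnW.
have [eq1 | neq1] := eqVneq (val b).1 (val c).1.
  suff -> : d = c by [].
  by apply: val_inj; rewrite /= eq1 -surjective_pairing.
have := Hcol d => /forallP/(_ c)/implyP; rewrite /= eqxx /= ltn_neqAle le1 andbT.
by rewrite -(inj_eq val_inj) in neq1; move=> /(_ neq1)/ltnW.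
Qed.

Lemma is_SYT_tab_of_fill t : std t -> shape t = diagram lam -> is_SYT (tab_of_fill t).
Proof.
move=> st sh; have TP b := tab_of_fillP b st sh; apply/and3P.
have injT : injective (tab_of_fill t).
  by move=> b c eqT; apply: val_inj; rewrite -!TP eqT.
have leT b c : box_le (val b) (val c) -> b != c -> (tab_of_fill t b < tab_of_fill t c)%N.
  move=> leb neq; rewrite ltn_neqAle (inj_eq val_inj) (inj_eq injT) neq /=.
  by apply: (std_le st); rewrite !TP.
split; first exact/injectiveP.
- apply/forallP=> b; apply/forallP=> c; apply/implyP=> /andP[/eqP eq1 lt2].
  apply: leT; first by rewrite /box_le eq1 leqnn ltnW.
  by apply: contraTneq lt2 => ->; rewrite ltnn.
apply/forallP=> b; apply/forallP=> c; apply/implyP=> /andP[/eqP eq2 lt1].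
apply: leT; first by rewrite /box_le eq2 leqnn ltnW.
by apply: contraTneq lt1 => ->; rewrite ltnn.
Qed.

Lemma std_fill_of_tab T : is_SYT T ->
  std (fill_of_tab T) /\ shape (fill_of_tab T) = diagram lam.
Proof.
move=> sT; have injT : injective T by case/and3P: sT => /injectiveP.
have tP b := fill_of_tabP b injT; have onto k := SYT_onto k injT.
split; last first.
  apply/setP=> b; apply/imsetP/idP => [[k _ ->] | bD].
    by have [c <-] := onto k; rewrite tP mem_box_diagram.
  rewrite inE in bD; pose c : box lam := Sub b bD.
  by exists (T c) => //; have := tP c.
apply/stdP; split=> [i j | i b].
  have [c <-] := onto i; have [d <-] := onto j.
  by rewrite !tP => /val_inj->.
have [c <-] := onto i; rewrite tP => leb.
have bD : b \in diagram lam by apply: is_idealP (diagram_ideal lam) _ _ leb (mem_box_diagram c).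
rewrite inE in bD; pose d : box lam := Sub b bD.
by exists (T d); [apply: is_SYT_le | have := tP d].
Qed.

Lemma nSYT_std : nSYT lam = #|[set t : filling | std t && (shape t == diagram lam)]|.
Proof.
apply/esym; rewrite -(card_in_imset (f := tab_of_fill)) => [|t u].
  apply: eq_card => T; rewrite inE; apply/imsetP/idP => [[t] | sT].
    by rewrite inE => /andP[st /eqP sh] ->; apply: is_SYT_tab_of_fill.
  have injT : injective T by case/and3P: sT => /injectiveP.
  have [st sh] := std_fill_of_tab sT.
  exists (fill_of_tab T); first by rewrite inE st sh eqxx.
  apply/ffunP=> b; have := tab_of_fillP b st sh; rewrite -(fill_of_tabP b injT).
  by move/(std_inj st).
rewrite !inE => /andP[st /eqP sh] /andP[su /eqP shu] eqT; apply/ffunP=> k.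
have : t k \in diagram lam by rewrite -sh imset_f.
rewrite inE => bD; pose b : box lam := Sub (t k) bD.
have tb := tab_of_fillP b st sh; have ub := tab_of_fillP b su shu.
by rewrite -[t k]/(val b) -ub -eqT (std_inj st tb).
Qed.

Lemma nSYT_gt0 : (0 < nSYT lam)%N.
Proof. by rewrite nSYT_std nstd_gt0 ?diagram_ideal ?card_diagram. Qed.

End Tableaux.

(** * The scalar of a self-conjugate shape up to squares *)

Lemma prod_involution (R : comPzRingType) (I : finType) (A : pred I) (sg : I -> I)
    (f : I -> R) : involutive sg -> (forall x, A (sg x) = A x) ->
    (forall x, A x -> f (sg x) = f x) ->
  exists z, \prod_(x | A x) f x = (\prod_(x | A x && (sg x == x)) f x) * z ^+ 2.
Proof.
move=> sgK Asg fsg; pose lt (x y : I) := (enum_rank x < enum_rank y)%N.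
(* Every orbit of two elements contributes the square of one factor; the rank in the enumeration
   picks the representative. *)
exists (\prod_(x | A x && lt x (sg x)) f x).
rewrite (bigID (fun x => sg x == x)) /=; congr (_ * _).
rewrite (bigID (fun x => lt x (sg x))) /= expr2; congr (_ * _).
  apply: eq_bigl => x; have [eqx | _] := eqVneq (sg x) x; last by rewrite andbT.
  by rewrite /lt eqx ltnn !andbF.
rewrite (reindex_inj (can_inj sgK)) /=; apply: eq_big => [x | x].
  rewrite Asg sgK eq_sym /lt; case: (A x) => //=.
  rewrite -[sg x == x](inj_eq enum_rank_inj) -val_eqE /=.
  by case: ltngtP.
by case/andP=> /andP[]; rewrite Asg => Ax _ _; apply: fsg.
Qed.

Lemma card_tr_invariant n (D : {set 'I_n * 'I_n}) :
    (forall b, (box_tr b \in D) = (b \in D)) ->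
  let P := [set b in D | 0 < content b] in
  (#|P| + #|P| + #|[set b in D | content b == 0%R]|)%N = #|D|.
Proof.
move=> trD P.
have cardM : #|[set b in D | content b < 0]| = #|P|.
  rewrite -(card_imset P (can_inj (@box_trK n))); apply: eq_card => b.
  rewrite -{2}[b]box_trK (mem_imset _ _ (can_inj (@box_trK n))) !inE.
  by rewrite trD content_tr oppr_gt0.
rewrite -{2}cardM -(cardsID [set b | 0 < content b] D).
rewrite -(cardsID [set b | content b < 0] (D :\: _)) addnA.
congr (_ + _ + _)%N; apply: eq_card => b; rewrite !inE.
- by [].
- by case: (b \in D); rewrite ?andbF ?andbT //=; lia.
by case: (b \in D); rewrite ?andbF ?andbT //=; lia.
Qed.

Section SelfConjugateScalar.

Variable n : nat.
Local Notation bx := ('I_n * 'I_n)%type.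
Variable lam : part n.
Hypothesis self : lam = conj_part lam.

Let D := diagram lam.

Lemma self_diagram b : (box_tr b \in D) = (b \in D).
Proof. by rewrite /D {2}self mem_diagram_conj. Qed.

Lemma prod_odd_pairs l : exists z : int,
  \prod_(k < l) ((2 * k%:Z + 1) * (2 * k%:Z + 3)) = (2 * l%:Z + 1) * z ^+ 2.
Proof.
elim: l => [|l [z zE]]; first by exists 1; rewrite big_ord0.
by exists (z * (2 * l%:Z + 1)); rewrite big_ord_recr /= zE; ring.
Qed.

(** Right of the diagonal, row i has the contents 1, ..., l, where l is the arm length. Neighbouring
    factors share an odd number, so up to squares only 2l + 1 survives, and this is the diagonal
    hook because arm and leg are equal. *)
Lemma prod_row (i : 'I_n) : exists z : int,
  \prod_(j < n | ((i, j) \in D) && (0 < content (i, j)))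
      ((2 * content (i, j) - 1) * (2 * content (i, j) + 1)) =
  (if on_diag lam i then (hook lam i i)%:Z else 1) * z ^+ 2.
Proof.
have [diag_i | ] := boolP (on_diag lam i); last first.
  rewrite -leqNgt => le; exists 1; rewrite expr1n mulr1 big1 // => j.
  by rewrite inE /content /=; lia.
have [z zE] := prod_odd_pairs (row_len lam i - i.+1); exists z.
have -> : (hook lam i i)%:Z = 2 * (row_len lam i - i.+1)%N%:Z + 1.
  by rewrite /hook -self; move: diag_i; rewrite /on_diag; lia.
rewrite -zE; move: diag_i; rewrite /on_diag => diag_i.
have le_n := row_len_le lam i.
pose g (j : nat) : int := (2 * (j%:Z - i%:Z) - 1) * (2 * (j%:Z - i%:Z) + 1).
transitivity (\prod_(i.+1 <= j < row_len lam i) g j).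
  rewrite big_geq_mkord (big_ord_widen_cond n (fun j => i.+1 <= j)%N g le_n).
  by apply: eq_bigl => j; rewrite inE /content /=; lia.
rewrite -[X in \prod_(X <= _ < _) _]add0n big_addn big_mkord.
by apply: eq_bigr => k _; rewrite /g; congr (_ * _); lia.
Qed.

Lemma prod_choice (I : finType) (f g : I -> int) :
  (forall i, exists z, f i = g i * z ^+ 2) ->
  exists z, \prod_i f i = (\prod_i g i) * z ^+ 2.
Proof.
move=> /fin_all_exists[z zE]; exists (\prod_i z i).
by rewrite (eq_bigr _ (fun i _ => zE i)) big_split /= prodrXl.
Qed.

(** This is the exponent of the sign in [p_part]: each box right of the diagonal will contribute a
    factor -1. *)
Lemma card_pos_content : #|[set b in D | 0 < content b]| = (n - diag_len lam)./2.
Proof.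
have cardZ : #|[set b in D | content b == 0]| = diag_len lam.
  rewrite /diag_len -(card_imset [set i | on_diag lam i] (f := fun i => (i, i))) => [|i j [] //].
  apply: eq_card => -[i j]; rewrite !inE /content /= subr_eq0 eqz_nat.
  apply/andP/imsetP => [[ltj /eqP/val_inj eqij] | [k]].
    by rewrite eqij in ltj *; exists i; rewrite ?inE.
  by rewrite inE => dk [-> ->].
have := card_tr_invariant self_diagram; rewrite card_diagram cardZ => cardD.
by rewrite -[X in (X - _)%N]cardD addnK addnn doubleK.
Qed.

Lemma assoc_scalar_p_part : exists z : int,
  \prod_(x : bx * bx | [&& x.1 \in D, x.2 \in D & content x.1 < content x.2])
    assoc_phi (content x.2 - content x.1) = p_part lam * z ^+ 2.
Proof.
pose sg (x : bx * bx) := (box_tr x.2, box_tr x.1).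
have sgK : involutive sg by case=> [[a b] [c d]].
have [|x _|z1 z1E] := prod_involution
    (A := fun x : bx * bx => [&& x.1 \in D, x.2 \in D & content x.1 < content x.2])
    (f := fun x => assoc_phi (content x.2 - content x.1)) sgK.
- by move=> x; rewrite /= !self_diagram !content_tr ltrN2 andbCA.
- by rewrite /= !content_tr opprK addrC.
pose g (b : bx) := (2 * content b - 1) * (2 * content b + 1).
have [z2 z2E] : exists z : int, \prod_(b | (b \in D) && (0 < content b)) g b =
    (\prod_(i < n | on_diag lam i) hook lam i i)%N%:Z * z ^+ 2.
  have [z zE] := prod_choice prod_row; exists z.
  rewrite (big_morph Posz PoszM (erefl 1%:Z)) [X in _ = X * _]big_mkcond -zE /=.
  by rewrite pair_big_dep /=; apply: eq_big => [[i j]|[i j] _].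
(* The fixed pairs are (b', b) with d = content b > 0. Their contents differ by 2d, which is at
   least 2, so the generic case of [assoc_phi] gives 1 - (2d)^2 = - (2d - 1)(2d + 1). *)
have fixE : \prod_(x : bx * bx | [&& x.1 \in D, x.2 \in D & content x.1 < content x.2]
      && (sg x == x)) assoc_phi (content x.2 - content x.1) =
    \prod_(b | (b \in D) && (0 < content b)) (- g b).
  rewrite (reindex_onto (fun b => (box_tr b, b)) snd) /=; last first.
    by case=> b c /andP[_ /eqP[-> _]].
  apply: eq_big => [b | b].
    rewrite self_diagram content_tr eqxx andbT /sg /= box_trK eqxx andbT.
    by case: (b \in D) => //=; lia.
  rewrite content_tr => /andP[/andP[/and3P[_ _ ltc] _] _].
  rewrite /assoc_phi /g; set d := content b in ltc *.
  have [|_] := eqVneq (d - - d) 0; first lia.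
  by have [|_] := eqVneq `|d - - d|%N 1%N; [lia | ring].
exists (z2 * z1); rewrite z1E fixE prodrN z2E /p_part -card_pos_content.
rewrite (eq_card (B := fun b => (b \in D) && (0 < content b))); last first.
  by move=> b; rewrite inE.
by rewrite exprMn -!mulrA.
Qed.

End SelfConjugateScalar.

(** * Ideals cut out by central idempotents *)

(** Simplicity of the matrix ring: a nonzero element of [J] comes from a matrix X with some entry X
    a b nonzero, and multiplying X by matrix units on both sides produces every multiple of every
    matrix unit. *)
Lemma minimal_ideal_full_matrix (F K : fieldType) (iota : F -> K) m n
    (R : 'A[F]_(m, n)) (I : 'A[F]_n) d :
  (0 < d)%N -> (I <= R)%MS -> mx_ideal R I -> iso_full_matrix iota I d ->
  minimal_mx_ideal R I.
Proof.
move=> d_gt0 IR idI [g [gD gM _ ginj gI]].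
have g0 : g 0 = 0 by apply: (addrI (g 0)); rewrite -gD !addr0.
have memI X : (g X \in I)%MS by apply/gI; exists X.
split=> //.
  apply/eqP=> I0; have : g (const_mx 1) = 0.
    by have := memI (const_mx 1); rewrite I0 submx0 => /eqP/(canRL mxvecK)->; rewrite linear0.
  rewrite -g0 => /ginj/matrixP/(_ (Ordinal d_gt0) (Ordinal d_gt0))/eqP.
  by rewrite !mxE oner_eq0.
move=> J /andP[/mulsmx_subP lJ /mulsmx_subP rJ] JI nzJ.
have [i nzi] : exists i, row i J != 0.
  apply/existsP; rewrite -negb_forall; apply: contra nzJ => /forallP J0.
  by apply/eqP/row_matrixP=> i; rewrite row0; apply/eqP.
have AJ : (vec_mx (row i J) \in J)%MS by rewrite vec_mxK row_sub.
have [X gX] : exists X, g X = vec_mx (row i J).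
  by apply/gI; apply: submx_trans AJ JI.
have : X != 0.
  by apply: contraNneq nzi => X0; rewrite -[row i J]vec_mxK -gX X0 g0 linear0.
case/matrix0Pn=> a [b nzab]; apply/memmx_subP=> _ /gI[Y <-].
have key c e : (g (Y c e *: delta_mx c e) \in J)%MS.
  have -> : Y c e *: delta_mx c e =
      ((Y c e / X a b) *: delta_mx c a) *m (X *m delta_mx b e).
    rewrite -(mul_delta_mx (0 : 'I_1) c a) -(mul_delta_mx (0 : 'I_1) b e).
    rewrite -scalemxAl -!mulmxA (mulmxA X) -colE (mulmxA (delta_mx 0 a)) -rowE.
    rewrite [row a _]mx11_scalar !mxE mul_scalar_mx -scalemxAr scalerA divfK //.
    by rewrite mul_delta_mx.
  rewrite !gM gX; apply: lJ; first exact: submx_trans (memI _) IR.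
  by apply: rJ => //; apply: submx_trans (memI _) IR.
rewrite [Y]matrix_sum_delta.
have g_sum (r : seq 'I_d) (Z : 'I_d -> 'M[K]_d) :
    (forall c, (g (Z c) \in J)%MS) -> (g (\sum_(c <- r) Z c)%R \in J)%MS.
  move=> gZ; elim: r => [|c r IHr]; first by rewrite big_nil g0 linear0 sub0mx.
  by rewrite big_cons gD memmxD.
by apply: (g_sum) => c; apply: (g_sum) => e; apply: key.
Qed.

Section CornerIdeals.

Variables (F : fieldType) (m n N : nat) (FA : 'A[F]_(m, n)).
Variables (R : {linear 'M[F]_n -> 'M[F]_N}) (good : 'M[F]_N -> Prop).
Hypothesis FAM : forall A B, (A \in FA)%MS -> (B \in FA)%MS -> (A *m B \in FA)%MS.
Hypothesis RM : forall A B, (B \in FA)%MS -> R (A *m B) = R A *m R B.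
Hypothesis Rinj : forall A, (A \in FA)%MS -> R A = 0 -> A = 0.
Hypothesis Rgood : forall A, (A \in FA)%MS -> good (R A).
Hypothesis Rsurj : forall X, good X -> exists2 A, (A \in FA)%MS & R A = X.

(* For e a central idempotent of the image of R, this consists of the A with
   R A = R A e. *)
Definition corner (e : 'M[F]_N) : 'A[F]_n :=
  (FA :&: kermx (lin_mx (mulmxr (1%:M - e) \o R)))%MS.

Lemma mem_corner e A : (A \in corner e)%MS = (A \in FA)%MS && (R A *m e == R A).
Proof.
rewrite sub_capmx; congr (_ && _).
rewrite (sameP sub_kermxP eqP) mul_vec_lin /= mulmxBr mulmx1.
by rewrite (can2_eq mxvecK vec_mxK) linear0 subr_eq0 eq_sym.
Qed.

Lemma corner_sub e : (corner e <= FA)%MS. Proof. exact: capmxSl. Qed.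

Lemma Rinj2 A B : (A \in FA)%MS -> (B \in FA)%MS -> R A = R B -> A = B.
Proof.
move=> FA_A FA_B eqR; apply/eqP; rewrite -subr_eq0; apply/eqP/Rinj.
  exact: memmxB.
by rewrite linearB eqR subrr.
Qed.

Lemma corner_ideal e : (forall X, good X -> X *m e = e *m X) -> mx_ideal FA (corner e).
Proof.
move=> ce; apply/andP; split; apply/mulsmx_subP=> A B.
  move=> FA_A; rewrite !mem_corner => /andP[FA_B /eqP eB].
  by rewrite FAM // RM // -mulmxA eB eqxx.
rewrite !mem_corner => /andP[FA_A /eqP eA] FA_B.
by rewrite FAM // RM // -mulmxA ce ?mulmxA ?eA ?eqxx //; apply: Rgood.
Qed.

Lemma cornerS e f : e *m f = e -> (corner e <= corner f)%MS.
Proof.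
move=> ef; apply/memmx_subP=> A; rewrite !mem_corner => /andP[-> /eqP eA].
by rewrite -eA -mulmxA ef eqxx.
Qed.

Lemma corner_cap0 e f : e *m f = 0 -> (corner e :&: corner f = 0)%MS.
Proof.
move=> ef; apply/eqP; rewrite -submx0; apply/memmx_subP=> A.
rewrite sub_capmx !mem_corner => /andP[/andP[FA_A /eqP eA] /andP[_ /eqP fA]].
rewrite (Rinj FA_A) ?linear0 ?sub0mx //.
by rewrite -fA -eA -mulmxA ef mulmx0.
Qed.

Lemma corner_lift e X : good X -> X *m e = X -> exists2 A, (A \in corner e)%MS & R A = X.
Proof.
move=> gX eX; have [A FA_A RA] := Rsurj gX.
by exists A => //; rewrite mem_corner FA_A RA eX eqxx.
Qed.

(** As [R] maps [FA] bijectively onto the good matrices, it suffices to parametrise the good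
    matrices fixed by e; the values are then lifted back through [R]. *)
Lemma corner_iso (K : finFieldType) (iota : F -> K) d e (Phi : 'M[K]_d -> 'M[F]_N) :
    {morph Phi : X Y / X + Y} -> {morph Phi : X Y / X *m Y} ->
    (forall a X, Phi (iota a *: X) = a *: Phi X) -> injective Phi ->
    (forall X, good (Phi X) /\ Phi X *m e = Phi X) ->
    (forall Y, good Y -> Y *m e = Y -> exists X, Phi X = Y) ->
  iso_full_matrix iota (corner e) d.
Proof.
move=> PhiD PhiM PhiZ Phi_inj Phi_e Phi_surj.
have [|g gP] := @fin_all_exists _ _ (fun X A => (A \in corner e)%MS /\ R A = Phi X).
  by move=> X; have [gX eX] := Phi_e X; have [A] := corner_lift gX eX; exists A.
have gFA X : (g X \in FA)%MS by have [] := gP X; rewrite mem_corner => /andP[].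
have gR X : R (g X) = Phi X by case: (gP X).
exists g; split.
- by move=> X Y; apply: Rinj2; rewrite ?memmxD ?linearD ?gR ?PhiD.
- by move=> X Y; apply: Rinj2; rewrite ?FAM ?RM ?gR ?PhiM.
- by move=> a X; apply: Rinj2; rewrite ?memmxZ ?linearZ /= ?gR ?PhiZ.
- by move=> X Y eqg; apply: Phi_inj; rewrite -!gR eqg.
move=> A; split=> [cA | [X <-]]; last by case: (gP X).
have := cA; rewrite mem_corner => /andP[FA_A /eqP eA].
have [X XE] := Phi_surj _ (Rgood FA_A) eA.
by exists X; apply: Rinj2; rewrite ?gR.
Qed.

End CornerIdeals.

(** * The centraliser of J on a block *)

Section Doubling.

(* S A is A acting on a block spanned by the rows of U and by their images    *)
(* under J; the matrices S A + S B *m J form the centraliser of J there.      *)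
Variables (F : fieldType) (d N : nat) (U : 'M[F]_(d, N)) (V : 'M[F]_(N, d)).
Variables (J : 'M[F]_N) (c : F).
Hypotheses (c0 : c != 0) (UV : U *m V = 1%:M) (UJV : U *m J *m V = 0).
Hypotheses (UJJ : U *m J *m J = c *: U) (JJV : J *m J *m V = c *: V).

Definition double_mx (A : 'M[F]_d) : 'M[F]_N :=
  V *m A *m U + c^-1 *: (J *m V *m A *m U *m J).
Local Notation S := double_mx.

Lemma double_mxD A B : S (A + B) = S A + S B.
Proof.
by rewrite /S !(mulmxDr, mulmxDl) scalerDr addrACA.
Qed.

Lemma double_mxZ a A : S (a *: A) = a *: S A.
Proof.
rewrite /S -!(scalemxAr, scalemxAl) scalerDr; congr (_ + _).
by rewrite !scalerA mulrC.
Qed.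

Lemma mulU_double A : U *m S A = A *m U.
Proof.
rewrite /S mulmxDr -scalemxAr !mulmxA UV mul1mx.
by rewrite (_ : U *m J *m V = 0) // !mul0mx scaler0 addr0.
Qed.

Lemma mulUJ_double A : U *m J *m S A = A *m U *m J.
Proof.
rewrite /S mulmxDr -scalemxAr !mulmxA UJV !mul0mx add0r UJJ -!scalemxAl UV mul1mx.
by rewrite scalerA mulVf ?scale1r.
Qed.

Lemma double_mxM A B : S (A *m B) = S A *m S B.
Proof.
rewrite {2}/S mulmxDl -scalemxAl -!(mulmxA _ U) mulU_double -!mulmxA.
by rewrite [U *m (J *m S B)]mulmxA mulUJ_double /S !mulmxA.
Qed.

Lemma double_mx_inj A B : U *m S A *m V = U *m S B *m V -> A = B.
Proof. by rewrite !mulU_double -!mulmxA UV !mulmx1. Qed.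

Let mulUJJ k (X : 'M_(k, d)) : X *m U *m J *m J = c *: (X *m U).
Proof. by rewrite -!mulmxA (mulmxA U) UJJ -scalemxAr. Qed.

Lemma double_mxJ A : S A *m J = J *m S A.
Proof.
rewrite /S mulmxDl mulmxDr -scalemxAl -scalemxAr mulUJJ !mulmxA JJV.
by rewrite -!scalemxAl !scalerA mulVf // !scale1r addrC.
Qed.

Lemma double_mxJJ A : S A *m J *m J = c *: S A.
Proof.
rewrite /S !mulmxDl -!scalemxAl !mulUJJ -scalemxAl scalerDr.
by rewrite !scalerA mulrC.
Qed.

Lemma double_mx1 : S 1%:M = V *m U + c^-1 *: (J *m V *m U *m J).
Proof. by rewrite /S !mulmx1. Qed.

(** A matrix commuting with [J] is determined on the block by its effect on the rows of [U]. The
    components of [U *m X] along [U] and [U *m J] are the two summands. *)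
Lemma double_decomp X : X *m J = J *m X -> X *m S 1%:M = X -> S 1%:M *m X = X ->
  X = S (U *m X *m V) + S (c^-1 *: (U *m X *m J *m V)) *m J.
Proof.
move=> XJ XP PX; set A := U *m X *m V; set B := U *m X *m J *m V.
have UX : U *m X = A *m U + c^-1 *: (B *m U *m J).
  by rewrite -{1}XP double_mx1 !mulmxDr -!scalemxAr !mulmxA.
have UJX : U *m J *m X = B *m U + A *m U *m J.
  rewrite -(mulmxA U) -XJ mulmxA UX mulmxDl -scalemxAl mulUJJ.
  by rewrite scalerA mulVf // scale1r addrC.
have -> : X = V *m (U *m X) + c^-1 *: (J *m V *m (U *m J *m X)).
  by rewrite -{1}PX double_mx1 mulmxDl -scalemxAl !mulmxA.
rewrite UX UJX !mulmxDr -scalemxAr scalerDr double_mxZ /S !mulmxA.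
rewrite -!scalemxAl mulmxDl -scalemxAl mulUJJ !scalerDr !scalerA -mulrA mulVf // mulr1.
by rewrite [X in _ + X = _]addrC addrACA.
Qed.

Lemma double_decomp0 X : X *m J = J *m X -> X *m S 1%:M = X -> S 1%:M *m X = X ->
  U *m X *m J *m V = 0 -> X = S (U *m X *m V).
Proof.
move=> XJ XP PX UXJV; rewrite {1}[X]double_decomp // UXJV scaler0.
by rewrite -[X in S X *m J](scale0r 0) double_mxZ scale0r mul0mx addr0.
Qed.

Lemma mulU_doubleJ A : U *m (S A *m J) *m V = 0.
Proof. by rewrite mulmxA mulU_double -!mulmxA (mulmxA U) UJV mulmx0. Qed.

Lemma mulUJ_doubleJ A : U *m J *m (S A *m J) *m V = c *: A.
Proof. by rewrite mulmxA mulUJ_double mulUJJ -scalemxAl -mulmxA UV mulmx1. Qed.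

Lemma mulU_doubleV A : U *m S A *m V = A.
Proof. by rewrite mulU_double -mulmxA UV mulmx1. Qed.

Lemma mulUJ_doubleV A : U *m J *m S A *m V = 0.
Proof. by rewrite mulUJ_double -!mulmxA (mulmxA U) UJV mulmx0. Qed.

Lemma double_pairU A B : U *m (S A + S B *m J) *m V = A.
Proof. by rewrite mulmxDr mulmxDl mulU_doubleV mulU_doubleJ addr0. Qed.

Lemma double_pairUJ A B : U *m J *m (S A + S B *m J) *m V = c *: B.
Proof. by rewrite mulmxDr mulmxDl mulUJ_doubleV mulUJ_doubleJ add0r. Qed.

Lemma double_pair_inj A B A' B' : S A + S B *m J = S A' + S B' *m J ->
  A = A' /\ B = B'.
Proof.
move=> eqS; split; first by rewrite -(double_pairU A B) eqS double_pairU.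
by apply: (scalerI c0); rewrite -(double_pairUJ A B) eqS double_pairUJ.
Qed.

(** This is multiplication of matrices over F[X]/(X^2 - c), with [J] in the role of X. *)
Lemma double_pairM A B A' B' : (S A + S B *m J) *m (S A' + S B' *m J) =
  S (A *m A' + c *: (B *m B')) + S (A *m B' + B *m A') *m J.
Proof.
have e1 : S A *m (S B' *m J) = S (A *m B') *m J by rewrite mulmxA -double_mxM.
have e2 : S B *m J *m S A' = S (B *m A') *m J.
  by rewrite -mulmxA -double_mxJ mulmxA -double_mxM.
have e3 : S B *m J *m (S B' *m J) = S (c *: (B *m B')).
  by rewrite -mulmxA [J *m _]mulmxA -double_mxJ double_mxJJ -scalemxAr -double_mxM double_mxZ.
rewrite mulmxDl [S A *m _]mulmxDr [S B *m J *m _]mulmxDr e1 e2 e3 -double_mxM.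
rewrite !double_mxD (mulmxDl (S (A *m B'))) [X in _ + X = _]addrC.
exact: addrACA.
Qed.

Section SplitCorner.

Variable y : F.
Hypotheses (yc : y ^+ 2 * c = 1) (two0 : 2%:R != 0 :> F).

(** On the block y J squares to 1, so (1 + y J) / 2 is the projection onto an eigenspace of [J]. The
    eigenvalue is y c, a square root of c. *)
Definition split_mx (A : 'M[F]_d) : 'M[F]_N := 2%:R^-1 *: (S A + y *: (S A *m J)).

Lemma split_mxE A : split_mx A = S (2%:R^-1 *: A) + S ((2%:R^-1 * y) *: A) *m J.
Proof. by rewrite /split_mx !double_mxZ scalerDr scalerA -scalemxAl. Qed.

Lemma split_mxD A B : split_mx (A + B) = split_mx A + split_mx B.
Proof. by rewrite !split_mxE !scalerDr !double_mxD mulmxDl addrACA. Qed.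

Lemma split_mxZ a A : split_mx (a *: A) = a *: split_mx A.
Proof.
by rewrite !split_mxE scalerDr scalemxAl -!double_mxZ !scalerA ![a * _]mulrC.
Qed.

Lemma split_mxM A B : split_mx (A *m B) = split_mx A *m split_mx B.
Proof.
have half : 2%:R^-1 * 2%:R^-1 + 2%:R^-1 * 2%:R^-1 = 2%:R^-1 :> F.
  by field.
have half' : c * (2%:R^-1 * y) * (2%:R^-1 * y) = 2%:R^-1 * 2%:R^-1.
  by rewrite -[RHS]mulr1 -yc; ring.
rewrite !split_mxE double_pairM -!scalemxAl -!scalemxAr !scalerA half' -!scalerDl half.
have -> : 2%:R^-1 * (2%:R^-1 * y) + 2%:R^-1 * y * 2%:R^-1 = 2%:R^-1 * y :> F.
  by rewrite -[in RHS]half; ring.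
by [].
Qed.

Lemma split_mx_inj : injective split_mx.
Proof.
move=> A B; rewrite !split_mxE => /double_pair_inj[+ _].
by move/(congr1 ( *:%R 2%:R)); rewrite !scalerA mulfV // !scale1r.
Qed.

Lemma double_pairJ A B : (S A + S B *m J) *m J = S (c *: B) + S A *m J.
Proof. by rewrite mulmxDl double_mxJJ -double_mxZ addrC. Qed.

Lemma double_pairZ a A B : a *: (S A + S B *m J) = S (a *: A) + S (a *: B) *m J.
Proof. by rewrite scalerDr scalemxAl -!double_mxZ. Qed.

Lemma split_mx_eigen A : split_mx A *m J = (y * c) *: split_mx A.
Proof.
have e1 : y * c * 2%:R^-1 = c * (2%:R^-1 * y) by ring.
have e2 : y * c * (2%:R^-1 * y) = 2%:R^-1 by rewrite -[RHS]mulr1 -yc; ring.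
by rewrite !split_mxE double_pairJ double_pairZ !scalerA e1 e2.
Qed.

Lemma split_mx_onto A B : (S A + S B *m J) *m J = (y * c) *: (S A + S B *m J) ->
  split_mx (2%:R *: A) = S A + S B *m J.
Proof.
rewrite double_pairJ double_pairZ => /double_pair_inj[_ AE].
rewrite split_mxE !scalerA mulVf // scale1r mulrAC mulVf // mul1r {2}AE scalerA.
by rewrite mulrA -expr2 yc scale1r.
Qed.

End SplitCorner.

End Doubling.

(** * Matrices over the quadratic extension *)

Lemma odd_card_finField (F : finFieldType) p : p \in [pchar F] -> (2 < p)%N -> odd #|F|.
Proof.
move=> charF p_gt2; have p_pr := pcharf_prime charF.
have pF : p.-nat #|F|.
  by have /andP[] := fin_ring_pchar_abelem charF; rewrite -cardsT.
rewrite -[odd _]negbK -dvdn2; apply/negP=> /(pnat_dvd)/(_ pF).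
by rewrite pnatE // inE /= => /eqP p2; rewrite -p2 in p_gt2.
Qed.

(** Write q for the order of F and the image of c as x^k with x a generator of the units of K. Its
    (q - 1)-st power is 1, so q + 1 divides k; as q is odd, k is even. *)
Lemma sqrt_quadratic_ext (F K : finFieldType) (iota : {rmorphism F -> K}) (c : F) :
  #|K| = (#|F| ^ 2)%N -> odd #|F| -> exists y : K, y ^+ 2 = iota c.
Proof.
move=> cardK oddF; have [-> | c0] := eqVneq c 0; first by exists 0; rewrite rmorph0 expr0n.
have /cyclicP[x xE] := field_unit_group_cyclic [set: {unit K}]%G.
have uc : iota c \is a GRing.unit by rewrite unitfE fmorph_eq0.
have : FinRing.unit K uc \in <[x]>%g by rewrite -xE inE.
case/cycleP=> k ucE.
have F_gt1 : (1 < #|F|)%N by apply: finNzRing_gt1.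
have ordx : #[x]%g = (#|F| ^ 2).-1.
  by rewrite orderE -xE card_finField_unit cardK.
have xq : (x ^+ (k * (#|F|).-1) = 1)%g.
  rewrite expgM -ucE; apply: val_inj; rewrite FinRing.val_unitX /=.
  rewrite -rmorphXn -[RHS](rmorph1 iota); congr (iota _).
  have /(mulfI c0) : c * c ^+ (#|F|).-1 = c * 1 by rewrite -exprS prednK ?expf_card ?mulr1 // ltnW.
  by [].
have evk : ~~ odd k.
  move: xq => /eqP; rewrite -order_dvdn ordx.
  have -> : ((#|F| ^ 2).-1 = (#|F|).+1 * (#|F|).-1)%N by nia.
  rewrite dvdn_pmul2r; last by lia.
  by move=> /(dvdn_trans _); rewrite -dvdn2; apply; rewrite dvdn2 /= oddF.
exists (val (x ^+ k./2)%g); rewrite -FinRing.val_unitX -expgM.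
by rewrite muln2 even_halfK // -ucE.
Qed.

Section QuadraticMatrices.

Variables (F K : finFieldType) (iota : {rmorphism F -> K}) (y : K) (c : F).
Hypotheses (cardK : #|K| = (#|F| ^ 2)%N) (yc : y ^+ 2 = iota c).
Hypothesis nsq : forall x : F, x ^+ 2 != c.

(** If b and b' differed, then y would be the image of an element of F, whose square would be c. *)
Lemma quad_basis_inj a b a' b' : iota a + y * iota b = iota a' + y * iota b' ->
  a = a' /\ b = b'.
Proof.
move=> eqz; have bb : b = b'.
  apply: contraTeq isT => neq; case/negP: (nsq ((a' - a) / (b - b'))); apply/eqP.
  apply: (fmorph_inj iota); rewrite -yc rmorphXn; congr (_ ^+ 2).
  have nz : iota (b - b') != 0 by rewrite fmorph_eq0 subr_eq0.
  apply: (mulIf nz); rewrite fmorph_div /= divfK // !rmorphB mulrBr.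
  by apply/eqP; rewrite eq_sym subr_eq addrAC -subr_eq opprK -eqz addrC.
by move: eqz; rewrite bb => /addIr/fmorph_inj.
Qed.

Lemma quad_basis_onto : exists re im : K -> F, forall z, z = iota (re z) + y * iota (im z).
Proof.
pose f (ab : F * F) := iota ab.1 + y * iota ab.2.
have injf : injective f by move=> [a b] [a' b'] /quad_basis_inj/= [-> ->].
have onto z : exists ab, f ab = z.
  have /codomP[ab ->] : z \in codom f; last by exists ab.
  by rewrite (inj_card_onto injf) // cardK card_prod expnS expn1.
have [g gK] := fin_all_exists onto.
by exists (fun z => (g z).1), (fun z => (g z).2) => z; rewrite -[LHS]gK.
Qed.

Variable d : nat.

Definition quad_mx (A B : 'M[F]_d) : 'M[K]_d := map_mx iota A + y *: map_mx iota B.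

Lemma quad_mx_inj A B A' B' : quad_mx A B = quad_mx A' B' -> A = A' /\ B = B'.
Proof.
move=> eqm; have eqij i j : A i j = A' i j /\ B i j = B' i j.
  by apply: quad_basis_inj; move/matrixP/(_ i j): eqm; rewrite !mxE.
by split; apply/matrixP=> i j; have [] := eqij i j.
Qed.

Lemma quad_mx_onto X : exists A B, X = quad_mx A B.
Proof.
have [re [im reim]] := quad_basis_onto.
exists (map_mx re X), (map_mx im X); apply/matrixP=> i j.
by rewrite !mxE -reim.
Qed.

Lemma quad_mxD A B A' B' : quad_mx A B + quad_mx A' B' = quad_mx (A + A') (B + B').
Proof. by rewrite /quad_mx !map_mxD scalerDr addrACA. Qed.

Lemma quad_mxZ a A B : iota a *: quad_mx A B = quad_mx (a *: A) (a *: B).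
Proof. by rewrite /quad_mx !map_mxZ scalerDr !scalerA mulrC. Qed.

Lemma quad_mxM A B A' B' : quad_mx A B *m quad_mx A' B' =
  quad_mx (A *m A' + c *: (B *m B')) (A *m B' + B *m A').
Proof.
rewrite /quad_mx !map_mxD map_mxZ !map_mxM -yc mulmxDl !mulmxDr.
rewrite -!scalemxAl -!scalemxAr !scalerDr !scalerA -expr2.
by rewrite -!addrA; congr (_ + _); rewrite addrC -!addrA addrC -!addrA; congr (_ + _); rewrite addrC.
Qed.

Variables (N : nat) (U : 'M[F]_(d, N)) (V : 'M[F]_(N, d)) (J : 'M[F]_N).
Hypotheses (c0 : c != 0) (UV : U *m V = 1%:M) (UJV : U *m J *m V = 0).
Hypotheses (UJJ : U *m J *m J = c *: U) (JJV : J *m J *m V = c *: V).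
Local Notation S := (double_mx U V J c).

Theorem quad_double_iso : exists Phi : 'M[K]_d -> 'M[F]_N,
  [/\ {morph Phi : X Y / X + Y}, {morph Phi : X Y / X *m Y},
      forall a X, Phi (iota a *: X) = a *: Phi X, injective Phi
    & (forall A B, exists X, Phi X = S A + S B *m J) /\
      (forall X, exists A B, Phi X = S A + S B *m J)].
Proof.
have [|re reP] := @fin_all_exists _ _ (fun X (AB : 'M[F]_d * 'M[F]_d) => X = quad_mx AB.1 AB.2).
  by move=> X; have [A [B ->]] := quad_mx_onto X; exists (A, B).
pose Phi X := S (re X).1 + S (re X).2 *m J.
have PhiE A B : Phi (quad_mx A B) = S A + S B *m J.
  by have /quad_mx_inj[eA eB] := reP (quad_mx A B); rewrite /Phi -eA -eB.
exists Phi; split.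
- move=> X Y; have [A [B ->]] := quad_mx_onto X; have [A' [B' ->]] := quad_mx_onto Y.
  by rewrite quad_mxD !PhiE !double_mxD mulmxDl addrACA.
- move=> X Y; have [A [B ->]] := quad_mx_onto X; have [A' [B' ->]] := quad_mx_onto Y.
  by rewrite quad_mxM !PhiE double_pairM.
- move=> a X; have [A [B ->]] := quad_mx_onto X.
  by rewrite quad_mxZ !PhiE double_pairZ.
- move=> X Y; have [A [B ->]] := quad_mx_onto X; have [A' [B' ->]] := quad_mx_onto Y.
  by rewrite !PhiE => /(double_pair_inj c0 UV UJV UJJ)[-> ->].
split=> [A B | X]; first by exists (quad_mx A B).
by have [A [B ->]] := quad_mx_onto X; exists A, B.
Qed.

End QuadraticMatrices.

(** * The group ring of the alternating group *)

Section AlternatingGroupRing.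

Variables (F : fieldType) (p m : nat).
Hypotheses (charF : p \in [pchar F]) (ltmp : (m.+1 < p)%N) (m_gt0 : (0 < m)%N).
Local Notation bx := ('I_m.+1 * 'I_m.+1)%type.
Local Notation filling := {ffun 'I_m.+1 -> bx}.
Local Notation s := (@adj_tperm m).
Variables (N : nat) (tab : 'I_N -> filling).
Hypotheses (tab_std : forall r, std (tab r)) (tab_inj : injective tab).
Hypothesis tab_surj : forall t, std t -> exists r, tab r = t.
Variable rG : mx_representation F 'Sym_('I_m.+1)%G N.
Hypothesis rG_adj : forall i, (i < m)%N -> rG (s i) = semi_mx F tab i.
Local Notation J := (assoc_mx F tab).
Local Notation G := ('Alt_('I_m.+1))%G.
Local Notation SG := ('Sym_('I_m.+1))%G.
Local Notation FA := (group_ring F G).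
Local Notation block_diag := (block_diag tab).

Lemma two_neq0 : 2%:R != 0 :> F.
Proof. by rewrite -(dvdn_pcharf charF); apply/negP=> /dvdn_leq; lia. Qed.

Definition scal r : F := assoc_scalar F (shape (tab r)).

Lemma scal_neq0 r : scal r != 0.
Proof.
rewrite /scal -(assoc_coef_scalar charF ltmp) // mulf_neq0 ?(assoc_coef_neq0 charF ltmp) //.
by rewrite std_tconj.
Qed.

Lemma assoc_mxJJ : J *m J = diag_mx (\row_r scal r).
Proof.
apply: (tvecP tab_std tab_inj) => t /tab_surj[r <-].
rewrite (assoc_mx_sqr _ tab_inj tab_surj) ?(assoc_coef_scalar charF ltmp) // -/(scal r).
by rewrite tvec_tab // -rowE row_diag_mx mxE.
Qed.

Lemma assoc_mx_unit : J \in unitmx.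
Proof.
have : J *m (J *m diag_mx (\row_r (scal r)^-1)) = 1%:M.
  rewrite mulmxA assoc_mxJJ mulmx_diag; apply/matrixP=> i j; rewrite !mxE.
  by rewrite mulfV ?scal_neq0.
by case/mulmx1_unit.
Qed.

Lemma repr_assoc_mx w : rG w *m J = (-1) ^+ odd_perm w *: (J *m rG w).
Proof.
apply: (repr_Sym_ind rG_adj (P := fun w A => A *m J = (-1) ^+ odd_perm w *: (J *m A))).
  by rewrite odd_perm1 scale1r mul1mx mulmx1.
move=> i {}w A lti IH; rewrite -mulmxA IH -scalemxAr.
have -> : semi_mx F tab i *m (J *m A) = - (J *m (semi_mx F tab i *m A)).
  rewrite !mulmxA (assoc_mx_anti charF ltmp tab_std tab_inj tab_surj lti).
  by rewrite mulNmx.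
by rewrite odd_permM adj_tperm_odd // signr_addb expr1 mulN1r scaleNr scalerN.
Qed.

Definition good (X : 'M[F]_N) := block_diag X /\ X *m J = J *m X.

Local Notation alt_op := (gring_op (subg_repr rG (Alt_subset 'I_m.+1))).

Lemma alt_op_sum a : alt_op (\sum_(x in G) a x *: regular_repr F G x) =
  \sum_(x in G) a x *: rG x.
Proof.
rewrite linear_sum; apply: eq_bigr => x Gx.
by rewrite linearZ /= gring_opG.
Qed.

Lemma repr_Sym_free (a : {perm 'I_m.+1} -> F) :
  \sum_x a x *: rG x = 0 -> forall x, a x = 0.
Proof.
move=> a0 x; have free : row_free (enveloping_algebra_mx rG).
  apply: (enveloping_row_free charF ltmp tab_std tab_inj tab_surj rG_adj).
  exact: card_same_shape.
have Gx z : z \in SG by rewrite inE.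
pose u : 'rV[F]_#|SG| := \row_i a (enum_val i).
have : u *m enveloping_algebra_mx rG = 0.
  rewrite mulmx_sum_row -[RHS](linear0 mxvec) -a0 linear_sum.
  rewrite [RHS](reindex_onto enum_val (enum_rank_in (Gx x))) /=; last first.
    by move=> z _; rewrite enum_rankK_in.
  apply: eq_big => [i | i _]; first by rewrite enum_valK_in eqxx.
  by rewrite mxE rowK linearZ.
rewrite -(mul0mx _ (enveloping_algebra_mx rG)).
move/(row_free_inj free)/rowP/(_ (enum_rank_in (Gx x) x)).
by rewrite !mxE enum_rankK_in.
Qed.

Lemma alt_opM A B : (B \in FA)%MS -> alt_op (A *m B) = alt_op A *m alt_op B.
Proof. exact: gring_opM. Qed.

Lemma alt_op_inj A : (A \in FA)%MS -> alt_op A = 0 -> A = 0.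
Proof.
case/envelop_mxP=> a ->; rewrite alt_op_sum => a0.
apply: big1 => x Gx; suff -> : a x = 0 by rewrite scale0r.
have := @repr_Sym_free (fun x => if x \in G then a x else 0).
rewrite (bigID (fun x => x \in G)) /= [X in _ + X]big1 => [|z /negbTE->]; last first.
  by rewrite scale0r.
rewrite addr0 (eq_bigr (fun z => a z *: rG z)) => [|z ->] // /(_ a0 x).
by rewrite Gx.
Qed.

Lemma alt_op_good A : (A \in FA)%MS -> good (alt_op A).
Proof.
case/envelop_mxP=> a ->; rewrite alt_op_sum; split.
  apply: block_diag_sum => x _; apply: block_diagZ.
  exact: (block_diag_repr _ _ _ rG_adj).
rewrite mulmx_suml mulmx_sumr; apply: eq_bigr => x.
rewrite Alt_even => /negbTE evx.
by rewrite -scalemxAl repr_assoc_mx evx scale1r scalemxAr.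
Qed.

(** A block diagonal X is a combination of the images of all permutations. Moving [J] across it
    changes the sign of the odd terms only, so commutation, with [J] invertible and 2 nonzero, kills
    the odd coefficients by linear independence. *)
Lemma alt_op_onto X : good X -> exists2 A, (A \in FA)%MS & alt_op A = X.
Proof.
case=> bX XJ.
have /envelop_mxP[a XE] := mem_block_diag charF ltmp tab_std tab_inj tab_surj rG_adj bX.
have {}XE : X = \sum_x a x *: rG x by rewrite XE; apply: eq_bigl => x; rewrite inE.
have odd0 x : odd_perm x -> a x = 0.
  move=> ox; have J0 : J *m \sum_x (((-1) ^+ odd_perm x - 1) * a x) *: rG x = 0.
    under eq_bigr do rewrite mulrBl mul1r scalerBl.
    rewrite sumrB mulmxBr -XE -XJ XE mulmx_sumr mulmx_suml -sumrB big1 // => z _.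
    by rewrite -scalemxAl repr_assoc_mx -scalemxAr scalerA mulrC subrr.
  have sum0 : \sum_x (((-1) ^+ odd_perm x - 1) * a x) *: rG x = 0.
    by rewrite -[LHS](mulKmx assoc_mx_unit) J0 mulmx0.
  have /eqP := repr_Sym_free sum0 x.
  rewrite ox expr1 mulf_eq0 => /orP[|/eqP //].
  by rewrite -opprD oppr_eq0 -mulr2n (negbTE two_neq0).
exists (\sum_(x in G) a x *: regular_repr F G x).
  by apply/envelop_mxP; exists a.
rewrite alt_op_sum XE [RHS](bigID (fun x => x \in G)) /= [X in _ + X]big1 ?addr0 // => x.
by rewrite Alt_even negbK => /odd0->; rewrite scale0r.
Qed.

Lemma group_ringM A B : (A \in FA)%MS -> (B \in FA)%MS -> (A *m B \in FA)%MS.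
Proof. exact: envelop_mxM. Qed.

End AlternatingGroupRing.

(** * Projections onto shapes and halves of blocks *)

Section ShapeProjections.

Variables (F : fieldType) (p m : nat).
Hypotheses (charF : p \in [pchar F]) (ltmp : (m.+1 < p)%N) (m_gt0 : (0 < m)%N).
Local Notation bx := ('I_m.+1 * 'I_m.+1)%type.
Local Notation filling := {ffun 'I_m.+1 -> bx}.
Variables (N : nat) (tab : 'I_N -> filling).
Hypotheses (tab_std : forall r, std (tab r)) (tab_inj : injective tab).
Hypothesis tab_surj : forall t, std t -> exists r, tab r = t.
Variables (lamr : 'I_N -> part m.+1) (cj : 'I_N -> 'I_N).
Hypothesis lamrE : forall r, diagram (lamr r) = shape (tab r).
Hypothesis cjE : forall r, tab (cj r) = tconj (tab r).
Local Notation J := (assoc_mx F tab).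
Local Notation block_diag := (block_diag tab).
Local Notation good := (@good F m N tab).
Local Notation scal := (scal F tab).

Lemma cjK : involutive cj.
Proof. by move=> r; apply: tab_inj; rewrite !cjE tconjK. Qed.

Lemma lamr_cj r : lamr (cj r) = conj_part (lamr r).
Proof.
by apply: diagram_inj; rewrite lamrE cjE shape_tconj diagram_conj lamrE.
Qed.

(** A tableau equal to its transpose would have only boxes of content 0, but the first two entries
    have different contents; this is where n > 1 matters. *)
Lemma cj_neq r : cj r != r.
Proof.
apply/eqP=> cjr; have c0 i : content (tab r i) = 0.
  have := congr1 (fun t : filling => content (t i)) (cjE r).
  by rewrite /= cjr ffunE content_tr; lia.
by have := content_adj_neq0 m_gt0 (tab_std r); rewrite !c0 subrr eqxx.
Qed.

Lemma eq_shape_lamr r q : (shape (tab r) == shape (tab q)) = (lamr r == lamr q).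
Proof. by rewrite -!lamrE (inj_eq (@diagram_inj _)). Qed.

Lemma lamr_onto lam : exists r, lamr r = lam.
Proof.
have := nSYT_gt0 lam; rewrite nSYT_std => /card_gt0P[t]; rewrite inE => /andP[st /eqP sh].
have [r rE] := tab_surj st; exists r; apply: diagram_inj.
by rewrite lamrE rE.
Qed.

Lemma assoc_mxE r q : J r q = assoc_coef F (tab r) * (q == cj r)%:R.
Proof.
have -> : J r q = (row r J) 0 q by rewrite [RHS]mxE.
rewrite rowK mxE; congr (_ * _).
by rewrite (tvecE _ tab_std tab_inj tab_surj) -cjE (inj_eq tab_inj) eq_sym.
Qed.

Lemma assoc_mx_eq0 r q : q != cj r -> J r q = 0.
Proof. by move=> neq; rewrite assoc_mxE (negbTE neq) mulr0. Qed.

Definition fun_mx (chi : 'I_N -> F) : 'M[F]_N := diag_mx (\row_r chi r).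

Lemma mul_fun_mx chi (X : 'M[F]_N) r q : (fun_mx chi *m X) r q = chi r * X r q.
Proof. by rewrite /fun_mx mul_diag_mx !mxE. Qed.

Lemma mul_mx_fun chi (X : 'M[F]_N) r q : (X *m fun_mx chi) r q = X r q * chi q.
Proof. by rewrite /fun_mx mul_mx_diag !mxE. Qed.

Lemma fun_mxJ chi : fun_mx chi *m J = J *m fun_mx (chi \o cj).
Proof.
apply/matrixP=> r q; rewrite mul_fun_mx mul_mx_fun /= mulrC.
have [-> | neq] := eqVneq q (cj r); first by rewrite cjK.
by rewrite assoc_mx_eq0 // !mul0r.
Qed.

Definition shape_proj (g : {set part m.+1}) := fun_mx (fun r => (lamr r \in g)%:R).

Lemma shape_projM g h : shape_proj g *m shape_proj h = shape_proj (g :&: h).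
Proof.
apply/matrixP=> r q; rewrite mul_fun_mx !mxE inE.
by case: (_ \in g); rewrite ?mul1r ?mul0r // mul0rn.
Qed.

Lemma shape_proj0 : shape_proj set0 = 0.
Proof. by apply/matrixP=> r q; rewrite !mxE inE mul0rn. Qed.

Definition conj_closed (g : {set part m.+1}) := forall lam, (conj_part lam \in g) = (lam \in g).

Lemma shape_projJ g : conj_closed g -> shape_proj g *m J = J *m shape_proj g.
Proof.
move=> cg; rewrite fun_mxJ; congr (_ *m _); apply/matrixP=> r q; rewrite !mxE /=.
by rewrite lamr_cj cg.
Qed.

Lemma shape_proj_block g X : block_diag X -> X *m shape_proj g = shape_proj g *m X.
Proof.
move=> bX; apply/matrixP=> r q; rewrite mul_fun_mx mul_mx_fun mulrC.
have [eqs | neq] := eqVneq (shape (tab r)) (shape (tab q)); last by rewrite bX // !mulr0.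
by have /eqP := eqs; rewrite eq_shape_lamr => /eqP->.
Qed.

Lemma block_diag_proj g X : block_diag X -> block_diag (X *m shape_proj g).
Proof. by move=> bX r q neq; rewrite mul_mx_fun bX // mul0r. Qed.

Lemma good_proj g X : conj_closed g -> good X -> good (X *m shape_proj g).
Proof.
move=> cg [bX XJ]; split; first exact: block_diag_proj.
by rewrite -mulmxA shape_projJ // !mulmxA XJ.
Qed.

Lemma goodD X Y : good X -> good Y -> good (X + Y).
Proof.
move=> [bX XJ] [bY YJ]; split; first exact: block_diagD.
by rewrite mulmxDl mulmxDr XJ YJ.
Qed.

Lemma goodZ a X : good X -> good (a *: X).
Proof.
move=> [bX XJ]; split; first exact: block_diagZ.
by rewrite -scalemxAl -scalemxAr XJ.
Qed.

(** [J] sends the block of a shape to that of the transposed shape, so the product stays block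
    diagonal only because the shape is self-conjugate. *)
Lemma good_mulJ lam X : lam = conj_part lam -> good X -> X *m shape_proj [set lam] = X ->
  good (X *m J).
Proof.
move=> self [bX XJ] XP; split; last by rewrite XJ -mulmxA XJ.
move=> r q neq; rewrite mxE big1 // => a _.
have [qa | nqa] := eqVneq q (cj a); last by rewrite assoc_mx_eq0 // mulr0.
have [eqs | neqs] := eqVneq (shape (tab r)) (shape (tab a)); last by rewrite bX // mul0r.
rewrite -XP mul_mx_fun inE; case: eqP => [lamE | _]; last by rewrite mulr0 mul0r.
case/negP: neq; rewrite eqs eq_shape_lamr qa lamr_cj lamE; exact/eqP.
Qed.

Lemma block_diag_conjJ X : block_diag X -> block_diag (J *m X *m J).
Proof.
move=> bX r q neq; rewrite mxE big1 // => b _.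
have [qb | nqb] := eqVneq q (cj b); last by rewrite assoc_mx_eq0 // mulr0.
rewrite mxE big1 ?mul0r // => a _.
have [ar | nar] := eqVneq a (cj r); last by rewrite assoc_mx_eq0 // mul0r.
rewrite bX ?mulr0 // eq_shape_lamr ar lamr_cj.
by apply: contraNneq neq => e; rewrite eq_shape_lamr qb lamr_cj -e conj_partK.
Qed.

Definition lam_scal (lam : part m.+1) : F := assoc_scalar F (diagram lam).

Lemma scal_lamr r : scal r = lam_scal (lamr r).
Proof. by rewrite /scal /lam_scal lamrE. Qed.

Lemma scal_cj r : scal (cj r) = scal r.
Proof.
rewrite /scal -!(assoc_coef_scalar charF ltmp) // cjE tconjK; exact: mulrC.
Qed.

Lemma lam_scal_neq0 lam : lam_scal lam != 0.
Proof.
by have [r <-] := lamr_onto lam; rewrite -scal_lamr (scal_neq0 charF ltmp).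
Qed.

Let JJ : J *m J = fun_mx scal := assoc_mxJJ charF ltmp tab_std tab_inj tab_surj.

Section HalfBlock.

Variables (lam : part m.+1) (d : nat) (f : 'I_d -> 'I_N).
Hypotheses (f_inj : injective f) (f_lam : forall i, lamr (f i) = lam).
Hypothesis f_cj : forall i j, cj (f i) != f j.

Definition half_rows : 'M[F]_(d, N) := \matrix_(i, r) (r == f i)%:R.
Local Notation U := half_rows.
Local Notation V := (U^T).
Local Notation c := (lam_scal lam).
Local Notation S := (double_mx U V J c).

Lemma mul_half_rows k (X : 'M[F]_(N, k)) i j : (U *m X) i j = X (f i) j.
Proof.
rewrite mxE (bigD1 (f i)) //= mxE eqxx mul1r big1 ?addr0 // => r neq.
by rewrite mxE (negbTE neq) mul0r.
Qed.

Lemma mul_half_rows_tr k (X : 'M[F]_(k, N)) i j : (X *m V) i j = X i (f j).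
Proof. by rewrite -[X *m V]trmxK trmx_mul trmxK mxE mul_half_rows mxE. Qed.

Lemma half_UV : U *m V = 1%:M.
Proof.
by apply/matrixP=> i j; rewrite mul_half_rows !mxE (inj_eq f_inj).
Qed.

Lemma half_UJV : U *m J *m V = 0.
Proof.
apply/matrixP=> i j; rewrite mul_half_rows_tr mul_half_rows [RHS]mxE assoc_mx_eq0 //.
by rewrite eq_sym f_cj.
Qed.

Lemma half_UJJ : U *m J *m J = c *: U.
Proof.
rewrite -mulmxA JJ; apply/matrixP=> i r; rewrite /fun_mx mul_mx_diag !mxE mulrC.
by case: eqP => [-> | _]; rewrite ?mulr0 // scal_lamr f_lam.
Qed.

Lemma half_JJV : J *m J *m V = c *: V.
Proof.
rewrite JJ; apply/matrixP=> r i; rewrite /fun_mx mul_diag_mx !mxE.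
by case: eqP => [-> | _]; rewrite ?mulr0 // scal_lamr f_lam.
Qed.

Lemma half_VU : V *m U = fun_mx (fun r => (r \in codom f)%:R).
Proof.
apply/matrixP=> r q; rewrite !mxE.
have [/codomP[i ->] | nr] := boolP (r \in codom f).
  rewrite (bigD1 i) //= !mxE eqxx mul1r big1 ?addr0 => [|j neq].
    by rewrite eq_sym; case: eqP.
  by rewrite !mxE (inj_eq f_inj) eq_sym (negbTE neq) mul0r.
rewrite mul0rn big1 // => i _; rewrite !mxE; case: eqP => [rE|_]; last by rewrite mul0r.
by rewrite rE codom_f in nr.
Qed.

Lemma half_double1 :
  S 1%:M = fun_mx (fun r => (r \in codom f)%:R + (cj r \in codom f)%:R).
Proof.
rewrite double_mx1 -(mulmxA J) half_VU -mulmxA fun_mxJ mulmxA JJ.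
apply/matrixP=> r q; rewrite mxE [X in _ + X]mxE mul_fun_mx !mxE /=.
rewrite mulrnDl; congr (_ + _); case: eqP => _; last by rewrite !mulr0n !mulr0.
have [/codomP[i cjr] | _] := boolP (cj r \in codom f); last by rewrite !mulr0.
rewrite mulr1 -scal_cj cjr scal_lamr f_lam mulVf ?lam_scal_neq0 //.
Qed.

Lemma good_double A : good (S A).
Proof.
split; last exact: (double_mxJ (lam_scal_neq0 lam) half_UJJ half_JJV).
have bVAU : block_diag (V *m A *m U).
  move=> r q neq; rewrite mxE big1 // => i _; rewrite !mxE.
  case: (eqVneq q (f i)) => [qE | _]; last by rewrite mulr0.
  rewrite big1 ?mul0r // => j _; rewrite !mxE.
  case: (eqVneq r (f j)) => [rE | _]; last by rewrite mul0r.
  by case/negP: neq; rewrite eq_shape_lamr rE qE !f_lam.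
rewrite /double_mx; apply: block_diagD => //; apply: block_diagZ.
by have := block_diag_conjJ bVAU; rewrite !mulmxA.
Qed.

End HalfBlock.

End ShapeProjections.

(** * The ideals and their direct sum *)

Lemma enum_set_fun N (A : {set 'I_N}) d : #|A| = d ->
  exists f : 'I_d -> 'I_N, injective f /\ forall r, (r \in codom f) = (r \in A).
Proof.
move=> <-; exists (@enum_val _ (mem A)); split; first exact: enum_val_inj.
move=> r; apply/codomP/idP => [[i ->] | Ar]; first exact: enum_valP.
by exists (enum_rank_in Ar r); rewrite enum_rankK_in.
Qed.

Lemma Gamma_block n (g : {set part n}) lam : g \in Gamma n -> lam \in g ->
  g = [set lam; conj_part lam] /\ lam != conj_part lam.
Proof.
case/imsetP=> mu; rewrite inE => neq ->; rewrite !inE => /orP[/eqP-> // | /eqP->].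
by rewrite conj_partK setUC eq_sym.
Qed.

Lemma Gamma_pair n (lam : part n) : lam != conj_part lam ->
  [set lam; conj_part lam] \in Gamma n.
Proof. by move=> neq; apply/imsetP; exists lam; rewrite ?inE. Qed.

Section Wedderburn.

Variables (F K : finFieldType) (iota : {rmorphism F -> K}).
Hypothesis cardK : #|K| = (#|F| ^ 2)%N.
Variables (p m : nat).
Hypotheses (charF : p \in [pchar F]) (ltmp : (m.+1 < p)%N) (m_gt0 : (0 < m)%N).
Local Notation bx := ('I_m.+1 * 'I_m.+1)%type.
Local Notation filling := {ffun 'I_m.+1 -> bx}.
Variables (N : nat) (tab : 'I_N -> filling).
Hypotheses (tab_std : forall r, std (tab r)) (tab_inj : injective tab).
Hypothesis tab_surj : forall t, std t -> exists r, tab r = t.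
Variable rG : mx_representation F 'Sym_('I_m.+1)%G N.
Hypothesis rG_adj : forall i, (i < m)%N -> rG (adj_tperm m i) = semi_mx F tab i.
Variables (lamr : 'I_N -> part m.+1) (cj : 'I_N -> 'I_N).
Hypothesis lamrE : forall r, diagram (lamr r) = shape (tab r).
Hypothesis cjE : forall r, tab (cj r) = tconj (tab r).
Local Notation J := (assoc_mx F tab).
Local Notation G := ('Alt_('I_m.+1))%G.
Local Notation FA := (group_ring F G).
Local Notation R := (gring_op (subg_repr rG (Alt_subset 'I_m.+1))).
Local Notation good := (@good F m N tab).
Local Notation Pi := (@shape_proj F m N lamr).
Local Notation corner := (corner FA R).
Implicit Types lam : part m.+1.
Local Notation c_ lam := (lam_scal F lam).

Let two0 : 2%:R != 0 :> F := two_neq0 charF ltmp m_gt0.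
Let RM := @alt_opM F m N rG.
Let Rinj := @alt_op_inj F p m charF ltmp N tab tab_std tab_inj tab_surj rG rG_adj.
Let Rgood := @alt_op_good F p m charF ltmp N tab tab_std tab_inj tab_surj rG rG_adj.
Let Rsurj := @alt_op_onto F p m charF ltmp m_gt0 N tab tab_std tab_inj tab_surj rG rG_adj.
Let FAM := @group_ringM F m.

Lemma conj_closed_pair lam : conj_closed [set lam; conj_part lam].
Proof.
move=> mu; rewrite !inE (inj_eq (can_inj (@conj_partK _))) orbC.
by rewrite (can2_eq (@conj_partK _) (@conj_partK _)).
Qed.

Lemma conj_closed_self lam : lam = conj_part lam -> conj_closed [set lam].
Proof.
by move=> self mu; rewrite !inE {1}self (inj_eq (can_inj (@conj_partK _))).
Qed.

Lemma card_lamr lam : #|[set r | lamr r == lam]| = nSYT lam.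
Proof.
rewrite nSYT_std -(card_imset _ tab_inj); apply: eq_card => t; rewrite inE.
apply/imsetP/andP => [[r] | [st /eqP sh]].
  by rewrite inE => /eqP <- ->; rewrite tab_std lamrE eqxx.
have [r rE] := tab_surj st; exists r => //; rewrite inE.
by apply/eqP/diagram_inj; rewrite lamrE rE.
Qed.

(** For self-conjugate [lam], comparing indices selects one tableau from each pair {T, T'}. *)
Definition half_set lam := [set r | (lamr r == lam) && (r < cj r)%N].

Let lamrcj := lamr_cj lamrE cjE.
Let cjinv := cjK tab_inj cjE.

Lemma mem_half_cj lam r : lam = conj_part lam ->
  ((r \in half_set lam) + (cj r \in half_set lam) = (lamr r == lam))%N.
Proof.
move=> self; rewrite !inE lamrcj cjinv {2}self (inj_eq (can_inj (@conj_partK _))).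
have := cj_neq charF ltmp m_gt0 tab_std cjE r; rewrite -val_eqE /=.
by case: (lamr r == lam) => //=; case: ltngtP.
Qed.

Lemma card_half_set lam : lam = conj_part lam -> #|half_set lam| = (nSYT lam)./2.
Proof.
move=> self; rewrite -card_lamr.
suff -> : #|[set r | lamr r == lam]| = #|half_set lam|.*2 by rewrite doubleK.
have cardE (A : {set 'I_N}) : #|A| = (\sum_r (r \in A))%N.
  by rewrite -sum1_card big_mkcond; apply: eq_bigr => r _; case: (r \in A).
rewrite -addnn [X in _ = (_ + X)%N]cardE (reindex_inj (can_inj cjinv)) /= !cardE -big_split /=.
by apply: eq_bigr => r _; rewrite mem_half_cj // [r \in _]inE.
Qed.

Lemma good_comm_proj g X : good X -> X *m Pi g = Pi g *m X.
Proof. by case=> bX _; apply: (shape_proj_block lamrE). Qed.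

(** Both kinds of blocks are treated alike: [A] contains exactly one of T and T' for each T with
    shape in g. It will be all tableaux of shape [lam] for a pair of shapes, and [half_set] for a
    self-conjugate shape. *)
Lemma half_block lam (A : {set 'I_N}) d (g : {set part m.+1}) : #|A| = d ->
    (forall r, r \in A -> lamr r = lam) ->
    (forall r, (r \in A) + (cj r \in A) = (lamr r \in g))%N ->
  exists (U : 'M[F]_(d, N)) (V : 'M[F]_(N, d)),
    [/\ [/\ U *m V = 1%:M, U *m J *m V = 0, U *m J *m J = c_ lam *: U
          & J *m J *m V = c_ lam *: V],
        double_mx U V J (c_ lam) 1%:M = Pi g,
        forall B, good (double_mx U V J (c_ lam) B),
        U *m Pi [set lam] = U & Pi [set lam] *m V = V].
Proof.
move=> cardA Alam Ag; have [f [f_inj fE]] := enum_set_fun cardA.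
have fA i : f i \in A by rewrite -fE codom_f.
have f_lam i : lamr (f i) = lam by apply: Alam.
have f_cj i j : cj (f i) != f j.
  apply/eqP=> cjf; have := Ag (f i); rewrite cjf !fA /=.
  by case: (_ \in g).
exists (half_rows F f), (half_rows F f)^T; split.
- split; first exact: half_UV.
  + exact: (half_UJV F tab_std tab_inj tab_surj cjE f_cj).
  + exact: (half_UJJ charF ltmp tab_std tab_inj tab_surj lamrE f_lam).
  exact: (half_JJV charF ltmp tab_std tab_inj tab_surj lamrE f_lam).
- rewrite (half_double1 charF ltmp tab_std tab_inj tab_surj lamrE cjE f_inj f_lam).
  by apply/matrixP=> r q; rewrite !mxE !fE -natrD Ag.
- exact: (good_double charF ltmp tab_std tab_inj tab_surj lamrE cjE f_lam).
- apply/matrixP=> i r; rewrite mul_half_rows !mxE inE eq_sym.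
  have [_|_] := eqVneq r (f i); first by rewrite f_lam eqxx.
  by rewrite mulr0n.
apply/matrixP=> r i; rewrite mul_half_rows_tr !mxE inE.
have [->|_] := eqVneq r (f i); first by rewrite f_lam eqxx.
by rewrite mulr0n.
Qed.

Let c0 lam : c_ lam != 0 := lam_scal_neq0 charF ltmp tab_std tab_surj lamrE lam.

Lemma pair_corner_iso lam : lam != conj_part lam ->
  iso_full_matrix (@idfun F) (corner (Pi [set lam; conj_part lam])) (nSYT lam).
Proof.
move=> neq; set g := [set lam; _].
have [||U [V [[UV UJV UJJ JJV] S1 gS UP PV]]] := half_block (lam := lam) (g := g) (card_lamr lam).
- by move=> r; rewrite inE => /eqP.
- move=> r; rewrite !inE lamrcj (can2_eq (@conj_partK _) (@conj_partK _)).
  by case: eqP => [-> | _]; rewrite ?(negbTE neq).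
apply: (corner_iso FAM RM Rinj Rgood Rsurj (Phi := double_mx U V J (c_ lam))).
- exact: double_mxD.
- exact: (double_mxM (c0 lam) UV UJV UJJ).
- by move=> a X; rewrite /= double_mxZ.
- by move=> A B eqS; apply: (double_mx_inj (c := c_ lam) UV UJV); congr (_ *m _ *m _).
- by move=> A; split=> //; rewrite -S1 -(double_mxM (c0 lam) UV UJV UJJ) mulmx1.
move=> Y gY eY; have PY : Pi g *m Y = Y by rewrite -good_comm_proj.
rewrite -S1 in eY PY; exists (U *m Y *m V).
symmetry; apply: (double_decomp0 (c0 lam) UJJ) => //; first by case: gY.
(* The image under [J] lives on the conjugate shape, whereas Y preserves shapes; this makes the
   component of Y along [J] vanish. *)
have JV : J *m V = Pi [set conj_part lam] *m (J *m V).
  rewrite -{1}PV !mulmxA (fun_mxJ tab_std tab_inj tab_surj cjE); congr (_ *m _ *m _).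
  apply/matrixP=> r q; rewrite !mxE /= !inE lamrcj.
  by rewrite (inj_eq (can_inj (@conj_partK _))).
rewrite -mulmxA JV mulmxA -(mulmxA U Y) good_comm_proj // (mulmxA U) -{1}UP.
rewrite -(mulmxA U) shape_projM (_ : _ :&: _ = set0) ?shape_proj0 ?mulmx0 ?mul0mx //.
by apply/setP=> mu; rewrite !inE; case: eqP => // ->; rewrite (negbTE neq).
Qed.

Lemma self_half_block lam : lam = conj_part lam ->
  exists (U : 'M[F]_((nSYT lam)./2, N)) (V : 'M[F]_(N, (nSYT lam)./2)),
    [/\ [/\ U *m V = 1%:M, U *m J *m V = 0, U *m J *m J = c_ lam *: U
          & J *m J *m V = c_ lam *: V],
        double_mx U V J (c_ lam) 1%:M = Pi [set lam]
      & forall A B, good (double_mx U V J (c_ lam) A + double_mx U V J (c_ lam) B *m J)].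
Proof.
move=> self.
have [||U [V [[UV UJV UJJ JJV] S1 gS _ _]]] := half_block (lam := lam)
  (g := [set lam]) (card_half_set self).
- by move=> r; rewrite inE => /andP[/eqP].
- by move=> r; rewrite mem_half_cj // inE.
exists U, V; split=> // A B; apply: goodD => //.
apply: (good_mulJ tab_std tab_inj tab_surj lamrE cjE self) => //.
by rewrite -S1 -(double_mxM (c0 lam) UV UJV UJJ) mulmx1.
Qed.

Lemma good_decomp lam (U : 'M[F]_((nSYT lam)./2, N)) (V : 'M[F]_(N, (nSYT lam)./2)) Y :
    U *m J *m J = c_ lam *: U ->
    double_mx U V J (c_ lam) 1%:M = Pi [set lam] -> good Y -> Y *m Pi [set lam] = Y ->
  exists A B, Y = double_mx U V J (c_ lam) A + double_mx U V J (c_ lam) B *m J.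
Proof.
move=> UJJ S1 gY eY; have PY : Pi [set lam] *m Y = Y by rewrite -good_comm_proj.
rewrite -S1 in eY PY; have [_ YJ] := gY.
by do 2!eexists; apply: (double_decomp (c0 lam) UJJ YJ eY PY).
Qed.

Lemma self_corner_iso lam : lam = conj_part lam -> (forall x : F, x ^+ 2 != c_ lam) ->
  iso_full_matrix iota (corner (Pi [set lam])) (nSYT lam)./2.
Proof.
move=> self nsq; have [U [V [[UV UJV UJJ JJV] S1 gS]]] := self_half_block self.
have p_gt2 : (2 < p)%N by lia.
(* The scalar has no root in F but one in K, so K is F with this root adjoined, and [J] acts on the
   block like the root. *)
have [y yc] := sqrt_quadratic_ext iota (c_ lam) cardK (odd_card_finField charF p_gt2).
have [Phi [PhiD PhiM PhiZ Phi_inj [onto form]]] :=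
  quad_double_iso cardK yc nsq (c0 lam) UV UJV UJJ JJV.
apply: (corner_iso FAM RM Rinj Rgood Rsurj (Phi := Phi)) => //.
- move=> X; have [A [B ->]] := form X; split=> //.
  rewrite -S1 mulmxDl -mulmxA -(double_mxJ (c0 lam) UJJ JJV) mulmxA.
  by rewrite -!(double_mxM (c0 lam) UV UJV UJJ) !mulmx1.
move=> Y gY eY; have [A [B ->]] := good_decomp UJJ S1 gY eY.
exact: onto.
Qed.

Definition split_idem (y : F) lam : 'M[F]_N :=
  2%:R^-1 *: (Pi [set lam] + y *: (Pi [set lam] *m J)).

Lemma split_corner_iso lam y : lam = conj_part lam -> y ^+ 2 * c_ lam = 1 ->
  iso_full_matrix (@idfun F) (corner (split_idem y lam)) (nSYT lam)./2.
Proof.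
move=> self yc; have [U [V [[UV UJV UJJ JJV] S1 gS]]] := self_half_block self.
have eE : split_idem y lam = split_mx U V J (c_ lam) y 1%:M by rewrite /split_mx S1.
apply: (corner_iso FAM RM Rinj Rgood Rsurj (Phi := split_mx U V J (c_ lam) y)).
- exact: split_mxD.
- exact: (split_mxM (c0 lam) UV UJV UJJ JJV yc two0).
- by move=> a X; rewrite /= split_mxZ.
- exact: (split_mx_inj (c0 lam) UV UJV UJJ two0).
- move=> A; split; first by rewrite split_mxE.
  by rewrite eE -(split_mxM (c0 lam) UV UJV UJJ JJV yc two0) mulmx1.
move=> Y gY eY; have YJ : Y *m J = (y * c_ lam) *: Y.
  by rewrite -eY -mulmxA eE (split_mx_eigen V UJJ yc) -scalemxAr.
have PY : Y *m Pi [set lam] = Y.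
  rewrite -eY -mulmxA; congr (_ *m _); rewrite /split_idem -scalemxAl mulmxDl -scalemxAl.
  rewrite -mulmxA -(shape_projJ F tab_std tab_inj tab_surj lamrE cjE (conj_closed_self self)).
  by rewrite mulmxA shape_projM setIid.
have [A [B YE]] := good_decomp UJJ S1 gY PY.
exists (2%:R *: A); rewrite YE in YJ *.
exact: (split_mx_onto (c0 lam) UV UJV UJJ yc two0 YJ).
Qed.

(** The scalar of [J] and [p_part] differ by the square of some z. Since the scalar is nonzero, so
    is z, and both are squares or neither is. *)
Lemma DeltaP lam : reflect (lam = conj_part lam /\ exists x : F, x ^+ 2 = c_ lam)
  (lam \in Delta F m.+1).
Proof.
have sq : lam = conj_part lam -> exists2 z : F, z != 0 & c_ lam = (p_part lam)%:~R * z ^+ 2.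
  move=> self; have [z zE] := assoc_scalar_p_part self; exists z%:~R; last first.
    by rewrite /lam_scal /assoc_scalar -rmorph_prod /= zE rmorphM rmorphXn.
  apply: contraNneq (c0 lam) => z0.
  by rewrite /lam_scal /assoc_scalar -rmorph_prod /= zE rmorphM rmorphXn /= z0 expr0n mulr0.
rewrite !inE; apply: (iffP andP) => [[/eqP self /existsP[x /eqP xE]] | [self [x xE]]].
  split=> //; have [z _ ->] := sq self; exists (x * z).
  by rewrite exprMn xE.
split; first exact/eqP; have [z z0 cE] := sq self.
apply/existsP; exists (x / z); rewrite exprMn xE cE -mulrA -exprMn mulfV //.
by rewrite expr1n mulr1.
Qed.

Definition scal_root lam : F := odflt 0 [pick x : F | x ^+ 2 == c_ lam].

Lemma scal_rootP lam : lam \in Delta F m.+1 -> scal_root lam ^+ 2 = c_ lam.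
Proof.
case/DeltaP=> _ [x xE]; rewrite /scal_root; case: pickP => [z /eqP // | /(_ x)].
by rewrite xE eqxx.
Qed.

Lemma scal_rootV lam : lam \in Delta F m.+1 -> (scal_root lam)^-1 ^+ 2 * c_ lam = 1.
Proof.
move=> Dlam; have sq := scal_rootP Dlam; rewrite exprVn sq mulVf //; exact: c0.
Qed.

Lemma nSYT_half_gt0 lam : lam = conj_part lam -> (0 < (nSYT lam)./2)%N.
Proof.
move=> self; rewrite -card_half_set //; have [r rE] := lamr_onto tab_surj lamrE lam.
have := mem_half_cj r self; rewrite rE eqxx lt0n cards_eq0 => mem1.
by apply/eqP=> H0; move: mem1; rewrite H0 !inE.
Qed.

Lemma split_idem_sub y lam : lam = conj_part lam ->
  split_idem y lam *m Pi [set lam] = split_idem y lam.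
Proof.
move=> self; rewrite /split_idem -scalemxAl mulmxDl -scalemxAl -mulmxA.
rewrite -(shape_projJ F tab_std tab_inj tab_surj lamrE cjE (conj_closed_self self)).
by rewrite mulmxA shape_projM setIid.
Qed.

Lemma split_idem_orth y lam : lam = conj_part lam -> y ^+ 2 * c_ lam = 1 ->
  split_idem y lam *m split_idem (- y) lam = 0.
Proof.
move=> self yc; have [U [V [[UV UJV UJJ JJV] S1 gS]]] := self_half_block self.
have eE : split_idem y lam = split_mx U V J (c_ lam) y 1%:M by rewrite /split_mx S1.
have eJ : split_idem y lam *m J = (y * c_ lam) *: split_idem y lam.
  by rewrite eE (split_mx_eigen V UJJ yc).
rewrite {2}/split_idem -scalemxAr mulmxDr -scalemxAr mulmxA split_idem_sub // eJ.
by rewrite scalerA mulNr mulrA -expr2 yc scaleN1r subrr scaler0.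
Qed.

Lemma split_idemD y lam : split_idem y lam + split_idem (- y) lam = Pi [set lam].
Proof.
rewrite /split_idem -scalerDr addrACA scaleNr subrr addr0 -mulr2n -scaler_nat.
by rewrite scalerA mulVf ?scale1r.
Qed.

Lemma split_idem_idem y lam : lam = conj_part lam -> y ^+ 2 * c_ lam = 1 ->
  split_idem y lam *m split_idem y lam = split_idem y lam.
Proof.
move=> self yc; rewrite -[RHS]split_idem_sub // -(split_idemD y) mulmxDr.
by rewrite split_idem_orth // addr0.
Qed.

Lemma good_split_idem y lam X : lam = conj_part lam -> good X ->
  good (X *m split_idem y lam).
Proof.
move=> self gX; have gP := good_proj tab_std tab_inj tab_surj lamrE cjE (conj_closed_self self) gX.
rewrite /split_idem -scalemxAr mulmxDr -scalemxAr; apply: goodZ; apply: goodD => //.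
rewrite mulmxA; apply: goodZ; apply: (good_mulJ tab_std tab_inj tab_surj lamrE cjE self gP).
by rewrite -mulmxA shape_projM setIid.
Qed.

Lemma good_comm_split y lam X : good X -> X *m split_idem y lam = split_idem y lam *m X.
Proof.
move=> gX; have [_ XJ] := gX; rewrite /split_idem -scalemxAr -scalemxAl mulmxDr mulmxDl.
by rewrite -scalemxAr -scalemxAl mulmxA good_comm_proj // -!mulmxA XJ.
Qed.

Lemma minimal_pair lam : lam != conj_part lam ->
  minimal_mx_ideal FA (corner (Pi [set lam; conj_part lam])).
Proof.
move=> neq; apply: minimal_ideal_full_matrix (nSYT_gt0 lam) _ _ (pair_corner_iso neq).
  exact: corner_sub.
by apply: (corner_ideal FAM RM Rgood) => X; apply: good_comm_proj.
Qed.

Lemma minimal_self lam : lam = conj_part lam -> (forall x : F, x ^+ 2 != c_ lam) ->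
  minimal_mx_ideal FA (corner (Pi [set lam])).
Proof.
move=> self nsq; apply: minimal_ideal_full_matrix (nSYT_half_gt0 self) _ _ (self_corner_iso self nsq).
  exact: corner_sub.
by apply: (corner_ideal FAM RM Rgood) => X; apply: good_comm_proj.
Qed.

Lemma minimal_split lam y : lam = conj_part lam -> y ^+ 2 * c_ lam = 1 ->
  minimal_mx_ideal FA (corner (split_idem y lam)).
Proof.
move=> self yc; apply: minimal_ideal_full_matrix (nSYT_half_gt0 self) _ _ (split_corner_iso self yc).
  exact: corner_sub.
by apply: (corner_ideal FAM RM Rgood) => X; apply: good_comm_split.
Qed.

Local Notation IGam := (fun g : {set part m.+1} => corner (Pi g)).
Local Notation Iself := (fun lam : part m.+1 => corner (Pi [set lam])).
Local Notation Iplus := (fun lam : part m.+1 => corner (split_idem (scal_root lam)^-1 lam)).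
Local Notation Iminus := (fun lam : part m.+1 => corner (split_idem (- (scal_root lam)^-1) lam)).
Local Notation total := (\sum_(g in Gamma m.+1) IGam g
  + \sum_(lam in selfconj m.+1 | lam \notin Delta F m.+1) Iself lam
  + \sum_(lam in Delta F m.+1) (Iplus lam + Iminus lam))%MS.

(** The diagonal entry at a tableau of shape L counts the index sets containing L, and L belongs to
    exactly one of them. *)
Lemma shape_proj_sum : \sum_(g in Gamma m.+1) Pi g
  + \sum_(lam in selfconj m.+1 | lam \notin Delta F m.+1) Pi [set lam]
  + \sum_(lam in Delta F m.+1) Pi [set lam] = 1%:M.
Proof.
have sumE (I : finType) (P : pred I) (g : I -> {set part m.+1}) r q :
    (\sum_(i | P i) Pi (g i)) r q = (\sum_(i | P i) (lamr r \in g i))%:R *+ (r == q).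
  by rewrite summxE natr_sum -sumrMnl; apply: eq_bigr => i _; rewrite !mxE.
apply/matrixP=> r q; rewrite 2!mxE !sumE -!mulrnDl -!natrD [RHS]mxE; set L := lamr r.
suff -> : (\sum_(i in Gamma m.+1) (L \in i) +
    \sum_(i in selfconj m.+1 | i \notin Delta F m.+1) (L \in [set i]) +
    \sum_(i in Delta F m.+1) (L \in [set i]) = 1)%N by [].
have [self | nself] := eqVneq L (conj_part L).
  rewrite big1 => [|g Gg]; last first.
    by case LgE: (L \in g) => //; have [_] := Gamma_block Gg LgE; rewrite -self eqxx.
  have [DL | nDL] := boolP (L \in Delta F m.+1).
    rewrite big1 => [|mu /andP[_ nD]]; last first.
      by rewrite inE; case: eqP => // LE; rewrite -LE DL in nD.
    rewrite (bigD1 L) //= inE eqxx big1 // => mu /andP[_ neq].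
    by rewrite inE eq_sym (negbTE neq).
  rewrite (bigD1 L) /=; last by rewrite nDL inE -self eqxx.
  rewrite inE eqxx !big1 // => mu.
    by move=> DM; rewrite inE; case: eqP => // LE; rewrite LE DM in nDL.
  by case/andP=> _ neq; rewrite inE eq_sym (negbTE neq).
rewrite (bigD1 _ (Gamma_pair nself)) /= !inE eqxx /= !big1 //.
- move=> mu /DeltaP[self _]; rewrite inE; case: eqP => // LE.
  by rewrite LE -self eqxx in nself.
- move=> mu; rewrite inE => /andP[/eqP self _]; rewrite inE; case: eqP => // LE.
  by rewrite LE -self eqxx in nself.
move=> g /andP[Gg neq]; case LgE: (L \in g) => //.
by have [gE _] := Gamma_block Gg LgE; rewrite gE eqxx in neq.
Qed.

(** The image [R A] is cut by the central idempotents, whose sum is 1; each piece lifts to its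
    corner, and injectivity of [R] identifies A with the sum of the lifts. *)
Lemma group_ring_total : (FA :=: total)%MS.
Proof.
apply/eqmxP/andP; split; last first.
  rewrite !addsmx_sub; apply/andP; split; first (apply/andP; split).
  - by apply/sumsmx_subP=> g _; apply: corner_sub.
  - by apply/sumsmx_subP=> lam _; apply: corner_sub.
  by apply/sumsmx_subP=> lam _; rewrite addsmx_sub !corner_sub.
apply/memmx_subP=> A FA_A.
pose inT X := exists B, [/\ (B \in FA)%MS, (B \in total)%MS & R B = X].
have inTD X Y : inT X -> inT Y -> inT (X + Y).
  case=> [B [FB TB <-]] [C [FC TC <-]]; exists (B + C).
  by split; [apply: memmxD | apply: memmxD | apply: linearD].
have inT0 : inT 0 by exists 0; rewrite !linear0; split; rewrite ?sub0mx.
have inT_sum (I : finType) (P : pred I) (X : I -> 'M_N) :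
    (forall i, P i -> inT (X i)) -> inT (\sum_(i | P i) X i).
  by move=> iX; apply: big_ind.
have inT_corner e : good (R A *m e) -> R A *m e *m e = R A *m e ->
    (corner e <= total)%MS -> inT (R A *m e).
  move=> gAe eAe le; have [B cB RB] := corner_lift Rsurj gAe eAe.
  exists B; split=> //; last exact: submx_trans cB le.
  by apply: submx_trans cB (corner_sub _ _ _).
have gA := Rgood FA_A.
have proj_id g : R A *m Pi g *m Pi g = R A *m Pi g by rewrite -mulmxA shape_projM setIid.
suff [B [FB TB RB]] : inT (R A) by rewrite -(Rinj2 Rinj FB FA_A RB).
rewrite -[R A]mulmx1 -shape_proj_sum 2!mulmxDr !mulmx_sumr.
apply: (inTD _ _); first apply: (inTD _ _); apply: inT_sum.
- move=> g Gg; apply: inT_corner => //.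
    apply: (good_proj tab_std tab_inj tab_surj lamrE cjE) => //.
    by case/imsetP: Gg => lam _ ->; apply: conj_closed_pair.
  by rewrite -addsmxA; apply: submx_trans (addsmxSl _ _); apply: (sumsmx_sup g).
- move=> lam /andP[]; rewrite inE => /eqP self nD; apply: inT_corner => //.
    apply: (good_proj tab_std tab_inj tab_surj lamrE cjE) => //.
    exact: conj_closed_self.
  apply: submx_trans (addsmxSl _ _); apply: submx_trans (addsmxSr _ _).
  by apply: (sumsmx_sup lam); rewrite // nD inE -self eqxx.
move=> lam Dlam; have [self _] := DeltaP _ Dlam.
have yc := scal_rootV Dlam; have yc' : (- (scal_root lam)^-1) ^+ 2 * c_ lam = 1.
  by rewrite sqrrN.
rewrite -(split_idemD (scal_root lam)^-1) mulmxDr.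
have le_D : (Iplus lam + Iminus lam <= total)%MS.
  by apply: submx_trans (addsmxSr _ _); apply: (sumsmx_sup lam).
have inT_split y : y ^+ 2 * c_ lam = 1 -> (corner (split_idem y lam) <= total)%MS ->
    inT (R A *m split_idem y lam).
  move=> yc2 le; apply: inT_corner => //; first exact: good_split_idem.
  by rewrite -mulmxA split_idem_idem.
apply: (inTD _ _).
  by apply: inT_split yc _; apply: submx_trans le_D; apply: addsmxSl.
by apply: inT_split yc' _; apply: submx_trans le_D; apply: addsmxSr.
Qed.

Lemma corners_sub (I : finType) (P : pred I) (e : I -> 'M[F]_N) f :
  (forall i, P i -> e i *m f = e i) -> (\sum_(i | P i) corner (e i) <= corner f)%MS.
Proof.
by move=> ef; apply/sumsmx_subP=> i Pi_; apply: cornerS; apply: ef.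
Qed.

Lemma shape_proj_disj (g h : {set part m.+1}) : [disjoint g & h] -> Pi g *m Pi h = 0.
Proof. by rewrite shape_projM -setI_eq0 => /eqP->; rewrite shape_proj0. Qed.

Lemma shape_proj_subset (g h : {set part m.+1}) : g \subset h -> Pi g *m Pi h = Pi g.
Proof. by rewrite shape_projM => /setIidPl->. Qed.

Lemma cap_corners0 k l (A : 'M[F]_(k, _)) (B : 'M[F]_(l, _)) e f :
  (A <= corner e)%MS -> (B <= corner f)%MS -> e *m f = 0 -> (A :&: B = 0)%MS.
Proof.
move=> Ae Bf ef; apply/eqP; rewrite -submx0 -(corner_cap0 (FA := FA) Rinj ef).
exact: capmxS.
Qed.

(** Every partial sum lies in the corner of an idempotent, and corners of orthogonal idempotents
    meet in 0. Except within a pair of split ideals, orthogonality is disjointness of sets of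
    shapes. *)
Lemma direct_total : mxdirect total.
Proof.
pose NS := [set lam : part m.+1 | lam != conj_part lam].
pose SN := [set lam in selfconj m.+1 | lam \notin Delta F m.+1].
have leG : (\sum_(g in Gamma m.+1) IGam g <= corner (Pi NS))%MS.
  apply: corners_sub => g Gg; apply: shape_proj_subset; apply/subsetP=> mu gmu.
  by rewrite inE; have [] := Gamma_block Gg gmu.
have leS : (\sum_(lam in selfconj m.+1 | lam \notin Delta F m.+1) Iself lam
    <= corner (Pi SN))%MS.
  by apply: corners_sub => lam Plam; apply: shape_proj_subset; rewrite sub1set inE.
have le_pm lam : lam \in Delta F m.+1 -> (Iplus lam + Iminus lam <= Iself lam)%MS.
  case/DeltaP=> self _; rewrite addsmx_sub; apply/andP.
  by split; apply: cornerS; apply: split_idem_sub.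
have leD (h : {set part m.+1}) : (\sum_(lam in h | lam \in Delta F m.+1)
    (Iplus lam + Iminus lam) <= corner (Pi h))%MS.
  apply/sumsmx_subP=> lam /andP[hlam Dlam]; apply: submx_trans (le_pm _ Dlam) _.
  by apply: cornerS; apply: shape_proj_subset; rewrite sub1set.
rewrite mxdirect_addsE mxdirect_addsE /=; apply/and3P; split; first (apply/and3P; split).
- apply/mxdirect_sumsP=> g Gg; apply: (cap_corners0 (submx_refl _) (f := Pi (~: g))).
    apply: corners_sub => h /andP[Gh neq]; apply: shape_proj_subset.
    apply/subsetP=> mu hmu; rewrite inE; apply: contra neq => gmu.
    have [-> _] := Gamma_block Gg gmu; have [-> _] := Gamma_block Gh hmu.
    exact: eqxx.
  by apply: shape_proj_disj; rewrite -setI_eq0 setICr.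
- apply/mxdirect_sumsP=> lam _; apply: (cap_corners0 (submx_refl _) (f := Pi (~: [set lam]))).
    apply: corners_sub => mu /andP[_ neq]; apply: shape_proj_subset.
    by rewrite sub1set !inE.
  by apply: shape_proj_disj; rewrite -setI_eq0 setICr.
- apply/eqP; apply: (cap_corners0 leG leS); apply: shape_proj_disj.
  rewrite -setI_eq0; apply/eqP/setP=> mu; rewrite !inE.
  by case: eqP; rewrite ?andbF.
- apply/mxdirect_sumsE; split=> [lam Dlam | ] /=.
    rewrite mxdirect_addsE !mxdirect_trivial /=; apply/eqP.
    have [self _] := DeltaP _ Dlam.
    apply: (cap_corners0 (submx_refl _) (submx_refl _)).
    by apply: split_idem_orth => //; apply: scal_rootV.
  apply/mxdirect_sumsP=> lam Dlam.
  apply: (cap_corners0 (le_pm _ Dlam) (f := Pi (~: [set lam]))).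
    apply: submx_trans (leD _); apply/sumsmx_subP=> mu /andP[Dmu neq].
    by apply: (sumsmx_sup mu); rewrite // Dmu !inE neq.
  by apply: shape_proj_disj; rewrite -setI_eq0 setICr.
apply/eqP; apply: (cap_corners0 (e := Pi (~: Delta F m.+1)) (f := Pi (Delta F m.+1))).
- rewrite addsmx_sub; apply/andP; split.
    apply: submx_trans leG _; apply: cornerS; apply: shape_proj_subset.
    apply/subsetP=> mu; rewrite !in_set; apply: contra => /andP[/eqP self _].
    by rewrite {1}self eqxx.
  apply: submx_trans leS _; apply: cornerS; apply: shape_proj_subset.
  by apply/subsetP=> mu; rewrite inE => /andP[_ nD]; rewrite inE.
- apply: submx_trans (leD _); apply/sumsmx_subP=> mu Dmu.
  by apply: (sumsmx_sup mu); rewrite // Dmu.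
by apply: shape_proj_disj; rewrite -setI_eq0 setIC setICr.
Qed.

End Wedderburn.

(** Stating mere existence hides the enumeration, so that the final proof sees only these two
    properties of [tab]. *)
Lemma enum_val_set_std m : exists tab : 'I_#|[set t : {ffun 'I_m.+1 -> 'I_m.+1 * 'I_m.+1} | std t]| ->
    {ffun 'I_m.+1 -> 'I_m.+1 * 'I_m.+1},
  injective tab /\ forall t, (t \in codom tab) = std t.
Proof.
exists (fun r => enum_val r); split; first exact: enum_val_inj.
move=> t; apply/codomP/idP => [[r ->] | st]; first by have := enum_valP r; rewrite inE.
have At : t \in [set t : {ffun 'I_m.+1 -> 'I_m.+1 * 'I_m.+1} | std t] by rewrite inE.
by exists (enum_rank_in At t); rewrite enum_rankK_in.
Qed.

Theorem mainTheorem5 (F K : finFieldType) (iota : {rmorphism F -> K})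
    (cardK : #|K| = (#|F| ^ 2)%N)
    (p n : nat) (charF : p \in [pchar F]) (n_gt1 : (1 < n)%N)
    (n_lt_p : (n < p)%N) :
  let FA := group_ring F ('Alt_('I_n))%G in
  exists (IGam : {set part n} -> 'A[F]_#|('Alt_('I_n))%g|)
         (I Iplus Iminus : part n -> 'A[F]_#|('Alt_('I_n))%g|),
    [/\ (FA :=: \sum_(g in Gamma n) IGam g
                + \sum_(lam in selfconj n | lam \notin Delta F n) I lam
                + \sum_(lam in Delta F n) (Iplus lam + Iminus lam))%MS,
        mxdirect (\sum_(g in Gamma n) IGam g
                  + \sum_(lam in selfconj n | lam \notin Delta F n) I lam
                  + \sum_(lam in Delta F n) (Iplus lam + Iminus lam))%MS,
        forall lam : part n, lam <> conj_part lam ->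
          minimal_mx_ideal FA (IGam [set lam; conj_part lam])
          /\ iso_full_matrix (@idfun F) (IGam [set lam; conj_part lam]) (nSYT lam),
        forall lam : part n, lam = conj_part lam -> lam \notin Delta F n ->
          minimal_mx_ideal FA (I lam)
          /\ iso_full_matrix iota (I lam) (nSYT lam)./2
      & forall lam : part n, lam \in Delta F n ->
          [/\ minimal_mx_ideal FA (Iplus lam),
              iso_full_matrix (@idfun F) (Iplus lam) (nSYT lam)./2,
              minimal_mx_ideal FA (Iminus lam)
            & iso_full_matrix (@idfun F) (Iminus lam) (nSYT lam)./2]].
Proof.
case: n n_gt1 n_lt_p => // m m_gt0 ltmp FA.
have [tab [tab_inj tabE]] := enum_val_set_std m.
have tab_std r : std (tab r) by rewrite -tabE; exact: codom_f.
have tab_surj t : std t -> exists r, tab r = t.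
  by rewrite -tabE => /codomP[r ->]; exists r.
have [rho [rho1 rhoM rho_adj]] := seminormal_repr charF ltmp tab_std tab_inj tab_surj.
have rhoP : mx_repr 'Sym_('I_m.+1)%G rho by split.
pose rG := MxRepresentation rhoP.
have rG_adj i : (i < m)%N -> rG (adj_tperm m i) = semi_mx F tab i by apply: rho_adj.
have [lamr lamrE] : exists lamr, forall r, diagram (lamr r) = shape (tab r).
  apply: (fin_all_exists (P := fun r lam => diagram lam = shape (tab r))) => r.
  by apply: ideal_diagram; rewrite ?std_shape ?card_shape.
have [cj cjE] : exists cj, forall r, tab (cj r) = tconj (tab r).
  apply: (fin_all_exists (P := fun r q => tab q = tconj (tab r))) => r.
  by apply: tab_surj; rewrite std_tconj.
pose R := gring_op (subg_repr rG (Alt_subset 'I_m.+1)).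
(* The inverse of the root appears because y^2 c = 1 is what makes (1 + y J) / 2 and (1 - y J) / 2
   idempotent on the block. *)
pose e lam := split_idem tab lamr (scal_root F lam)^-1 lam.
pose e' lam := split_idem tab lamr (- (scal_root F lam)^-1) lam.
exists (fun g => corner FA R (shape_proj F lamr g)).
exists (fun lam => corner FA R (shape_proj F lamr [set lam])).
exists (fun lam => corner FA R (e lam)), (fun lam => corner FA R (e' lam)).
split.
- exact: (group_ring_total charF ltmp m_gt0 tab_std tab_inj tab_surj rG_adj lamrE cjE).
- exact: (direct_total charF ltmp m_gt0 tab_std tab_inj tab_surj rG_adj lamrE cjE).
- move=> lam /eqP neq; split.
    exact: (minimal_pair charF ltmp m_gt0 tab_std tab_inj tab_surj rG_adj lamrE cjE).
  exact: (pair_corner_iso charF ltmp m_gt0 tab_std tab_inj tab_surj rG_adj lamrE cjE).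
- move=> lam self nD.
  have nsq x : x ^+ 2 != lam_scal F lam.
    apply: contra nD => /eqP xE.
    by apply/(DeltaP charF ltmp tab_std tab_surj lamrE); split=> //; exists x.
  split.
    exact: (minimal_self iota cardK charF ltmp m_gt0 tab_std tab_inj tab_surj rG_adj lamrE cjE).
  exact: (self_corner_iso iota cardK charF ltmp m_gt0 tab_std tab_inj tab_surj rG_adj lamrE cjE).
move=> lam Dlam.
have [self _] := DeltaP charF ltmp tab_std tab_surj lamrE _ Dlam.
have yc := scal_rootV charF ltmp tab_std tab_surj lamrE Dlam.
have yc' : (- (scal_root F lam)^-1) ^+ 2 * lam_scal F lam = 1 by rewrite sqrrN.
split.
- exact: (minimal_split charF ltmp m_gt0 tab_std tab_inj tab_surj rG_adj lamrE cjE self yc).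
- exact: (split_corner_iso charF ltmp m_gt0 tab_std tab_inj tab_surj rG_adj lamrE cjE self yc).
- exact: (minimal_split charF ltmp m_gt0 tab_std tab_inj tab_surj rG_adj lamrE cjE self yc').
exact: (split_corner_iso charF ltmp m_gt0 tab_std tab_inj tab_surj rG_adj lamrE cjE self yc').
Qed.
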